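(* For every integer $n \geq 301$, $$3\left(\Delta p(n+2)\right)^2-4\,\Delta p(n+1)\,\Delta p(n+3)+\Delta p(n)\,\Delta p(n+4)>0,$$ where $p(n)$ is the number of partitions of $n$ and $\Delta p(n)=p(n+1)-p(n)$.
   Context: A partition of a positive integer $n$ is a non-increasing sequence of positive integers $\lambda=(\lambda_1,\ldots,\lambda_\ell)$ with $\sum_{i=1}^{\ell}\lambda_i=n$; $p(n)$ denotes the number of partitions of $n$. The first-order forward difference of a sequence $f(n)$ is $\Delta f(n)=f(n+1)-f(n)$. The inequality is called the Laguerre inequality of order $2$ for the sequence $\Delta p(n)$. *)

(* Defs.v *)
From mathcomp Require Import all_boot all_order all_algebra.

Set Implicit Arguments.
Unset Strict Implicit.
Unset Printing Implicit Defensive.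

Import GRing.Theory.
Local Open Scope ring_scope.

Definition is_partition (n : nat) (s : seq nat) : bool :=
  [&& sorted geq s, all (ltn 0) s & sumn s == n].

(* A partition of n has at most n parts, each of them at most n, so all of
   them are found in the finite type of sequences of length at most n over
   'I_n.+1; see is_partitionP. *)
Definition partitions (n : nat) : {set {bseq n of 'I_n.+1}} :=
  [set b : {bseq n of 'I_n.+1} | is_partition n (map val b)].

Definition npart (n : nat) : nat := #|partitions n|.

Definition fdiff (f : nat -> nat) (n : nat) : int := (f n.+1)%:Z - (f n)%:Z.

Lemma is_partitionP (n : nat) (s : seq nat) :
  reflect (exists2 b : {bseq n of 'I_n.+1}, b \in partitions n & map val b = s)
          (is_partition n s).
Proof.
apply: (iffP idP) => [Ps|[b]]; last by rewrite inE => Pb <-.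
have /and3P[_ s_gt0 /eqP sum_s] := Ps.
have size_s : (size s <= n)%N.
  rewrite -sum_s; elim: s s_gt0 {Ps sum_s} => //= x s IHs /andP[x_gt0 /IHs].
  by rewrite -add1n; apply: leq_add.
have s_le_n x : x \in s -> (x < n.+1)%N.
  rewrite ltnS -sum_s; elim: s {Ps s_gt0 sum_s size_s} => //= y s IHs.
  rewrite inE => /predU1P[->|/IHs]; first exact: leq_addr.
  by move/leq_trans; apply; apply: leq_addl.
have size_b : (size (map (@inord n) s) <= n)%N by rewrite size_map.
have val_b : map val (map (@inord n) s) = s.
  rewrite -map_comp -[RHS]map_id; apply/eq_in_map => x /s_le_n x_lt /=.
  exact: inordK.
by exists (Bseq size_b); rewrite ?inE /= val_b.
Qed.

Lemma partition_seq_inj (n : nat) :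
  injective (fun b : {bseq n of 'I_n.+1} => map val b).
Proof. by move=> b1 b2 /(inj_map val_inj)/val_inj. Qed.

(* Main.v *)
(** Idea.  Let [b j] be the number of partitions of [j] without part 1, so that
    [Delta p (j - 1) = b j].  Up to a positive factor [exp (j s)], [b j] is the
    integral over [0, PI] of [A x * cos (psi x - j x)], where [A] and [psi] are
    the normalised modulus and the argument of the generating function of [b]
    on the circle of radius [exp (- s)].  Choose [s] so that [psi x - n x] has
    no linear term at [0], and call it [- H x].  With
    [e k], [O] and [o] the integrals of [A * cos H * (1 - cos x) ^ k],
    [A * sin H * sin x] and [A * sin H * sin x * (1 - cos x)], the Laguerre
    expression centred at [n] is a positive multiple of
    [12 (e 1)^2 + 4 (e 0) (e 2) + 4 (e 2)^2 - 16 (e 1) (e 2) + 8 o O - 4 o^2]: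
    the alternating sum 3 - 4 + 1 cancels all but fourth order terms, so no
    asymptotic expansion of [p n] is needed, only the second and fourth moments
    of [A], which is close to a Gaussian of variance [1 / K2], and the bound
    [0 <= H x <= K3 x ^ 3 / 6].  The cumulants [K2], [K3], [K4] are estimated
    by elementary means, and all constants are good enough for [s <= 1 / 60],
    that is for [n >= 5941].  The remaining cases are computed with the
    pentagonal number recurrence, proved from Shanks' finite identity. *)

From Stdlib Require Import Reals Ranalysis5 ZArith Lra Lia.
From Coquelicot Require Import Coquelicot.
Require Import Defs.
From mathcomp Require Import all_boot all_order all_algebra.
Set Implicit Arguments.
Unset Strict Implicit.

Section Analysis.
Local Open Scope R_scope.

(** * Finite sums and the polylogarithms of non-positive order *)

(** The product over the parts is truncated to [2, ..., k + 1] with [k] about [4 n^2]: the counts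
    needed are then exact, the truncation is invisible in the cumulants, and all sums and products
    are finite. Fourier coefficients are matched with counts through a common recurrence in [k], so
    no power series occurs. The difficulty lies in the constants. In the Gaussian model
    [e 1 = a / (2 K2)] and [e 2 = 3 a / (4 K2^2)], so the expression is about [6 (a / K2)^2]. The
    phase perturbs this by multiples of [K3^2 / K2^3], which is of order [s] but comes with the
    Gaussian moments 15, 105 and 945; at [s = 1 / 60] about a fifth of the main term survives. A
    smaller limit on [s] would enlarge the computed range, as [n] grows like [1.65 / s^2], and
    [1.65 * 60^2 = 5940] explains the threshold. Two upper bounds for [A] are needed: the one with
    the fourth cumulant is Gaussian near 0 but becomes useless when [x] is close to [s], where a
    bound valid on the whole circle takes over. *)

Fixpoint rsum (n : nat) (f : nat -> R) : R :=
  if n is k.+1 then rsum k f + f k else 0.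

Lemma rsumS n f : rsum n.+1 f = rsum n f + f n. Proof. by []. Qed.

Lemma rsum_le n f g :
  (forall i, (i < n)%N -> f i <= g i) -> rsum n f <= rsum n g.
Proof.
elim: n => [|n IHn] le_fg /=; first by lra.
apply: Rplus_le_compat; last by apply: le_fg.
by apply: IHn => i lt_in; apply: le_fg; rewrite ltnS ltnW.
Qed.

Lemma rsum_ext n f g :
  (forall i, (i < n)%N -> f i = g i) -> rsum n f = rsum n g.
Proof.
elim: n => [//|n IHn] eq_fg /=; rewrite eq_fg // IHn // => i lt_in.
by apply: eq_fg; rewrite ltnS ltnW.
Qed.

Lemma rsum_plus n f g : rsum n (fun i => f i + g i) = rsum n f + rsum n g.
Proof. by elim: n => [|n IHn] /=; [lra | rewrite IHn; lra]. Qed.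

Lemma rsum_scal n c f : rsum n (fun i => c * f i) = c * rsum n f.
Proof. by elim: n => [|n IHn] /=; [lra | rewrite IHn; lra]. Qed.

Lemma rsum_nonneg n f : (forall i, (i < n)%N -> 0 <= f i) -> 0 <= rsum n f.
Proof.
move=> f_ge0; apply: Rle_trans (rsum_le f_ge0).
by elim: n {f_ge0} => [|n IHn] /=; lra.
Qed.

Lemma rsum_exchange n k (f : nat -> nat -> R) :
  rsum n (fun i => rsum k (f i)) = rsum k (fun j => rsum n (f^~ j)).
Proof.
elim: n => [|n IHn] /=; last by rewrite IHn -rsum_plus.
by elim: k => [|k IHk] /=; rewrite -?IHk; lra.
Qed.

Lemma rsumSl n f : rsum n.+1 f = f 0%N + rsum n (fun i => f i.+1).
Proof. by elim: n => [|n IHn] /=; [lra | rewrite -Rplus_assoc -IHn /=]. Qed.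

(* The sum of the series [sum_(k >= 1) k^j r^k], for [j <= 4]. *)
Definition polylog (j : nat) (r : R) : R :=
  match j with
  | 0%nat => r / (1 - r)
  | 1%nat => r / (1 - r) ^ 2
  | 2%nat => r * (1 + r) / (1 - r) ^ 3
  | 3%nat => r * (1 + 4 * r + r ^ 2) / (1 - r) ^ 4
  | _ => r * (1 + 11 * r + 11 * r ^ 2 + r ^ 3) / (1 - r) ^ 5
  end.

(* [r ^ n] times this is the tail [sum_(k > n) k^j r^k]. *)
Definition polylog_tail (j : nat) (n r : R) : R :=
  match j with
  | 0%nat => polylog 0 r
  | 1%nat => n * polylog 0 r + polylog 1 r
  | 2%nat => n ^ 2 * polylog 0 r + 2 * n * polylog 1 r + polylog 2 r
  | 3%nat => n ^ 3 * polylog 0 r + 3 * n ^ 2 * polylog 1 r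
             + 3 * n * polylog 2 r + polylog 3 r
  | _ => n ^ 4 * polylog 0 r + 4 * n ^ 3 * polylog 1 r
         + 6 * n ^ 2 * polylog 2 r + 4 * n * polylog 3 r + polylog 4 r
  end.

(** By the binomial theorem [polylog_tail] is [sum_(k >= 1) (n + k)^j r^k]. With these closed forms
    the induction step is an identity of rational functions, and no convergence is involved. *)
Lemma polylog_partial j r n : (j <= 4)%N -> r < 1 ->
  rsum n (fun k => INR k.+1 ^ j * r ^ k.+1)
  = polylog j r - r ^ n * polylog_tail j (INR n) r.
Proof.
move=> le_j4 r_lt1; have r_neq1 : 1 - r <> 0 by lra.
elim: n => [|n IHn].
  by case: j le_j4 => [|[|[|[|[|//]]]]] _; rewrite /= /polylog; field.
rewrite rsumS {}IHn; cbv beta; rewrite S_INR -!tech_pow_Rmult.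
by case: j le_j4 => [|[|[|[|[|//]]]]] _; rewrite /polylog_tail /polylog /=; field.
Qed.

Lemma polylog_pos j r : 0 < r < 1 -> 0 < polylog j r.
Proof.
move=> [r_gt0 r_lt1]; have r1_gt0 : 0 < 1 - r by lra.
case: j => [|[|[|[|j]]]] /=; apply: Rdiv_lt_0_compat;
  by [lra | nra | repeat apply: Rmult_lt_0_compat; nra].
Qed.

Lemma polylog_tail_ge0 j n r : 0 <= n -> 0 < r < 1 -> 0 <= polylog_tail j n r.
Proof.
move=> n_ge0 r01; have T_gt0 k := polylog_pos k r01.
have npow_T c k i : 0 <= c -> 0 <= c * n ^ k * polylog i r.
  move=> c_ge0; apply: Rmult_le_pos; last exact: Rlt_le.
  by apply: Rmult_le_pos => //; apply: pow_le.
move: (T_gt0 0%N) (T_gt0 1%N) (T_gt0 2%N) (T_gt0 3%N) (T_gt0 4%N).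
move: (npow_T 1 1%N 0%N) (npow_T 1 2%N 0%N) (npow_T 2 1%N 1%N)
  (npow_T 1 3%N 0%N) (npow_T 3 2%N 1%N) (npow_T 3 1%N 2%N)
  (npow_T 1 4%N 0%N) (npow_T 4 3%N 1%N) (npow_T 6 2%N 2%N) (npow_T 4 1%N 3%N).
case: j => [|[|[|[|j]]]]; rewrite /polylog_tail ?pow_1; lra.
Qed.

Lemma rsum_polylog_le j r n : (j <= 4)%N -> 0 < r < 1 ->
  rsum n (fun k => INR k.+1 ^ j * r ^ k.+1) <= polylog j r.
Proof.
move=> le_j4 r01; rewrite polylog_partial //; last by lra.
have := pow_le r n; have := polylog_tail_ge0 j (pos_INR n) r01; nra.
Qed.

Lemma exp_mulr_nat n x : exp (INR n * x) = exp x ^ n.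
Proof.
elim: n => [|n IHn]; first by rewrite /= Rmult_0_l exp_0.
by rewrite S_INR Rmult_plus_distr_r Rmult_1_l exp_plus IHn /= Rmult_comm.
Qed.

(** This is [y / k <= exp (y / k)] raised to the power [k]. It serves where only fast decay matters,
    not the constant. *)
Lemma exp_neg_le_pow k y : 0 < y -> exp (- y) <= (INR k / y) ^ k.
Proof.
case: k => [|k] y_gt0.
  by rewrite pow_O -exp_0; case: (Rle_lt_or_eq_dec 0 y); try lra;
     move=> ?; apply/Rlt_le/exp_increasing; lra.
have k_gt0 : 0 < INR k.+1 by apply: lt_0_INR; lia.
have -> : exp (- y) = / exp (y / INR k.+1) ^ k.+1.
  by rewrite exp_Ropp -exp_mulr_nat; congr (/ exp _); field; lra.
have -> : INR k.+1 / y = / (y / INR k.+1) by field; lra.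
have y_k : 0 < y / INR k.+1 by apply: Rdiv_lt_0_compat.
rewrite -pow_inv; apply: pow_incr; split.
  by apply/Rlt_le/Rinv_0_lt_compat/exp_pos.
apply: Rinv_le_contravar => //; have := exp_ineq1_le (y / INR k.+1); lra.
Qed.

Lemma polylog_tail_vanish j x : (j <= 3)%N -> 0 < x ->
  exists2 C, 0 <= C & forall n, (0 < n)%N ->
    exp (- x) ^ n * polylog_tail j (INR n) (exp (- x)) <= C / INR n.
Proof.
move=> le_j3 x_gt0; set r := exp (- x).
have r01 : 0 < r < 1.
  by split; [apply: exp_pos | rewrite -exp_0; apply: exp_increasing; lra].
have T_gt0 k := polylog_pos k r01.
(* The tail polynomial is at most [n^4] times its coefficients, with 8 dominating the binomial ones,
   while [r^n <= (5 / (x n))^5]; one factor [1 / n] is left over. *)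
exists ((5 / x) ^ 5 * (8 * (polylog 0 r + polylog 1 r + polylog 2 r + polylog 3 r))).
  apply: Rmult_le_pos; first by apply/pow_le/Rlt_le/Rdiv_lt_0_compat; lra.
  by move: (T_gt0 0%N) (T_gt0 1%N) (T_gt0 2%N) (T_gt0 3%N); lra.
move=> n n_gt0; have n_ge1 : 1 <= INR n by apply: (le_INR 1); apply/leP.
set m := INR n in n_ge1 *.
have tail_le : polylog_tail j m r
    <= m ^ 4 * (8 * (polylog 0 r + polylog 1 r + polylog 2 r + polylog 3 r)).
  move: (T_gt0 0%N) (T_gt0 1%N) (T_gt0 2%N) (T_gt0 3%N).
  have m2 : m <= m ^ 2 by rewrite /= Rmult_1_r; nra.
  have m3 : m ^ 2 <= m ^ 3 by rewrite /= Rmult_1_r; nra.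
  have m4 : m ^ 3 <= m ^ 4 by rewrite /= Rmult_1_r; have : 0 <= m * (m * m); nra.
  have mono k u : u <= m ^ 4 -> u * polylog k r <= m ^ 4 * polylog k r.
    by move=> le_u; apply: Rmult_le_compat_r => //; apply/Rlt_le.
  have := (mono 0%N 1 ltac:(lra)); have := (mono 0%N m ltac:(lra)).
  have := (mono 0%N (m ^ 2) ltac:(lra)); have := (mono 0%N (m ^ 3) ltac:(lra)).
  have := (mono 1%N 1 ltac:(lra)); have := (mono 1%N m ltac:(lra)).
  have := (mono 1%N (m ^ 2) ltac:(lra)); have := (mono 2%N 1 ltac:(lra)).
  have := (mono 2%N m ltac:(lra)); have := (mono 3%N 1 ltac:(lra)).
  case: j le_j3 => [|[|[|[|//]]]] _; rewrite /polylog_tail; lra.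
have rn_le : r ^ n <= (5 / x) ^ 5 / m ^ 5.
  rewrite -exp_mulr_nat -/m Ropp_mult_distr_r_reverse.
  apply: Rle_trans (exp_neg_le_pow 5 _) _; first by nra.
  by apply: Req_le; rewrite /=; field; lra.
have rn_ge0 : 0 <= r ^ n by apply: pow_le; lra.
apply: Rle_trans (Rmult_le_compat_l _ _ _ rn_ge0 tail_le) _.
rewrite -/m; set S := 8 * _; have S_ge0 : 0 <= m ^ 4 * S.
  apply: Rmult_le_pos; first by apply: pow_le; lra.
  by rewrite /S; move: (T_gt0 0%N) (T_gt0 1%N) (T_gt0 2%N) (T_gt0 3%N); lra.
apply: Rle_trans (Rmult_le_compat_r _ _ _ S_ge0 rn_le) _.
by apply: Req_le; field; lra.
Qed.

(** Telescoping with [1 / m^2 <= 1 / (m - 1/2) - 1 / (m + 1/2)]. Three terms are kept exact because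
    1.65 exceeds [PI^2 / 6] by only 0.3 percent. *)
Lemma rsum_inv_sqr_le n : rsum n (fun k => / INR k.+1 ^ 2) <= 1.65.
Proof.
suff H k : rsum k.+3 (fun k => / INR k.+1 ^ 2) <= 1.65 - / (INR k.+3 + 1/2).
  case: n => [|[|[|n]]]; try by rewrite /=; lra.
  apply: Rle_trans (H n) _; have : 0 < / (INR n.+3 + 1 / 2).
    by apply: Rinv_0_lt_compat; have := pos_INR n.+3; lra.
  lra.
elim: k => [|k IHk]; first by rewrite /=; lra.
rewrite rsumS; move: (rsum _ _) IHk => S IHk; cbv beta.
have k_ge0 := pos_INR k; rewrite !S_INR in IHk *.
have : / (INR k + 1 + 1 + 1 + 1) ^ 2
  <= / (INR k + 1 + 1 + 1 + 1/2) - / (INR k + 1 + 1 + 1 + 1 + 1/2).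
  have -> : / (INR k + 1 + 1 + 1 + 1/2) - / (INR k + 1 + 1 + 1 + 1 + 1/2)
     = / ((INR k + 1 + 1 + 1 + 1/2) * (INR k + 1 + 1 + 1 + 1 + 1/2)) by field; lra.
  by apply: Rinv_le_contravar; nra.
move: IHk; rewrite /= !Rmult_1_r; lra.
Qed.

Lemma Rle_eps_nat a b C : (forall n, (0 < n)%N -> a <= b + C / INR n) -> a <= b.
Proof.
move=> H; apply: Rnot_lt_le => lt_ba.
have [n n_ge] := nfloor_ex (Rmax 0 (C / (a - b))) (Rmax_l _ _).
have n1_gt : C / (a - b) < INR n.+1 by rewrite S_INR; have := Rmax_r 0 (C / (a - b));
  lra.
have n1_gt0 : 0 < INR n.+1 by apply: lt_0_INR; lia.
have := H n.+1 isT; have : C / INR n.+1 < a - b.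
  have ab_gt0 : 0 < a - b by lra.
  by apply/(Rlt_div_l _ _ _ n1_gt0); move/(Rlt_div_l _ _ _ ab_gt0): n1_gt; lra.
lra.
Qed.

(* Expanding [polylog j] and summing over [m] first turns the sum into
   [sum_k k^j polylog_(j+1) (exp (- k s)) <= c / s^(j+2) sum_k 1 / k^2]. *)
Lemma rsum_polylog_scaled j s c N : (j <= 3)%N -> 0 < s -> 0 <= c ->
  (forall x, 0 < x -> polylog j.+1 (exp (- x)) <= c / x ^ j.+2) ->
  rsum N (fun i => INR i.+1 ^ j.+1 * polylog j (exp (- (INR i.+1 * s))))
  <= 1.65 * c / s ^ j.+2.
Proof.
move=> le_j3 s_gt0 c_ge0 polylog_le.
have exp01 x : 0 < x -> 0 < exp (- x) < 1.
  by move=> ?; split; [apply: exp_pos | rewrite -exp_0; apply: exp_increasing; lra].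
have i_gt0 i : 0 < INR i.+1 by apply: lt_0_INR; lia.
(* The inner series are cut at a common [n], so the double sum to be exchanged is finite; the error
   [C / n] disappears at the end as [n] grows. *)
have [C C_le] : exists C, forall n, (0 < n)%N ->
   rsum N (fun i => INR i.+1 ^ j.+1 * polylog j (exp (- (INR i.+1 * s))))
   <= rsum N (fun i => INR i.+1 ^ j.+1 *
         rsum n (fun k => INR k.+1 ^ j * exp (- (INR i.+1 * s)) ^ k.+1)) + C / INR n.
  elim: N => [|N [C IHN]].
    by exists 0 => n _ /=; rewrite /Rdiv Rmult_0_l; lra.
  have x_gt0 : 0 < INR N.+1 * s by apply: Rmult_lt_0_compat.
  have [C' C'_ge0 C'_le] := polylog_tail_vanish le_j3 x_gt0.
  exists (C + INR N.+1 ^ j.+1 * C') => n n_gt0; rewrite !rsumS; cbv beta.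
  have := IHN n n_gt0; have := C'_le n n_gt0.
  rewrite polylog_partial; [|exact: leq_trans le_j3 _|by case: (exp01 _ x_gt0)].
  have : 0 <= INR N.+1 ^ j.+1 by apply/pow_le/Rlt_le.
  have -> : (C + INR N.+1 ^ j.+1 * C') / INR n
    = C / INR n + INR N.+1 ^ j.+1 * (C' / INR n).
    by rewrite /Rdiv; ring.
  nra.
apply: (@Rle_eps_nat _ _ C) => n n_gt0; apply: Rle_trans (C_le n n_gt0) _.
apply: Rplus_le_compat_r.
have exp_swap i k : exp (- (INR i * s)) ^ k = exp (- (INR k * s)) ^ i.
  by rewrite -!exp_mulr_nat; congr exp; ring.
have -> : rsum N (fun i => INR i.+1 ^ j.+1 *
            rsum n (fun k => INR k.+1 ^ j * exp (- (INR i.+1 * s)) ^ k.+1))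
  = rsum n (fun k => INR k.+1 ^ j *
      rsum N (fun i => INR i.+1 ^ j.+1 * exp (- (INR k.+1 * s)) ^ i.+1)).
  rewrite (@rsum_ext N _ (fun i => rsum n (fun k => INR k.+1 ^ j *
             (INR i.+1 ^ j.+1 * exp (- (INR k.+1 * s)) ^ i.+1)))).
    by rewrite rsum_exchange; apply: rsum_ext => k _; rewrite rsum_scal.
  move=> i _; rewrite -rsum_scal; apply: rsum_ext => k _.
  by rewrite exp_swap; ring.
have -> : 1.65 * c / s ^ j.+2 = c / s ^ j.+2 * 1.65 by rewrite /Rdiv; ring.
have sj_gt0 : 0 < s ^ j.+2 by apply: pow_lt.
have cs_ge0 : 0 <= c / s ^ j.+2 by apply: Rdiv_le_0_compat.
apply: Rle_trans (Rmult_le_compat_l _ _ _ cs_ge0 (rsum_inv_sqr_le n)).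
rewrite -rsum_scal; apply: rsum_le => k _.
have ks_gt0 : 0 < INR k.+1 * s by apply: Rmult_lt_0_compat.
have kj_gt0 := pow_lt _ j (i_gt0 k).
apply: Rle_trans (Rmult_le_compat_l _ _ _ (Rlt_le _ _ kj_gt0) _) _.
  apply: Rle_trans (rsum_polylog_le _ _ (exp01 _ ks_gt0)) (polylog_le _ ks_gt0).
  exact: le_j3.
apply: Req_le; rewrite Rpow_mult_distr -[INR k.+1 ^ j.+2]/(INR k.+1 * (INR k.+1
  * INR k.+1 ^ j)).
rewrite [X in / X](_ : _ = INR k.+1 * INR k.+1); last by rewrite /= Rmult_1_r.
by have := i_gt0 k; move: (INR k.+1) kj_gt0 => a *; field; lra.
Qed.

(** Applied repeatedly, this proves Taylor-type inequalities: both sides are differentiated until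
    the sign is evident. *)
Lemma ge0_of_derive_ge0 (f f' : R -> R) b :
  (forall x, 0 <= x <= b -> is_derive f x (f' x)) -> 0 <= f 0 ->
  (forall x, 0 <= x <= b -> 0 <= f' x) -> forall x, 0 <= x <= b -> 0 <= f x.
Proof.
move=> df f0_ge0 f'_ge0 x x0b; case: (Req_dec x 0) => [->//|x_neq0].
have [||c [c0x]] := MVT_gen f 0 x f'; rewrite ?Rmin_left ?Rmax_right; try lra.
- by move=> z z0x; apply: df; lra.
- move=> z z0x; apply/continuity_pt_filterlim;
  apply: (@ex_derive_continuous _ R_NormedModule).
  by exists (f' z); apply: df; lra.
rewrite Rmin_left ?Rmax_right in c0x; try lra.
have := f'_ge0 c ltac:(lra); nra.
Qed.

Lemma cosh_ge x : 0 <= x ->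
  2 + (x ^ 2 + x ^ 4 / 12 + x ^ 6 / 360 + x ^ 8 / 20160) <= exp x + exp (- x).
Proof.
move=> x_ge0; suff H b : forall x, 0 <= x <= b ->
    0 <= exp x + exp (- x)
      - (2 + x ^ 2 + x ^ 4 / 12 + x ^ 6 / 360 + x ^ 8 / 20160).
  by have := H x x; lra.
have chain f f' := @ge0_of_derive_ge0 f f' b.
apply: (chain _ (fun x => exp x - exp (- x)
    - (2 * x + x ^ 3 / 3 + x ^ 5 / 60 + x ^ 7 / 2520))) => [z _||].
- by auto_derive => //; field.
- by rewrite Ropp_0 exp_0; lra.
apply: (chain _ (fun x => exp x + exp (- x)
    - (2 + x ^ 2 + x ^ 4 / 12 + x ^ 6 / 360))) => [z _||].
- by auto_derive => //; field.
- by rewrite Ropp_0 exp_0; lra.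
apply: (chain _ (fun x => exp x - exp (- x) - (2 * x + x ^ 3 / 3 + x ^ 5 / 60))) =>
  [z _||].
- by auto_derive => //; field.
- by rewrite Ropp_0 exp_0; lra.
apply: (chain _ (fun x => exp x + exp (- x) - (2 + x ^ 2 + x ^ 4 / 12))) => [z _||].
- by auto_derive => //; field.
- by rewrite Ropp_0 exp_0; lra.
apply: (chain _ (fun x => exp x - exp (- x) - (2 * x + x ^ 3 / 3))) => [z _||].
- by auto_derive => //; field.
- by rewrite Ropp_0 exp_0; lra.
apply: (chain _ (fun x => exp x + exp (- x) - (2 + x ^ 2))) => [z _||].
- by auto_derive => //; field.
- by rewrite Ropp_0 exp_0; lra.
apply: (chain _ (fun x => exp x - exp (- x) - 2 * x)) => [z _||].
- by auto_derive => //; field.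
- by rewrite Ropp_0 exp_0; lra.
apply: (chain _ (fun x => exp x + exp (- x) - 2)) => [z _||].
- by auto_derive => //; field.
- by rewrite Ropp_0 exp_0; lra.
move=> z _; rewrite exp_Ropp; have := exp_pos z; move: (exp z) => e e_gt0.
have -> : e + / e - 2 = (e - 1) ^ 2 / e by field; lra.
by apply: Rdiv_le_0_compat => //; apply: pow2_ge_0.
Qed.

(** Replacing the Taylor coefficient 1/12 by 1/10 pays for all higher terms: four differentiations
    leave only [2 cosh x <= 12 / 5]. *)
Lemma cosh_le x : 0 <= x <= 1 / 6 ->
  exp x + exp (- x) <= 2 + x ^ 2 + x ^ 4 / 10.
Proof.
suff H y : 0 <= y <= 1 / 6 -> 0 <= 2 + y ^ 2 + y ^ 4 / 10 - (exp y + exp (- y)).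
  by move/H; lra.
have chain f f' := @ge0_of_derive_ge0 f f' (1 / 6); move: y.
apply: (chain _ (fun x => 2 * x + 2 * x ^ 3 / 5 - (exp x - exp (- x)))) => [y _||].
- by auto_derive => //; field.
- by rewrite Ropp_0 exp_0; lra.
apply: (chain _ (fun x => 2 + 6 * x ^ 2 / 5 - (exp x + exp (- x)))) => [y _||].
- by auto_derive => //; field.
- by rewrite Ropp_0 exp_0; lra.
apply: (chain _ (fun x => 12 * x / 5 - (exp x - exp (- x)))) => [y _||].
- by auto_derive => //; field.
- by rewrite Ropp_0 exp_0; lra.
apply: (chain _ (fun x => 12 / 5 - (exp x + exp (- x)))) => [y _||].
- by auto_derive => //; field.
- by rewrite Ropp_0 exp_0; lra.
move=> y y01; have := exp_ineq1_le (- y).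
have exp_y : exp y * exp (- y) = 1 by rewrite -exp_plus Rplus_opp_r exp_0.
have : exp (- y) <= 1.
  by rewrite -exp_0; case: (Req_dec y 0) => [->|?]; [rewrite Ropp_0; lra|];
    apply/Rlt_le/exp_increasing; lra.
have := exp_pos y; nra.
Qed.

(** * Two-sided bounds for the polylogarithms at [exp (- x)] *)

Section PolylogBounds.

Variable x : R.
Hypothesis x_gt0 : 0 < x.
Notation r := (exp (- x)).
Notation P := (polylog 1 r).

Lemma exp_neg_lt1 : 0 < r < 1.
Proof. by split; [apply: exp_pos | rewrite -exp_0; apply: exp_increasing; lra]. Qed.

(** So [P] is [1 / (4 sinh^2 (x / 2))], and bounds on [cosh] become bounds on [P]; the next
    identities reduce the higher orders to [P]. *)
Lemma polylog1_exp : P * (exp x + exp (- x) - 2) = 1.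
Proof.
have := exp_neg_lt1; have -> : exp x = / r by rewrite exp_Ropp Rinv_inv.
by rewrite /=; move=> ?; field; lra.
Qed.

(** As a function of [x], order 2 is odd while [P] is even, so only its square is a polynomial in
    [P]. This is why orders 2 and 4 are compared after squaring. *)
Lemma polylog2_sqr : polylog 2 r ^ 2 = P ^ 2 * (1 + 4 * P).
Proof. by have := exp_neg_lt1; rewrite /= => ?; field; lra. Qed.

Lemma polylog3E : polylog 3 r = P + 6 * P ^ 2.
Proof. by have := exp_neg_lt1; rewrite /= => ?; field; lra. Qed.

Lemma polylog4E : polylog 4 r = polylog 2 r * (1 + 12 * P).
Proof. by have := exp_neg_lt1; rewrite /= => ?; field; lra. Qed.

(* [a = x^2 / 12] makes the Taylor coefficients of [4 sinh^2 (x/2)] small. *)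
Lemma polylog1_le_cosh (a : R) : 12 * a = x ^ 2 ->
  P <= / (12 * a * (1 + a + 2 / 5 * a ^ 2 + 3 / 35 * a ^ 3)).
Proof.
move=> aE; have x2_gt0 := pow_lt x 2 x_gt0; have a_gt0 : 0 < a by lra.
have a2_gt0 := pow_lt a 2 a_gt0; have a3_gt0 := pow_lt a 3 a_gt0.
set d := 12 * a * _; have d_gt0 : 0 < d by apply: Rmult_lt_0_compat; lra.
have := cosh_ge (Rlt_le _ _ x_gt0); have := polylog1_exp.
have -> : x ^ 2 + x ^ 4 / 12 + x ^ 6 / 360 + x ^ 8 / 20160 = d.
  have -> : x ^ 4 = x ^ 2 * x ^ 2 by ring.
  have -> : x ^ 6 = x ^ 2 * x ^ 2 * x ^ 2 by ring.
  have -> : x ^ 8 = x ^ 2 * x ^ 2 * x ^ 2 * x ^ 2 by ring.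
  by rewrite -aE /d; field.
have P_gt0 := polylog_pos 1 exp_neg_lt1 => PE le_d.
by apply: (Rmult_le_reg_r d) => //; rewrite Rinv_l; nra.
Qed.

Lemma polylog1_le : P <= 1 / x ^ 2.
Proof.
have x2_gt0 := pow_lt x 2 x_gt0; have aE : 12 * (x ^ 2 / 12) = x ^ 2 by field.
apply: Rle_trans (polylog1_le_cosh aE) _; rewrite aE /Rdiv Rmult_1_l.
apply: Rinv_le_contravar => //; have a_gt0 : 0 < x ^ 2 / 12 by lra.
have := pow_lt _ 2 a_gt0; have := pow_lt _ 3 a_gt0; rewrite /Rdiv in a_gt0 *; nra.
Qed.

Lemma polylog2_le : polylog 2 r <= 2 / x ^ 3.
Proof.
have x2_gt0 := pow_lt x 2 x_gt0; have aE : 12 * (x ^ 2 / 12) = x ^ 2 by field.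
have x3_gt0 := pow_lt x 3 x_gt0.
have := polylog1_le_cosh aE; move: (x ^ 2 / 12) aE => a aE.
have P_gt0 := polylog_pos 1 exp_neg_lt1; have a_gt0 : 0 < a by lra.
set q := 1 + _ + _ + _; set d := _ * q => P_le.
have q_gt0 : 0 < q.
  by have := pow_lt _ 2 a_gt0; have := pow_lt _ 3 a_gt0; rewrite /q; lra.
have d_gt0 : 0 < d by apply: Rmult_lt_0_compat; lra.
have S2_gt0 := polylog_pos 2 exp_neg_lt1.
apply: Rsqr_incr_0_var; last by apply/Rlt_le/Rdiv_lt_0_compat; lra.
rewrite !Rsqr_pow2 polylog2_sqr.
apply: (Rle_trans _ ((/ d) ^ 2 * (1 + 4 * / d))).
  apply: Rmult_le_compat; [by apply/pow_le/Rlt_le | by lra | | by lra].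
  by apply: pow_incr; lra.
have -> : (2 / x ^ 3) ^ 2 = 4 / (12 * a) ^ 3 by rewrite aE; field; lra.
have -> : (/ d) ^ 2 * (1 + 4 * / d) = (d + 4) / q ^ 3 / (12 * a) ^ 3.
  by rewrite /d; field; lra.
apply: Rmult_le_compat_r; first by apply/Rlt_le/Rinv_0_lt_compat/pow_lt; lra.
apply/Rle_div_l; first by apply: pow_lt.
(* The claim is [d + 4 <= 4 q^3]. Constant and linear terms in [a] agree on both sides, and every
   further coefficient is in favour of [4 q^3]. *)
have pw k := pow_lt a k a_gt0; rewrite /d /q.
have := (pw 2%N); have := (pw 3%N); have := (pw 4%N); have := (pw 5%N).
have := (pw 6%N); have := (pw 7%N); have := (pw 8%N); have := (pw 9%N); lra.
Qed.

(** At [x = 0] order [j] behaves like [j! / x^(j+1)]. Orders 1 and 2 stay below this, but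
    [x^4 * polylog 3] is [6 + x^4 / 120 + ...], so a constant above 6 is unavoidable; likewise 26.5
    instead of 24 for order 4. *)
Lemma polylog3_le : polylog 3 r <= 6.18 / x ^ 4.
Proof.
have x2_gt0 := pow_lt x 2 x_gt0; have aE : 12 * (x ^ 2 / 12) = x ^ 2 by field.
have := polylog1_le_cosh aE; move: (x ^ 2 / 12) aE => a aE.
have P_gt0 := polylog_pos 1 exp_neg_lt1; have a_gt0 : 0 < a by lra.
set q := 1 + _ + _ + _; set d := _ * q => P_le.
have q_gt0 : 0 < q.
  by have := pow_lt _ 2 a_gt0; have := pow_lt _ 3 a_gt0; rewrite /q; lra.
have d_gt0 : 0 < d by apply: Rmult_lt_0_compat; lra.
rewrite polylog3E; apply: (Rle_trans _ (/ d + 6 * (/ d) ^ 2)).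
  apply: Rplus_le_compat => //; apply: Rmult_le_compat_l; first lra.
  by apply: pow_incr; lra.
have -> : 6.18 / x ^ 4 = 6.18 / (12 * a) ^ 2 by rewrite aE; field; lra.
have -> : / d + 6 * (/ d) ^ 2 = (d + 6) / q ^ 2 / (12 * a) ^ 2.
  by rewrite /d; field; lra.
apply: Rmult_le_compat_r; first by apply/Rlt_le/Rinv_0_lt_compat/pow_lt; lra.
apply/Rle_div_l; first by apply: pow_lt.
have pw k := pow_lt a k a_gt0; rewrite /d /q.
have := (pw 3%N); have := (pw 4%N); have := (pw 5%N).
(* The coefficient of [a^2] has the wrong sign here; the square absorbs it. *)
have := (pw 6%N); have := pow2_ge_0 (a ^ 2 - 1/3); nra.
Qed.

Lemma polylog4_le : polylog 4 r <= 26.5 / x ^ 5.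
Proof.
have x2_gt0 := pow_lt x 2 x_gt0; have aE : 12 * (x ^ 2 / 12) = x ^ 2 by field.
have x5_gt0 := pow_lt x 5 x_gt0.
have := polylog1_le_cosh aE; move: (x ^ 2 / 12) aE => a aE.
have P_gt0 := polylog_pos 1 exp_neg_lt1; have a_gt0 : 0 < a by lra.
set q := 1 + _ + _ + _; set d := _ * q => P_le.
have q_gt0 : 0 < q.
  by have := pow_lt _ 2 a_gt0; have := pow_lt _ 3 a_gt0; rewrite /q; lra.
have d_gt0 : 0 < d by apply: Rmult_lt_0_compat; lra.
have S4_gt0 := polylog_pos 4 exp_neg_lt1.
apply: Rsqr_incr_0_var; last by apply/Rlt_le/Rdiv_lt_0_compat; lra.
rewrite !Rsqr_pow2 polylog4E Rpow_mult_distr polylog2_sqr.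
have le_pow k c : 0 <= c -> (1 + c * P) ^ k <= (1 + c * / d) ^ k.
  move=> c_ge0; apply: pow_incr; split; first by nra.
  by apply/Rplus_le_compat_l/Rmult_le_compat_l.
apply: (Rle_trans _ ((/ d) ^ 2 * (1 + 4 * / d) * (1 + 12 * / d) ^ 2)).
  have P2_ge0 := pow_le _ 2 (Rlt_le _ _ P_gt0).
  apply: Rmult_le_compat; [by apply: Rmult_le_pos; lra | by apply: pow_le; lra | |].
    apply: Rmult_le_compat => //; [by lra | by apply: pow_incr; lra | by lra].
  by apply: le_pow; lra.
have -> : (26.5 / x ^ 5) ^ 2 = 702.25 / (12 * a) ^ 5.
  by rewrite aE (_ : 702.25 = 26.5 ^ 2); [field; lra | lra].
have -> : (/ d) ^ 2 * (1 + 4 * / d) * (1 + 12 * / d) ^ 2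
   = (d + 4) * (d + 12) ^ 2 / q ^ 5 / (12 * a) ^ 5.
  by rewrite /d; field; lra.
apply: Rmult_le_compat_r; first by apply/Rlt_le/Rinv_0_lt_compat/pow_lt; lra.
apply/Rle_div_l; first by apply: pow_lt.
have pw k := pow_lt a k a_gt0; rewrite /d /q.
have := (pw 2%N); have := (pw 3%N); have := (pw 4%N); have := (pw 5%N).
have := (pw 6%N); have := (pw 7%N); have := (pw 8%N); have := (pw 9%N).
have := (pw 10%N); have := (pw 11%N); have := (pw 12%N); have := (pw 13%N).
have := (pw 14%N); have := (pw 15%N); lra.
Qed.

(** The range up to 1/6 covers the arguments [j s] with [j <= 8] and [s <= 1 / 60] met in
    [cumulant1_ge]. There the correction factor is at most 361/360, and [0.997 * 361 / 360 < 1]. *)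
Lemma polylog1_ge : x <= 1 / 6 -> 0.997 / x ^ 2 <= P.
Proof.
move=> x_le; have x2_gt0 := pow_lt x 2 x_gt0.
have P_gt0 := polylog_pos 1 exp_neg_lt1.
have := cosh_le (conj (Rlt_le _ _ x_gt0) x_le); have := polylog1_exp => PE ch_le.
apply/Rle_div_l => //.
have : 1 <= P * (x ^ 2 + x ^ 4 / 10) by nra.
have -> : P * (x ^ 2 + x ^ 4 / 10) = P * x ^ 2 * (1 + x ^ 2 / 10) by field.
have x2_le : x ^ 2 <= 1 / 36 by nra.
have : 0 < P * x ^ 2 by apply: Rmult_lt_0_compat.
nra.
Qed.

Lemma polylog2_ge : x <= 1 / 6 -> 1.99 / x ^ 3 <= polylog 2 r.
Proof.
move=> x_le; have x2_gt0 := pow_lt x 2 x_gt0; have x3_gt0 := pow_lt x 3 x_gt0.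
have P_gt0 := polylog_pos 1 exp_neg_lt1; have S2_gt0 := polylog_pos 2 exp_neg_lt1.
have P_ge := polylog1_ge x_le.
apply: Rsqr_incr_0_var; last lra.
rewrite !Rsqr_pow2 polylog2_sqr.
apply: (Rle_trans _ (4 * P ^ 3)); last by have := pow_lt _ 2 P_gt0; rewrite /=; nra.
have -> : (1.99 / x ^ 3) ^ 2 = 3.9601 / (x ^ 2) ^ 3.
  by rewrite (_ : 3.9601 = 1.99 ^ 2); [field; lra | lra].
have : (0.997 / x ^ 2) ^ 3 <= P ^ 3.
  by apply: pow_incr; split=> //; apply/Rlt_le/Rdiv_lt_0_compat; lra.
have -> : (0.997 / x ^ 2) ^ 3 = 0.991026973 / (x ^ 2) ^ 3.
  by rewrite (_ : 0.991026973 = 0.997 ^ 3); [field; lra | lra].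
have := Rinv_0_lt_compat _ (pow_lt _ 3 x2_gt0); rewrite /Rdiv; lra.
Qed.

End PolylogBounds.

(** * Cumulants of a random partition without part 1 *)

Section PartSums.

Variables (s : R) (k : nat).
Hypothesis s_gt0 : 0 < s.

(* For [j = 0, ..., 3] this is the [(j + 1)]-st cumulant of the size of a random
   partition into parts [2, ..., k + 1] with weight [exp (- s |lambda|)]. *)
Definition cumulant (j : nat) : R :=
  rsum k (fun i => INR i.+2 ^ j.+1 * polylog j (exp (- (INR i.+2 * s)))).

Lemma part_gt0 i : 0 < INR i.+1 * s.
Proof. by apply: Rmult_lt_0_compat => //; apply: lt_0_INR; lia. Qed.

Lemma cumulant_term_gt0 j i :
  0 < INR i.+1 ^ j.+1 * polylog j (exp (- (INR i.+1 * s))).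
Proof.
apply: Rmult_lt_0_compat; first by apply/pow_lt/lt_0_INR; lia.
exact/polylog_pos/exp_neg_lt1/part_gt0.
Qed.

Lemma cumulant_ge0 j : 0 <= cumulant j.
Proof. by apply: rsum_nonneg => i _; apply/Rlt_le/cumulant_term_gt0. Qed.

Lemma cumulant_le j c : (j <= 3)%N -> 0 <= c ->
  (forall x, 0 < x -> polylog j.+1 (exp (- x)) <= c / x ^ j.+2) ->
  cumulant j <= 1.65 * c / s ^ j.+2.
Proof.
move=> le_j3 c_ge0 le_c.
apply: Rle_trans (rsum_polylog_scaled k.+1 le_j3 s_gt0 c_ge0 le_c).
by rewrite rsumSl; have := cumulant_term_gt0 j 0; rewrite /cumulant; lra.
Qed.

(** With part 1 restored, expanding [polylog 1] and exchanging sums gives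
    [sum_j j * polylog 2 (exp (- j s))], up to truncation. Eight terms suffice:
    [1.99 * sum_(j <= 8) 1 / j^2 > 3.039], from which [36 * 0.0005] is lost to truncation and 1/60
    to part 1. *)
Lemma cumulant1_ge : s <= 1 / 60 -> 1 / s <= INR k.+1 * s -> 3 / s ^ 3 <= cumulant 1.
Proof.
move=> s_le; set N := k.+1; set Y := INR N * s => Y_ge.
have s3_gt0 := pow_lt s 3 s_gt0.
have t_ge : 60 <= 1 / s by apply/(Rle_div_r _ _ _ s_gt0); lra.
have P1_le := polylog1_le s_gt0; rewrite -{1}[s]Rmult_1_l in P1_le.
(* The parts beyond [N] contribute at most [2 Y^2 exp (- Y) / s^3] with [Y = N s >= 60]. *)
have tail_le j : 1 <= j -> j <= 8 ->
    exp (- (j * s)) ^ N * polylog_tail 2 (INR N) (exp (- (j * s))) <= 0.0005 / s ^ 3.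
  move=> j_ge1 j_le8.
  have js_gt0 : 0 < j * s by nra.
  have N_gt0 : 0 < INR N by apply: lt_0_INR; rewrite /N; lia.
  have pow_le : exp (- (j * s)) ^ N <= exp (- Y).
    rewrite -exp_mulr_nat; case: (Req_dec j 1) => [->|?].
      by apply: Req_le; congr exp; rewrite /Y; ring.
    have : 0 < INR N * s * (j - 1) by apply: Rmult_lt_0_compat; nra.
    by move=> ?; apply/Rlt_le/exp_increasing; rewrite /Y; lra.
  have T0_le : polylog 0 (exp (- (j * s))) <= 1 / s.
    have := exp_neg_lt1 js_gt0; rewrite /polylog => e01; apply/Rle_div_l; first lra.
    rewrite (_ : 1 / s * _ = (1 - exp (- (j * s))) / s); last by field; lra.
    apply/(Rle_div_r _ _ _ s_gt0).
    have := exp_ineq1_le (j * s); have := exp_plus (j * s) (- (j * s)).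
    by rewrite Rplus_opp_r exp_0; nra.
  have T1_le : polylog 1 (exp (- (j * s))) <= 1 / s ^ 2.
    apply: Rle_trans (polylog1_le js_gt0) _; rewrite /Rdiv !Rmult_1_l.
    by apply: Rinv_le_contravar; [apply: pow_lt | apply: pow_incr; nra].
  have T2_le : polylog 2 (exp (- (j * s))) <= 2 / s ^ 3.
    apply: Rle_trans (polylog2_le js_gt0) _; apply: Rmult_le_compat_l; first lra.
    by apply: Rinv_le_contravar; [apply: pow_lt | apply: pow_incr; nra].
  have tail2_le : polylog_tail 2 (INR N) (exp (- (j * s))) <= 2 * Y ^ 2 / s ^ 3.
    apply: (Rle_trans _ ((Y ^ 2 + 2 * Y + 2) / s ^ 3)); last first.
      by apply: Rmult_le_compat_r; [apply/Rlt_le/Rinv_0_lt_compat | nra].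
    have -> : (Y ^ 2 + 2 * Y + 2) / s ^ 3
      = INR N ^ 2 * (1 / s) + 2 * INR N * (1 / s ^ 2) + 2 / s ^ 3.
      by rewrite /Y; field; lra.
    rewrite /polylog_tail; apply: Rplus_le_compat => //; apply: Rplus_le_compat.
      by apply: Rmult_le_compat_l => //; apply: pow2_ge_0.
    by apply: Rmult_le_compat_l => //; lra.
  have expY_le : exp (- Y) <= (10 / Y) ^ 10.
    by apply: Rle_trans (exp_neg_le_pow 10 _) _; [|rewrite /= ; lra]; lra.
  have tail2_ge0 := polylog_tail_ge0 2 (Rlt_le _ _ N_gt0) (exp_neg_lt1 js_gt0).
  apply: Rle_trans (Rmult_le_compat_r _ _ _ tail2_ge0 pow_le) _.
  have e_ge0 := Rlt_le _ _ (exp_pos (- Y)).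
  apply: Rle_trans (Rmult_le_compat_l _ _ _ e_ge0 tail2_le) _.
  rewrite /Rdiv -Rmult_assoc; apply: Rmult_le_compat_r.
    by apply/Rlt_le/Rinv_0_lt_compat.
  have Y2_ge0 : 0 <= 2 * Y ^ 2 by nra.
  apply: Rle_trans (Rmult_le_compat_r _ _ _ Y2_ge0 expY_le) _.
  have -> : (10 / Y) ^ 10 * (2 * Y ^ 2) = 20000000000 * (/ Y) ^ 8 by field; lra.
  have Yi_le : / Y <= / 60 by apply: Rinv_le_contravar; lra.
  have Yi_ge0 : 0 <= / Y by apply/Rlt_le/Rinv_0_lt_compat; lra.
  have := pow_incr (/ Y) (/ 60) 8 (conj Yi_ge0 Yi_le); lra.
have part_ge j : (0 < j)%N -> (j <= 8)%N ->
    (1.99 / INR j ^ 3 - 0.0005) / s ^ 3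
    <= rsum N (fun i => INR i.+1 ^ 2 * exp (- (INR j * s)) ^ i.+1).
  move=> j_gt0 j_le8.
  have j_ge1 : 1 <= INR j by apply: (le_INR 1); apply/leP.
  have j_le : INR j <= 8 by rewrite [8](_ : _ = INR 8); [apply/le_INR/leP | rewrite /=;
    lra].
  have js_gt0 : 0 < INR j * s by nra.
  rewrite polylog_partial //; last by case: (exp_neg_lt1 js_gt0).
  have := tail_le _ j_ge1 j_le; have := polylog2_ge js_gt0 ltac:(nra).
  have -> : 1.99 / (INR j * s) ^ 3 = 1.99 / INR j ^ 3 / s ^ 3 by field; lra.
  by rewrite /Rdiv; lra.
(* The surplus 1/60 pays for part 1, whose term is at most [1 / s^2 <= (1 / 60) / s^3]. *)
suff : (3 + 1 / 60) / s ^ 3 <= rsum N (fun i =>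
  INR i.+1 ^ 2 * polylog 1 (exp (- (INR i.+1 * s)))).
  rewrite /N rsumSl /cumulant.
  set a := _ ^ 2 * polylog 1 _; have : a <= (1 / 60) / s ^ 3.
    rewrite /a; apply: (Rle_trans _ (1 / s ^ 2)); first by rewrite /=;
      rewrite /= in P1_le; lra.
    have -> : 1 / s ^ 2 = s / s ^ 3 by field; lra.
    by apply: Rmult_le_compat_r => //; apply/Rlt_le/Rinv_0_lt_compat.
  by rewrite /Rdiv; lra.
apply: (Rle_trans _ (rsum 8 (fun j =>
  INR j.+1 * ((1.99 / INR j.+1 ^ 3 - 0.0005) / s ^ 3)))).
  rewrite /rsum !INR_IZR_INZ; cbn [Z.of_nat Pos.of_succ_nat Pos.succ].
  by have := Rinv_0_lt_compat _ s3_gt0; rewrite /Rdiv; lra.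
apply: Rle_trans (_ : rsum 8 (fun j => INR j.+1 * rsum N (fun i =>
  INR i.+1 ^ 2 * exp (- (INR j.+1 * s)) ^ i.+1)) <= _).
  apply: rsum_le => j lt_j8; apply: Rmult_le_compat_l; first exact: pos_INR.
  exact: part_ge.
rewrite (@rsum_ext 8 _ (fun j => rsum N (fun i =>
  INR i.+1 ^ 2 * (INR j.+1 ^ 1 * exp (- (INR i.+1 * s)) ^ j.+1)))); last first.
  move=> j _; rewrite -rsum_scal; apply: rsum_ext => i _.
  have -> : exp (- (INR j.+1 * s)) ^ i.+1 = exp (- (INR i.+1 * s)) ^ j.+1.
    by rewrite -!exp_mulr_nat; congr exp; ring.
  by rewrite pow_1; ring.
rewrite rsum_exchange; apply: rsum_le => i _; rewrite rsum_scal.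
apply: Rmult_le_compat_l; first exact: pow2_ge_0.
exact: (rsum_polylog_le (j := 1) 8 isT (exp_neg_lt1 (part_gt0 i))).
Qed.

End PartSums.

Lemma cumulant0_le s k : 0 < s -> cumulant s k 0 <= 1.65 / s ^ 2.
Proof.
move=> s_gt0; rewrite -[1.65]Rmult_1_r.
by apply: cumulant_le => //; [lra | exact: polylog1_le].
Qed.

Lemma cumulant1_le s k : 0 < s -> cumulant s k 1 <= 3.3 / s ^ 3.
Proof.
move=> s_gt0; rewrite [3.3](_ : _ = 1.65 * 2); last lra.
by apply: cumulant_le => //; [lra | exact: polylog2_le].
Qed.

Lemma cumulant2_le s k : 0 < s -> cumulant s k 2 <= 10.2 / s ^ 4.
Proof.
move=> s_gt0; apply: Rle_trans (_ : 1.65 * 6.18 / s ^ 4 <= _).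
  by apply: cumulant_le => //; [lra | exact: polylog3_le].
by apply: Rmult_le_compat_r; [apply/Rlt_le/Rinv_0_lt_compat/pow_lt | lra].
Qed.

Lemma cumulant3_le s k : 0 < s -> cumulant s k 3 <= 43.725 / s ^ 5.
Proof.
move=> s_gt0; rewrite [43.725](_ : _ = 1.65 * 26.5); last lra.
by apply: cumulant_le => //; [lra | exact: polylog4_le].
Qed.

(** * One Euler factor on the circle of radius rho *)

Lemma exp_mono x y : x <= y -> exp x <= exp y.
Proof. by case=> [lt_xy|->]; [apply/Rlt_le/exp_increasing | lra]. Qed.

Lemma cos_ge_quadratic x : 0 <= x -> 1 - x ^ 2 / 2 <= cos x.
Proof.
move=> x_ge0; suff H b : forall x, 0 <= x <= b -> 0 <= cos x - (1 - x ^ 2 / 2).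
  by have := H x x; lra.
have chain f f' := @ge0_of_derive_ge0 f f' b.
apply: (chain _ (fun x => x - sin x)) => [z _||].
- by auto_derive => //; field.
- by rewrite cos_0; lra.
apply: (chain _ (fun x => 1 - cos x)) => [z _||z _].
- by auto_derive => //; field.
- by rewrite sin_0; lra.
by have := COS_bound z; lra.
Qed.

Lemma sin_le_id x : 0 <= x -> sin x <= x.
Proof.
move=> x_ge0; suff H b : forall x, 0 <= x <= b -> 0 <= x - sin x.
  by have := H x x; lra.
have chain f f' := @ge0_of_derive_ge0 f f' b.
apply: (chain _ (fun x => 1 - cos x)) => [z _||z _].
- by auto_derive => //; field.
- by rewrite sin_0; lra.
by have := COS_bound z; lra.
Qed.

Lemma cos_le_quartic x : 0 <= x -> cos x <= 1 - x ^ 2 / 2 + x ^ 4 / 24.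
Proof.
move=> x_ge0; suff H b : forall x, 0 <= x <= b ->
  0 <= 1 - x ^ 2 / 2 + x ^ 4 / 24 - cos x.
  by have := H x x; lra.
have chain f f' := @ge0_of_derive_ge0 f f' b.
apply: (chain _ (fun x => - x + x ^ 3 / 6 + sin x)) => [z _||].
- by auto_derive => //; field.
- by rewrite cos_0; lra.
apply: (chain _ (fun x => cos x - (1 - x ^ 2 / 2))) => [z _||z [z_ge0 _]].
- by auto_derive => //; field.
- by rewrite sin_0; lra.
by have := cos_ge_quadratic z_ge0; lra.
Qed.

Lemma ln_ge_quadratic y : 0 <= y -> y - y ^ 2 / 2 <= ln (1 + y).
Proof.
move=> y_ge0; suff H b : forall x, 0 <= x <= b -> 0 <= ln (1 + x) - (x - x ^ 2 / 2).
  by have := H y y; lra.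
apply: (@ge0_of_derive_ge0 _ (fun x => x ^ 2 / (1 + x))) => [z z0b||z z0b].
- by auto_derive; [lra | field; lra].
- by rewrite Rplus_0_r ln_1; lra.
by apply: Rdiv_le_0_compat; [apply: pow2_ge_0 | lra].
Qed.

(** The tangent to [exp] at [l * a], evaluated at [a] and at 0 and averaged with weights [l] and
    [1 - l]. *)
Lemma exp_convex l a : 0 <= l <= 1 -> exp (l * a) <= 1 - l + l * exp a.
Proof.
move=> l01.
have e_gt0 := exp_pos (l * a).
have h1 : exp (l * a) * (1 + (1 - l) * a) <= exp a.
  have -> : exp a = exp (l * a) * exp ((1 - l) * a) by rewrite -exp_plus; congr exp;
    ring.
  by apply: Rmult_le_compat_l; [lra | apply: exp_ineq1_le].
have h2 : exp (l * a) * (1 - l * a) <= 1.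
  have E : exp (l * a) * exp (- (l * a)) = 1 by rewrite -exp_plus Rplus_opp_r exp_0.
  have := Rmult_le_compat_l _ _ _ (Rlt_le _ _ e_gt0) (exp_ineq1_le (- (l * a))); lra.
nra.
Qed.

Section Factor.

Variable rho : R.
Hypothesis rho01 : 0 < rho < 1.
Notation W := (2 * polylog 1 rho).

(* Normalised modulus and argument of [1 / (1 - rho e^(i al))]. *)
Definition fmod (al : R) : R := / sqrt (1 + W * (1 - cos al)).
Definition farg (al : R) : R := atan (rho * sin al / (1 - rho * cos al)).

Lemma W_gt0 : 0 < W.
Proof. by have := polylog_pos 1 rho01; lra. Qed.

Lemma fmod_arg_gt0 al : 0 <= W * (1 - cos al).
Proof. by apply: Rmult_le_pos; [have := W_gt0; lra | have := COS_bound al; lra]. Qed.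

Lemma denom_gt0 al : 0 < 1 - rho * cos al.
Proof. by have := COS_bound al; nra. Qed.

Lemma sqr_modE al :
  (1 - rho) ^ 2 * (1 + W * (1 - cos al)) = (1 - rho * cos al) ^ 2 + (rho * sin al) ^ 2.
Proof.
rewrite Rpow_mult_distr -[sin al ^ 2]Rsqr_pow2 sin2 Rsqr_pow2 /=; field; lra.
Qed.

Lemma modE al :
  sqrt (1 + (rho * sin al / (1 - rho * cos al))²) * (1 - rho * cos al)
  = (1 - rho) * sqrt (1 + W * (1 - cos al)).
Proof.
have d0 := denom_gt0 al.
rewrite -[X in _ * X = _]sqrt_pow2; last lra.
rewrite -[X in _ = X * _]sqrt_pow2; last lra.
rewrite -!sqrt_mult_alt; try nra; last first.
  by have := Rle_0_sqr (rho * sin al / (1 - rho * cos al)); lra.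
by congr sqrt; rewrite sqr_modE Rsqr_pow2; field; lra.
Qed.

(* [Re (e^(iX) f) - Re (e^(iX) f rho e^(i al)) = Re e^(iX) (1 - rho)], where
   [f] is the normalised factor. *)
Lemma fmod_farg al X :
  fmod al * (cos (X + farg al) - rho * cos (X + farg al + al)) = (1 - rho) * cos X.
Proof.
have d0 := denom_gt0 al; have mE := modE al.
have u_ge0 := Rle_0_sqr (rho * sin al / (1 - rho * cos al)).
have r_gt0 : 0 < sqrt (1 + (rho * sin al / (1 - rho * cos al))²) by apply: sqrt_lt_R0;
  lra.
have w_gt0 : 0 < sqrt (1 + W * (1 - cos al)).
  by apply: sqrt_lt_R0; have := fmod_arg_gt0 al; lra.
rewrite /fmod /farg.
have := cos_atan (rho * sin al / (1 - rho * cos al)).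
have := sin_atan (rho * sin al / (1 - rho * cos al)).
move: (sqrt (1 + _²)) r_gt0 mE => q q_gt0 mE sE cE.
have s2 := sin2_cos2 al; rewrite /Rsqr in s2.
have cosE : cos (atan (rho * sin al / (1 - rho * cos al))) = / q by rewrite cE; field;
  lra.
have sinE : sin (atan (rho * sin al / (1 - rho * cos al)))
  = rho * sin al / (1 - rho * cos al) / q by rewrite sE; field; lra.
rewrite !cos_plus sin_plus cosE sinE.
have -> : sqrt (1 + W * (1 - cos al))
  = q * (1 - rho * cos al) / (1 - rho) by rewrite mE; field; lra.
have qq : q ^ 2 * (1 - rho * cos al) ^ 2 = (1 - rho * cos al) ^ 2 + (rho * sin al) ^ 2.
  rewrite -sqr_modE -Rpow_mult_distr mE Rpow_mult_distr pow2_sqrt //.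
  by have := fmod_arg_gt0 al; lra.
rewrite (_ : _ * (_ - _) = (1 - rho) * cos X
  * (((1 - rho * cos al) ^ 2 + (rho * sin al) ^ 2) / (q ^ 2 * (1 - rho * cos al) ^ 2))).
  by rewrite -qq; field; lra.
by field; lra.
Qed.

Lemma fmod_gt0 al : 0 < fmod al.
Proof. by apply/Rinv_0_lt_compat/sqrt_lt_R0; have := fmod_arg_gt0 al; lra. Qed.

Lemma fmodE al : fmod al = exp (- (ln (1 + W * (1 - cos al)) / 2)).
Proof.
have w_ge0 := fmod_arg_gt0 al.
rewrite exp_Ropp /fmod; congr (/ _); apply: sqrt_lem_1; [lra | exact/Rlt_le/exp_pos |].
by rewrite -exp_plus (_ : _ / 2 + _ / 2 = ln (1 + W * (1 - cos al))) ?exp_ln; lra.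
Qed.

Lemma fmod_ge al : 0 <= al -> exp (- (polylog 1 rho * al ^ 2 / 2)) <= fmod al.
Proof.
move=> al_ge0; rewrite fmodE; apply: exp_mono; have w_ge0 := fmod_arg_gt0 al.
have : ln (1 + W * (1 - cos al)) <= W * (1 - cos al).
  rewrite -[X in _ <= X]ln_exp; apply: ln_le; [lra | exact: exp_ineq1_le].
by have := cos_ge_quadratic al_ge0; have := W_gt0; nra.
Qed.

(** With [y = W (1 - cos al)], the quadratic error of [ln (1 + y)] and the quartic error of [cos]
    add up to [(P + 6 P^2) al^4 / 24], where [P + 6 P^2] is exactly [polylog 3]. Summation over the
    parts therefore produces the fourth cumulant. *)
Lemma fmod_le_core al : 0 <= al ->
  fmod al <= exp (- (polylog 1 rho * al ^ 2 / 2) + polylog 3 rho * al ^ 4 / 24).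
Proof.
move=> al_ge0; rewrite fmodE; apply: exp_mono; have w_ge0 := fmod_arg_gt0 al.
have := ln_ge_quadratic w_ge0.
have -> : polylog 3 rho = polylog 1 rho + 6 * polylog 1 rho ^ 2 by rewrite /=; field;
  lra.
have := cos_ge_quadratic al_ge0; have := cos_le_quartic al_ge0; have := W_gt0.
move: (polylog 1 rho) (cos al) w_ge0 => P c w_ge0 P_gt0 c_le c_ge.
have : (2 * P * (1 - c)) ^ 2 <= (2 * P * (al ^ 2 / 2)) ^ 2.
  by apply: pow_incr; split=> //; apply: Rmult_le_compat_l; lra.
have : 2 * P * (al ^ 2 / 2 - al ^ 4 / 24) <= 2 * P * (1 - c).
  by apply: Rmult_le_compat_l; lra.
have -> : (2 * P * (al ^ 2 / 2)) ^ 2 = P ^ 2 * al ^ 4 by field.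
lra.
Qed.

Lemma exp_2rho_le : exp (2 * rho) <= (1 + rho) / (1 - rho).
Proof.
have H : 0 <= ln (1 + rho) - ln (1 - rho) - 2 * rho.
  apply: (@ge0_of_derive_ge0 (fun x => ln (1 + x) - ln (1 - x) - 2 * x)
    (fun x => 2 * x ^ 2 / (1 - x ^ 2)) rho) => [z zr||z zr|]; last by lra.
  - by auto_derive; [lra | field; nra].
  - by rewrite Rplus_0_r Rminus_0_r ln_1; lra.
  apply: Rdiv_le_0_compat; nra.
rewrite -[X in _ <= X]exp_ln; last by apply: Rdiv_lt_0_compat; lra.
by apply: exp_mono; rewrite ln_div; lra.
Qed.

(* By convexity of [exp] it suffices to compare at [cos al = -1]. *)
Lemma fmod_le al : fmod al <= exp (- (rho * (1 - cos al))).
Proof.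
rewrite fmodE; apply: exp_mono.
suff : 2 * rho * (1 - cos al) <= ln (1 + W * (1 - cos al)) by lra.
rewrite -[X in X <= _]ln_exp; apply: ln_le; first exact: exp_pos.
have c_bd := COS_bound al; set t := 1 - cos al.
have := @exp_convex (t / 2) (4 * rho) ltac:(rewrite /t; lra).
rewrite (_ : t / 2 * (4 * rho) = 2 * rho * t); last by field.
have : exp (4 * rho) <= 1 + 2 * W.
  rewrite (_ : 4 * rho = 2 * rho + 2 * rho) ?exp_plus; last by lra.
  rewrite (_ : 1 + 2 * W = (1 + rho) / (1 - rho) * ((1 + rho) / (1 - rho))); last first.
    by rewrite /=; field; lra.
  by apply: Rmult_le_compat; try exact: exp_2rho_le; exact/Rlt_le/exp_pos.
have : 0 <= t / 2 by rewrite /t; lra.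
nra.
Qed.

(** The derivative [g] of the difference is [1 - cos x] times a positive factor that is largest at
    [x = 0]; this yields both the sign and the cubic bound. *)
Lemma farg_bounds al : 0 <= al ->
  0 <= al * polylog 0 rho - farg al <= polylog 2 rho * al ^ 3 / 6.
Proof.
move=> al_ge0.
pose g x := rho * (1 + rho) * (1 - cos x) / ((1 - rho) * ((1 - rho * cos x) ^ 2
  + (rho * sin x) ^ 2)).
have den_ge x : (1 - rho) ^ 2 <= (1 - rho * cos x) ^ 2 + (rho * sin x) ^ 2.
  rewrite -sqr_modE; have := pow_lt (1 - rho) 2 ltac:(lra); have := fmod_arg_gt0 x; nra.
have rho2_gt0 := pow_lt (1 - rho) 2 ltac:(lra).
have g_bd x : 0 <= x -> 0 <= g x <= polylog 2 rho * x ^ 2 / 2.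
  move=> x_ge0; have := COS_bound x; have := den_ge x => den c_bd.
  have num_ge0 : 0 <= rho * (1 + rho) * (1 - cos x) by apply: Rmult_le_pos; nra.
  split; first by apply: Rdiv_le_0_compat => //; apply: Rmult_lt_0_compat; lra.
  apply: (Rle_trans _ (rho * (1 + rho) * (1 - cos x) / ((1 - rho) * (1 - rho) ^ 2))).
    apply: Rmult_le_compat_l => //; apply: Rinv_le_contravar; last by nra.
    by apply: Rmult_lt_0_compat; lra.
  have -> : polylog 2 rho * x ^ 2 / 2
    = rho * (1 + rho) * (x ^ 2 / 2) / ((1 - rho) * (1 - rho) ^ 2).
    by rewrite /=; field; lra.
  apply: Rmult_le_compat_r; first by apply/Rlt_le/Rinv_0_lt_compat/Rmult_lt_0_compat;
    lra.
  apply: Rmult_le_compat_l; first by nra.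
  by have := cos_ge_quadratic x_ge0; lra.
have dg x : is_derive (fun x => x * polylog 0 rho - farg x) x (g x).
  have d0 := denom_gt0 x; have := den_ge x => den.
  rewrite /farg /g; auto_derive; first lra.
  rewrite /polylog; have := sin2_cos2 x; rewrite /Rsqr => sc.
  have D_gt0 : 0 < (1 - rho * cos x) ^ 2 + (rho * sin x) ^ 2 by lra.
  move: (sin x) (cos x) sc d0 D_gt0 => u c sc d0 D_gt0.
  transitivity (rho / (1 - rho) - rho * (c * (1 - rho * c) - rho * (u * u))
      / ((1 - rho * c) ^ 2 + (rho * u) ^ 2)).
    by field; rewrite /= in D_gt0; repeat split; lra.
  have uE : u * u = 1 - c * c by lra.
  have DE : (1 - rho * c) ^ 2 + (rho * u) ^ 2 = 1 - 2 * rho * c + rho ^ 2.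
    rewrite (_ : (rho * u) ^ 2 = rho ^ 2 * (u * u)); last by ring.
    by rewrite uE; ring.
  by rewrite DE in D_gt0 *; rewrite uE; field; lra.
have fargz : farg 0 = 0 by rewrite /farg sin_0 Rmult_0_r /Rdiv Rmult_0_l atan_0.
split.
  apply: (@ge0_of_derive_ge0 (fun x => x * polylog 0 rho - farg x) g al) =>
    [z _||z zal|]; [exact: dg | | | lra].
    by rewrite fargz; lra.
  by have := g_bd z ltac:(lra); lra.
have : 0 <= polylog 2 rho * al ^ 3 / 6 - (al * polylog 0 rho - farg al); last by lra.
apply: (@ge0_of_derive_ge0 (fun x =>
  polylog 2 rho * x ^ 3 / 6 - (x * polylog 0 rho - farg x))
  (fun x => polylog 2 rho * x ^ 2 / 2 - g x) al) => [z _||z zal|]; last by lra.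
- apply: is_derive_minus (dg z); move: (polylog 2 rho) => p.
  by auto_derive => //; field.
- by rewrite fargz; lra.
by have := g_bd z ltac:(lra); lra.
Qed.

Lemma fmod_continuous al : continuous fmod al.
Proof.
apply: (@ex_derive_continuous _ R_NormedModule); rewrite /fmod.
have := fmod_arg_gt0 al => w_ge0.
have sq_gt0 : 0 < sqrt (1 + W * (1 - cos al)) by apply: sqrt_lt_R0; lra.
move: (W) w_ge0 sq_gt0 => w w_ge0 sq_gt0.
by auto_derive; repeat split; try lra; apply/Rgt_not_eq.
Qed.

Lemma farg_continuous al : continuous farg al.
Proof.
apply: (@ex_derive_continuous _ R_NormedModule); rewrite /farg.
by auto_derive; have := denom_gt0 al; lra.
Qed.

End Factor.

(** * The generating function on the circle of radius exp (- s) *)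

Section Integrand.

Variable s : R.
Hypothesis s_gt0 : 0 < s.

Definition rho (m : nat) : R := exp (- (INR m * s)).

Fixpoint ampl (k : nat) (th : R) : R :=
  if k is i.+1 then ampl i th * fmod (rho i.+2) (INR i.+2 * th) else 1.

Definition phase (k : nat) (th : R) : R :=
  rsum k (fun i => farg (rho i.+2) (INR i.+2 * th)).

Lemma rho01 i : 0 < rho i.+1 < 1.
Proof. exact/exp_neg_lt1/part_gt0. Qed.

Lemma rhoE i : rho i.+1 = exp (- s) ^ i.+1.
Proof. by rewrite -exp_mulr_nat /rho; congr exp; ring. Qed.

Lemma ampl_gt0 k th : 0 < ampl k th.
Proof.
by elim: k => [|k IHk] /=; [lra | apply: Rmult_lt_0_compat => //; apply/fmod_gt0/rho01].
Qed.

Lemma ampl_le_rsum (g : nat -> R) k th :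
  (forall i, fmod (rho i.+2) (INR i.+2 * th) <= exp (g i)) ->
  ampl k th <= exp (rsum k g).
Proof.
move=> le_g; elim: k => [|k IHk] /=; first by rewrite exp_0; lra.
by rewrite exp_plus; apply: Rmult_le_compat => //; apply/Rlt_le;
  [apply: ampl_gt0 | apply/fmod_gt0/rho01].
Qed.

Lemma ampl_ge_rsum (g : nat -> R) k th :
  (forall i, exp (g i) <= fmod (rho i.+2) (INR i.+2 * th)) ->
  exp (rsum k g) <= ampl k th.
Proof.
move=> le_g; elim: k => [|k IHk] /=; first by rewrite exp_0; lra.
by rewrite exp_plus; apply: Rmult_le_compat => //; apply/Rlt_le/exp_pos.
Qed.

Lemma ampl_ge k th : 0 <= th -> exp (- (cumulant s k 1 * th ^ 2 / 2)) <= ampl k th.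
Proof.
move=> th_ge0; rewrite (_ : - _ = - (th ^ 2 / 2) * cumulant s k 1); last by field.
rewrite -rsum_scal; apply: ampl_ge_rsum => i.
apply: Rle_trans (fmod_ge (rho01 _) _); last by apply: Rmult_le_pos => //;
  apply: pos_INR.
by apply: Req_le; congr exp; rewrite /rho; move: (polylog 1 _) => p; field.
Qed.

Lemma ampl_le_core k th : 0 <= th ->
  ampl k th <= exp (- (cumulant s k 1 * th ^ 2 / 2) + cumulant s k 3 * th ^ 4 / 24).
Proof.
move=> th_ge0; rewrite (_ : - _ + _
  = - (th ^ 2 / 2) * cumulant s k 1 + th ^ 4 / 24 * cumulant s k 3); last by field.
rewrite -!rsum_scal -rsum_plus; apply: ampl_le_rsum => i.
apply: Rle_trans (fmod_le_core (rho01 _) _) _; first by apply: Rmult_le_pos => //;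
  apply: pos_INR.
apply: Req_le; congr exp; rewrite /rho; move: (polylog 1 _) (polylog 3 _) => p q; field.
Qed.

Lemma ampl_le k th :
  ampl k th <= exp (- rsum k (fun i => rho i.+2 * (1 - cos (INR i.+2 * th)))).
Proof.
rewrite -[- rsum _ _]Rmult_1_l Ropp_mult_distr_r_reverse Ropp_mult_distr_l -rsum_scal.
apply: ampl_le_rsum => i; apply: Rle_trans (fmod_le (rho01 _) _) _.
by apply: Req_le; congr exp; ring.
Qed.

Lemma phase_defect k th : 0 <= th ->
  0 <= th * cumulant s k 0 - phase k th <= cumulant s k 2 * th ^ 3 / 6.
Proof.
move=> th_ge0; rewrite /cumulant /phase.
elim: k => [|k [IHk1 IHk2]]; first by rewrite /=; lra.
rewrite !rsumS; cbv beta.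
have := farg_bounds (rho01 k.+1) (Rmult_le_pos _ _ (pos_INR k.+2) th_ge0).
rewrite -/(rho _) pow_1.
by move: (rsum k _) (rsum k _) (rsum k _) IHk1 IHk2 (farg _ _) (polylog 0 _) (polylog 2
  _) => *; lra.
Qed.

Lemma ampl_continuous k th : continuous (ampl k) th.
Proof.
elim: k => [|k IHk]; first exact: continuous_const.
apply: (@continuous_mult R_UniformSpace R_AbsRing (ampl k) (fun th =>
  fmod (rho k.+2) (INR k.+2 * th))) => //.
apply: (continuous_comp (fun th => INR k.+2 * th) (fmod (rho k.+2)));
  last exact/fmod_continuous/rho01.
by apply: continuous_scal_r; apply: continuous_id.
Qed.

Lemma phase_continuous k th : continuous (phase k) th.
Proof.
rewrite /phase; elim: k => [|k IHk]; first exact: continuous_const.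
apply: (@continuous_plus _ _ _ _ (fun th => farg (rho k.+2) (INR k.+2 * th))) => //.
apply: (continuous_comp (fun th => INR k.+2 * th) (farg (rho k.+2)));
  last exact/farg_continuous/rho01.
by apply: continuous_scal_r; apply: continuous_id.
Qed.

(** The frequency is an integer rather than a natural number because the recurrence [fourierS] moves
    it below 0, where the coefficient has to be shown to vanish. *)
Definition wave (k : nat) (n : Z) (th : R) : R :=
  ampl k th * cos (phase k th - IZR n * th).

Lemma wave_continuous k n th : continuous (wave k n) th.
Proof.
apply: continuous_mult; first exact: ampl_continuous.
apply: (continuous_comp (fun th => phase k th - IZR n * th) cos).
  apply: continuous_minus; first exact: phase_continuous.
  by apply: continuous_scal_r; apply: continuous_id.
by apply: (@ex_derive_continuous _ R_NormedModule); auto_derive.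
Qed.

Lemma ex_RInt_wave k n a b : ex_RInt (wave k n) a b.
Proof. by apply: ex_RInt_continuous => z _; apply: wave_continuous. Qed.

Definition fourier (k : nat) (n : Z) : R := RInt (wave k n) 0 PI.

Lemma fourier0 n : fourier 0 n = if Z.eqb n 0 then PI else 0.
Proof.
rewrite /fourier; case: Z.eqb_spec => [->|n_neq0].
  rewrite (RInt_ext _ (fun=> 1)); last first.
    by move=> x _; rewrite /wave /= /phase /= (_ : 0 - _ = 0) ?cos_0; lra.
  by rewrite RInt_const /scal /= /mult /=; lra.
have nR_neq0 : IZR n <> 0 by apply: IZR_neq.
apply: is_RInt_unique.
have E : minus (sin (IZR n * PI) / IZR n) (sin (IZR n * 0) / IZR n) = 0.
  rewrite Rmult_0_r sin_0 (sin_eq_0_1 (IZR n * PI)); last by exists n.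
  by rewrite /minus /plus /Hierarchy.opp /=; field.
rewrite -[X in is_RInt _ _ _ X]E.
apply: (is_RInt_derive (fun th => sin (IZR n * th) / IZR n)) => x _;
  last exact: wave_continuous.
rewrite /wave /phase /= (_ : 0 - _ = - (IZR n * x)); last by ring.
by rewrite cos_neg Rmult_1_l; auto_derive => //; field.
Qed.

(** Multiplying the product by the denominator of its last factor gives back the shorter product;
    pointwise this is [fmod_farg]. The result is the recurrence of restricted partition counts, up
    to weights. *)
Lemma fourierS k n :
  fourier k.+1 n = rho k.+2 * fourier k.+1 (n - Z.of_nat k.+2)
    + (1 - rho k.+2) * fourier k n.
Proof.
apply: is_RInt_unique; apply: is_RInt_ext (_ : is_RInt (fun th =>
    rho k.+2 * wave k.+1 (n - Z.of_nat k.+2) th + (1 - rho k.+2) * wave k n th)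
    0 PI _); last first.
  apply: (@is_RInt_plus R_NormedModule); apply: (@is_RInt_scal R_NormedModule);
    apply: RInt_correct; exact: ex_RInt_wave.
move=> th _; rewrite /wave.
have := fmod_farg (rho01 k.+1) (INR k.+2 * th) (phase k th - IZR n * th).
rewrite minus_IZR -INR_IZR_INZ /phase rsumS -/(phase k th) -[ampl k.+1 th]/(ampl k th
  * fmod (rho k.+2) (INR k.+2 * th)).
have -> : phase k th - IZR n * th + farg (rho k.+2) (INR k.+2 * th)
   = phase k th + farg (rho k.+2) (INR k.+2 * th) - IZR n * th by ring.
have -> : phase k th + farg (rho k.+2) (INR k.+2 * th) - IZR n * th + INR k.+2 * th
   = phase k th + farg (rho k.+2) (INR k.+2 * th) - (IZR n - INR k.+2) * th by ring.
move=> E; rewrite (_ : (1 - rho k.+2) * (ampl k th * cos (phase k th - IZR n * th))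
  = ampl k th * ((1 - rho k.+2) * cos (phase k th - IZR n * th))); last by ring.
rewrite -E; match goal with |- ?a = ?b => change (a = b :> R) end; ring.
Qed.

(** Below 0 the term of level [k] vanishes by induction, so each shift multiplies by [rho k.+2 < 1].
    All coefficients of level [k + 1] are bounded by the integral of [ampl], hence iteration forces
    0. *)
Lemma fourier_neg k n : Z.lt n Z0 -> fourier k n = 0.
Proof.
elim: k n => [|k IHk] n n_lt0.
  by rewrite fourier0; case: Z.eqb_spec => // ?; lia.
have [C C_ge] : exists C, forall m, Rabs (fourier k.+1 m) <= C.
  exists (RInt (ampl k.+1) 0 PI) => m.
  have exA : ex_RInt (ampl k.+1) 0 PI by apply: ex_RInt_continuous => z _;
    apply: ampl_continuous.
  apply: (norm_RInt_le (wave k.+1 m) (ampl k.+1) 0 PI).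
  - by have := PI_RGT_0; lra.
  - move=> x _; change (Rabs (wave k.+1 m x) <= ampl k.+1 x);
    rewrite /wave Rabs_mult (Rabs_right (ampl _ _)); last first.
      by apply/Rle_ge/Rlt_le/ampl_gt0.
    have : Rabs (cos (phase k.+1 x - IZR m * x)) <= 1 by apply: Rabs_le;
      have := COS_bound (phase k.+1 x - IZR m * x); lra.
    by have := ampl_gt0 k.+1 x; nra.
  - by apply: RInt_correct; apply: ex_RInt_wave.
  - by apply: RInt_correct.
have iter j m : Z.lt m Z0 -> exists m', fourier k.+1 m = rho k.+2 ^ j * fourier k.+1 m'.
  elim: j m => [|j IHj] m m_lt0; first by exists m; rewrite /=; lra.
  have [|m' m'E] := IHj (Z.sub m (Z.of_nat k.+2)); first by lia.
  by exists m'; rewrite fourierS IHk // m'E /=; ring.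
have := rho01 k.+1; set r := rho _ => r01.
apply: cond_eq => eps eps_gt0; rewrite Rminus_0_r.
have C1_gt0 : 0 < Rabs C + 1 by have := Rabs_pos C; lra.
have [j /(_ j (Nat.le_refl _)) j_le] := pow_lt_1_zero r ltac:(rewrite Rabs_right;
  lra) (eps / (Rabs C + 1)) ltac:(exact: Rdiv_lt_0_compat).
have [m' ->] := iter j n n_lt0; rewrite Rabs_mult -/r.
have := C_ge m'; have := Rle_abs C; have := Rabs_pos (r ^ j);
  have := Rabs_pos (fourier k.+1 m').
move/(Rlt_div_r _ _ _ C1_gt0): j_le; nra.
Qed.

(* [count k n] is the number of partitions of [n] into parts [2, ..., k + 1]. *)
Lemma fourier_count (count : nat -> nat -> R) :
  (forall n, count 0%N n = if n == 0%N then 1 else 0) ->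
  (forall k n, count k.+1 n = count k n + if (k.+2
    <= n)%N then count k.+1 (n - k.+2)%N else 0) ->
  forall k, exists2 C, 0 < C &
    forall n, fourier k (Z.of_nat n) = C * exp (- (INR n * s)) * count k n.
Proof.
move=> count0 countS; elim=> [|k [C C_gt0 IHk]].
  exists PI => [|n]; first exact: PI_RGT_0.
  rewrite fourier0 count0; case: n => [|n] /=; last by lra.
  by rewrite Rmult_0_l Ropp_0 exp_0; lra.
have r01 := rho01 k.+1.
exists ((1 - rho k.+2) * C) => [|n]; first by apply: Rmult_lt_0_compat; lra.
elim/ltn_ind: n => n IHn; rewrite fourierS IHk countS;
  have [lt_nk|le_kn] := ltnP n k.+2; last first.
  rewrite -Nat2Z.inj_sub; last exact/leP.
  rewrite minusE IHn; last by rewrite ltn_subrL; case: n le_kn {IHn}.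
  have -> : exp (- (INR (n - k.+2) * s)) = exp (- (INR n * s)) / rho k.+2.
    rewrite /rho /Rdiv -exp_Ropp -exp_plus; congr exp.
    by rewrite minus_INR; [ring | apply/leP].
  by field; lra.
rewrite fourier_neg; last by move/ltP: lt_nk; lia.
by ring.
Qed.

End Integrand.

(** * Decay away from angle 0, and the equation fixing [s] *)

Lemma geom_cos_sum N r th :
  (1 - 2 * r * cos th + r ^ 2) * rsum N (fun i => r ^ i.+1 * cos (INR i.+1 * th))
  = r * cos th - r ^ 2 - r ^ N.+1 * cos (INR N.+1 * th) + r ^ N.+2 * cos (INR N * th).
Proof.
elim: N => [|N IHN]; first by rewrite /= Rmult_0_l cos_0 Rmult_1_l; ring.
rewrite rsumS; cbv beta; rewrite Rmult_plus_distr_l IHN !(S_INR N.+1).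
have -> : cos ((INR N.+1 + 1) * th)
    = 2 * cos th * cos (INR N.+1 * th) - cos (INR N * th).
  have -> : (INR N.+1 + 1) * th = INR N.+1 * th + th by ring.
  have -> : INR N * th = INR N.+1 * th - th by rewrite S_INR; ring.
  by rewrite cos_plus cos_minus; ring.
by rewrite -!tech_pow_Rmult; ring.
Qed.

Lemma half_coth_ge s : 0 < s -> 1 / s <= (1 + exp (- s)) / (2 * (1 - exp (- s))).
Proof.
move=> s_gt0; have r01 := exp_neg_lt1 s_gt0.
have : 0 <= (2 + s) * exp (- s) - 2 + s.
  apply: (@ge0_of_derive_ge0 (fun x => (2 + x) * exp (- x) - 2 + x)
    (fun x => 1 - (1 + x) * exp (- x)) s) => [z _||z zs|]; last by lra.
  - by auto_derive => //; ring.
  - by rewrite Ropp_0 exp_0; lra.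
  have := exp_ineq1_le z; have := exp_plus z (- z).
  by rewrite Rplus_opp_r exp_0; have := exp_pos (- z); nra.
move=> H; apply/(Rle_div_l _ _ _ s_gt0).
rewrite (_ : _ * s = (1 + exp (- s)) * s / (2 * (1 - exp (- s)))); last by field; lra.
by apply/Rle_div_r; lra.
Qed.

(** Putting part 1 back costs at most [1 - cos th] and makes the exponent a geometric sum. The
    complete sum is [y / (1 + y)] times [coth (s / 2) / 2 >= 1 / s], where [y] is the upper bound
    imposed on [y0]; since [y / (1 + y)] increases, any smaller [y0] will do. The 0.001 covers the
    truncation. *)
Lemma ampl_far s k th y0 : 0 < s <= 1 / 60 -> 1 / s <= INR k.+1 * s ->
  0 <= y0 <= 2 * polylog 1 (exp (- s)) * (1 - cos th) ->
  ampl s k th <= exp (- (y0 / (1 + y0) / s) + (1 - cos th) + 0.001).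
Proof.
move=> [s_gt0 s_le] kS y0_bd; apply: Rle_trans (ampl_le s_gt0 k th) _.
apply: exp_mono; have r01 := exp_neg_lt1 s_gt0; have c_bd := COS_bound th.
suff : y0 / (1 + y0) / s - 0.001
    <= rsum k.+1 (fun i => rho s i.+1 * (1 - cos (INR i.+1 * th))).
  rewrite rsumSl /= Rmult_1_l rhoE pow_1.
  have : exp (- s) * (1 - cos th) <= 1 * (1 - cos th) by apply: Rmult_le_compat_r; lra.
  lra.
set N := k.+1 in kS *; set r := exp (- s) in r01 y0_bd *;
  set c := cos th in c_bd y0_bd *.
have den_gt0 : 0 < 1 - 2 * r * c + r ^ 2 by nra.
have den_ge : (1 - r) ^ 2 <= 1 - 2 * r * c + r ^ 2 by nra.
have -> : rsum N (fun i => rho s i.+1 * (1 - cos (INR i.+1 * th)))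
   = rsum N (fun i => INR i.+1 ^ 0 * r ^ i.+1)
     + -1 * rsum N (fun i => r ^ i.+1 * cos (INR i.+1 * th)).
  rewrite -rsum_scal -rsum_plus; apply: rsum_ext => i _.
  by rewrite rhoE pow_O; rewrite -/r; ring.
rewrite polylog_partial //; last by lra.
have -> : rsum N (fun i => r ^ i.+1 * cos (INR i.+1 * th))
   = (r * c - r ^ 2 - r ^ N.+1 * cos (INR N.+1 * th) + r ^ N.+2 * cos (INR N * th))
     / (1 - 2 * r * c + r ^ 2).
  by rewrite -geom_cos_sum -/c; field; lra.
have rN_ge0 : 0 <= r ^ N by apply: pow_le; lra.
have err : r ^ N * polylog_tail 0 (INR N) r
    + (r ^ N.+2 * cos (INR N * th) - r ^ N.+1 * cos (INR N.+1 * th))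
      / (1 - 2 * r * c + r ^ 2) <= 0.001.
  apply: (Rle_trans _ (3 * r ^ N / (1 - r) ^ 2)).
    have -> : 3 * r ^ N / (1 - r) ^ 2 = r ^ N / (1 - r) ^ 2 + 2 * r ^ N / (1 - r) ^ 2.
      by field; lra.
    apply: Rplus_le_compat.
      apply: Rmult_le_compat_l => //; rewrite /polylog_tail /polylog.
      rewrite (_ : / (1 - r) ^ 2 = (/ (1 - r)) / (1 - r)); last by field; lra.
      apply: Rmult_le_compat_r; first by apply/Rlt_le/Rinv_0_lt_compat; lra.
      by apply: (Rle_trans _ (/ 1)); [rewrite Rinv_1; lra | apply: Rinv_le_contravar;
        lra].
    apply: (Rle_trans _ (2 * r ^ N / (1 - 2 * r * c + r ^ 2))).
      apply: Rmult_le_compat_r; first exact/Rlt_le/Rinv_0_lt_compat.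
      rewrite -[r ^ N.+2]/(r * (r * r ^ N)) -[r ^ N.+1]/(r * r ^ N).
      have := COS_bound (INR N * th).
      have := COS_bound (INR N.+1 * th);
        move: (cos (INR N * th)) (cos (INR N.+1 * th)) => c1 c2 c2b c1b.
      move: (r ^ N) rN_ge0 => a a_ge0.
      have ra : 0 <= r * a <= a by nra.
      have rra : 0 <= r * (r * a) <= a by nra.
      have : r * (r * a) * c1 <= a by nra.
      have : - a <= r * a * c2 by nra.
      lra.
    apply: Rmult_le_compat_l; first by nra.
    by apply: Rinv_le_contravar => //; apply: pow_lt; lra.
  have s2_gt0 := pow_lt s 2 s_gt0.
  have r_ge : s / 2 <= 1 - r.
    have := exp_ineq1_le s; have := exp_plus s (- s); rewrite Rplus_opp_r exp_0 -/r.
    by nra.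
  have t_ge : 60 <= 1 / s by apply/(Rle_div_r _ _ _ s_gt0); lra.
  have rN_le : r ^ N <= 10000000000 * s ^ 10.
    rewrite -exp_mulr_nat; apply: (Rle_trans _ (exp (- (1 / s)))).
      by apply: exp_mono; lra.
    apply: Rle_trans (exp_neg_le_pow 10 _) _; first lra.
    by apply: Req_le; rewrite INR_IZR_INZ /=; field; lra.
  apply: (Rle_trans _ (3 * (10000000000 * s ^ 10) / (s / 2) ^ 2)).
    apply: Rmult_le_compat; [lra | | lra |].
      by apply/Rlt_le/Rinv_0_lt_compat/pow_lt; lra.
    apply: Rinv_le_contravar; first by apply: pow_lt; lra.
    by apply: pow_incr; lra.
  have -> : 3 * (10000000000 * s ^ 10) / (s / 2) ^ 2 = 120000000000 * s ^ 8 by field;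
    lra.
  have := pow_incr s (1 / 60) 8 (conj (Rlt_le _ _ s_gt0) s_le); lra.
set y := 2 * polylog 1 r * (1 - c) in y0_bd.
have main : y0 / (1 + y0) / s
  <= polylog 0 r - (r * c - r ^ 2) / (1 - 2 * r * c + r ^ 2).
  have -> : polylog 0 r - (r * c - r ^ 2) / (1 - 2 * r * c + r ^ 2)
     = y / (1 + y) * ((1 + r) / (2 * (1 - r))).
    rewrite /y /polylog; field; repeat split; try lra.
  rewrite [X in X <= _](_ : _ = y0 / (1 + y0) * (1 / s)); last by field; lra.
  apply: Rmult_le_compat; last exact: half_coth_ge.
  - by apply: Rdiv_le_0_compat; lra.
  - by apply: Rdiv_le_0_compat; lra.
  have -> : y0 / (1 + y0) = 1 - / (1 + y0) by field; lra.
  have -> : y / (1 + y) = 1 - / (1 + y) by field; lra.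
  have := Rinv_le_contravar (1 + y0) (1 + y); lra.
move: err main; rewrite /Rdiv; move: (/ (1 - 2 * r * c + r ^ 2)) => D.
by lra.
Qed.

(** Intermediate values of the mean size. At [s = 1 / 60] it is at most [1.65 * 3600 = 5940]; at
    [s = 1 / (2 n)] the part 2 alone contributes at least [2 (n - 1)]. The lower bound on [s] later
    makes a [k] quadratic in [n] sufficient. *)
Lemma cumulant0_surj k n : (0 < k)%N -> (5941 <= n)%N ->
  exists2 s, / (2 * INR n) <= s <= 1 / 60 & cumulant s k 0 = INR n.
Proof.
move=> k_gt0 n_ge; have nR_ge : 5941 <= INR n.
  have := le_INR _ _ (elimT leP n_ge); rewrite INR_IZR_INZ.
  by have -> : Z.of_nat 5941 = Zpos 5941 by [].
have s0_lt : / (2 * INR n) < 1 / 60.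
  by rewrite /Rdiv Rmult_1_l; apply: Rinv_lt_contravar; nra.
have s0_gt0 : 0 < / (2 * INR n) by apply: Rinv_0_lt_compat; lra.
have [|||s [s_bd cE]] := IVT_interv (fun s => INR n - cumulant s k 0) _ _ _ s0_lt.
- move=> s s_bd; apply/continuity_pt_filterlim.
  suff : continuous (fun s => INR n - cumulant s k 0) s by [].
  apply: continuous_minus; first exact: continuous_const.
  rewrite /cumulant; elim: (k) => [|i IHi]; first exact: continuous_const.
  apply: continuous_plus => //=; rewrite -/(INR i.+2).
  apply: (@ex_derive_continuous _ R_NormedModule); rewrite /polylog.
  have := exp_neg_lt1 (part_gt0 (Rlt_le_trans _ _ _ s0_gt0 (proj1 s_bd)) i.+1).
  by move: (INR i.+2) => m ?; auto_derive; lra.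
- case: k k_gt0 => // k _; rewrite /cumulant rsumSl.
  have := cumulant_ge0;
    have := @rsum_nonneg k (fun i =>
      INR i.+3 ^ 1 * polylog 0 (exp (- (INR i.+3 * / (2 * INR n))))).
  move=> H _; have {}H := H (fun i _ => Rlt_le _ _ (cumulant_term_gt0 s0_gt0 0 i.+2)).
  rewrite pow_1 (_ : INR 2 * / (2 * INR n) = / INR n); last by rewrite /=; field; lra.
  have n_gt0 : 0 < / INR n by apply: Rinv_0_lt_compat; lra.
  have := exp_neg_lt1 n_gt0; have := exp_ineq1_le (- / INR n) => e_ge e01.
  have : INR n - 1 <= polylog 0 (exp (- / INR n)).
    rewrite /polylog; apply/Rle_div_r; first lra.
    have : INR n * / INR n = 1 by apply: Rinv_r; lra.
    nra.
  by rewrite [INR 2]/=; lra.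
- have s60 : 0 < 1 / 60 by lra.
  by have := cumulant0_le k s60; lra.
by exists s => //; lra.
Qed.

(** * Gaussian moments and the Laguerre expression *)

Lemma cont_mul (f g : R -> R) x :
  continuous f x -> continuous g x -> continuous (fun y => f y * g y) x.
Proof. exact: (@continuous_mult R_UniformSpace R_AbsRing). Qed.

Lemma cont_cos (f : R -> R) x : continuous f x -> continuous (fun y => cos (f y)) x.
Proof.
move=> fx; apply: (continuous_comp f cos) => //.
by apply: (@ex_derive_continuous _ R_NormedModule); auto_derive.
Qed.

Lemma cont_sin (f : R -> R) x : continuous f x -> continuous (fun y => sin (f y)) x.
Proof.
move=> fx; apply: (continuous_comp f sin) => //.
by apply: (@ex_derive_continuous _ R_NormedModule); auto_derive.
Qed.

Ltac smooth := apply: (@ex_derive_continuous _ R_NormedModule); auto_derive; done.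

Lemma ex_RInt_cont (f : R -> R) a b : (forall x, continuous f x) -> ex_RInt f a b.
Proof. by move=> cf; apply: ex_RInt_continuous => z _. Qed.

Lemma RInt_mono (f g : R -> R) a b : a <= b ->
  (forall x, continuous f x) -> (forall x, continuous g x) ->
  (forall x, a < x < b -> f x <= g x) -> RInt f a b <= RInt g a b.
Proof. by move=> le_ab cf cg; apply: RInt_le => //; apply: ex_RInt_cont. Qed.

Lemma RInt_lin (f g : R -> R) u v a b :
  (forall x, continuous f x) -> (forall x, continuous g x) ->
  RInt (fun x => u * f x + v * g x) a b = u * RInt f a b + v * RInt g a b.
Proof.
move=> cf cg; apply: is_RInt_unique.
by apply: (@is_RInt_plus R_NormedModule); apply: (@is_RInt_scal R_NormedModule);
   apply: RInt_correct; apply: ex_RInt_cont.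
Qed.

Lemma RInt_split (f : R -> R) a b c : (forall x, continuous f x) ->
  RInt f a c = RInt f a b + RInt f b c.
Proof. by move=> cf; rewrite -(@RInt_Chasles R_CompleteNormedModule f a b c) //;
  apply: ex_RInt_cont. Qed.

Lemma exp_ge_cubic x : 0 <= x -> 1 + x + x ^ 2 / 2 + x ^ 3 / 6 <= exp x.
Proof.
move=> x_ge0; suff H b : forall x, 0 <= x <= b ->
  0 <= exp x - (1 + x + x ^ 2 / 2 + x ^ 3 / 6).
  by have := H x x; lra.
have chain f f' := @ge0_of_derive_ge0 f f' b.
apply: (chain _ (fun x => exp x - (1 + x + x ^ 2 / 2))) => [z _||].
- by auto_derive => //; field.
- by rewrite exp_0; lra.
apply: (chain _ (fun x => exp x - (1 + x))) => [z _||z _].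
- by auto_derive => //; field.
- by rewrite exp_0; lra.
by have := exp_ineq1_le z; lra.
Qed.

(** For numerical values of [exp]: at a 64th of the argument the cubic Taylor polynomial loses
    little, and [v] is a short decimal below it. *)
Lemma exp_neg64_le u v : 0 <= u -> 0 < v -> v <= 1 + u + u ^ 2 / 2 + u ^ 3 / 6 ->
  exp (- (64 * u)) <= / v ^ 64.
Proof.
move=> u_ge0 v_gt0 v_le; rewrite exp_Ropp; apply: Rinv_le_contravar.
  exact: pow_lt.
have -> : 64 * u = INR 64 * u by rewrite INR_IZR_INZ.
rewrite exp_mulr_nat; apply: pow_incr; have := exp_ge_cubic u_ge0; lra.
Qed.

(** The function [t^k exp (- c t)] decreases from [t = k / c] on. It reduces estimates in
    [t = 1 / s] to their value at [t = 60]. *)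
Lemma pow_exp_decay k c t0 t : 0 < t0 -> INR k <= c * t0 -> t0 <= t ->
  t ^ k * exp (- (c * t)) <= t0 ^ k * exp (- (c * t0)).
Proof.
move=> t0_gt0 k_le t_ge.
have -> : exp (- (c * t)) = exp (- (c * t0)) * exp (- (c * (t - t0))).
  by rewrite -exp_plus; congr exp; ring.
have : (t / t0) ^ k <= exp (c * (t - t0)).
  have tt0 : 0 <= (t - t0) / t0 by apply: Rdiv_le_0_compat; lra.
  apply: (Rle_trans _ (exp ((t - t0) / t0) ^ k)).
    apply: pow_incr; split; first by apply: Rdiv_le_0_compat; lra.
    have := exp_ineq1_le ((t - t0) / t0).
    by rewrite (_ : t / t0 = 1 + (t - t0) / t0); [lra | field; lra].
  rewrite -exp_mulr_nat; apply: exp_mono.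
  rewrite (_ : c * (t - t0) = c * t0 * ((t - t0) / t0)); last by field; lra.
  exact: Rmult_le_compat_r.
have t0k := pow_lt t0 k t0_gt0.
rewrite (_ : (t / t0) ^ k = t ^ k / t0 ^ k) => [H|]; last first.
  by rewrite /Rdiv Rpow_mult_distr pow_inv.
have {}H : t ^ k * exp (- (c * (t - t0))) <= t0 ^ k.
  rewrite exp_Ropp; apply/Rle_div_l; first exact: exp_pos.
  by move/(Rle_div_l _ _ _ t0k): H; rewrite Rmult_comm.
have := exp_pos (- (c * t0)); nra.
Qed.

Definition gauss (c : R) (p : nat) (x : R) : R := x ^ p * exp (- (c * x ^ 2 / 2)).
Definition gmom (c T : R) (p : nat) : R := RInt (gauss c p) 0 T.

Lemma gauss_continuous c p x : continuous (gauss c p) x.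
Proof. by rewrite /gauss; smooth. Qed.

(** Integration by parts. The boundary term at [T] is kept because lower bounds on the moments need
    it as well. *)
Lemma gmom_rec c T p :
  c * gmom c T p.+2 = INR p.+1 * gmom c T p - T ^ p.+1 * exp (- (c * T ^ 2 / 2)).
Proof.
suff : INR p.+1 * gmom c T p + - c * gmom c T p.+2
  = T ^ p.+1 * exp (- (c * T ^ 2 / 2)) by lra.
rewrite -RInt_lin; try exact: gauss_continuous.
apply: is_RInt_unique.
have E : minus (gauss c p.+1 T) (gauss c p.+1 0) = T ^ p.+1 * exp (- (c * T ^ 2 / 2)).
  by rewrite /minus /plus /Hierarchy.opp /gauss /=; ring.
rewrite -[X in is_RInt _ _ _ X]E.
apply: is_RInt_derive => x _; last first.
  apply: (@continuous_plus _ _ R_NormedModule);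
    apply: (@continuous_scal_r _ _ R_NormedModule); exact: gauss_continuous.
rewrite /gauss; auto_derive => //.
by rewrite /Rdiv /=; field.
Qed.

Lemma gauss_ge0 c p x : 0 <= x -> 0 <= gauss c p x.
Proof. by move=> x_ge0; apply: Rmult_le_pos;
  [apply: pow_le | apply/Rlt_le/exp_pos]. Qed.

Lemma gmomS_le c T p : 0 < c -> 0 <= T -> gmom c T p.+2 <= INR p.+1 / c * gmom c T p.
Proof.
move=> c_gt0 T_ge0; have := gmom_rec c T p; have := pow_le T p.+1 T_ge0.
have := exp_pos (- (c * T ^ 2 / 2)).
rewrite (_ : INR p.+1 / c * gmom c T p = INR p.+1 * gmom c T p / c); last by field; lra.
move=> e_gt0 T_pow E; apply/(Rle_div_r _ _ _ c_gt0); nra.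
Qed.

(** The substitution [x = l y] carries the wider Gaussian to the original one on [[0, l T]]. Having
    the ratio of the variances as a square [l ^ 2] avoids square roots, hence the factor [0.93 ^ 2]
    below. *)
Lemma gmom0_scale c l T : 0 < l <= 1 -> 0 <= T ->
  l * gmom (l ^ 2 * c) T 0 <= gmom c T 0.
Proof.
move=> l01 T_ge0.
have -> : l * gmom (l ^ 2 * c) T 0 = RInt (gauss c 0) (l * 0 + 0) (l * T + 0).
  rewrite -RInt_comp_lin; last by apply: ex_RInt_cont => x; apply: gauss_continuous.
  apply/esym/is_RInt_unique;
    apply: is_RInt_ext (_ : is_RInt (fun x => l * gauss (l ^ 2 * c) 0 x) _ _ _).
    move=> x _; rewrite /scal /= /mult /= /gauss !pow_O !Rmult_1_l Rplus_0_r.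
    by congr (_ * exp _); field.
  by apply: (@is_RInt_scal R_NormedModule); apply: RInt_correct;
    apply: ex_RInt_cont => x; apply: gauss_continuous.
rewrite !Rplus_0_r Rmult_0_r /gmom (@RInt_split _ 0 (l * T) T);
  last exact: gauss_continuous.
suff : 0 <= RInt (gauss c 0) (l * T) T by lra.
rewrite -[X in X <= _](_ : RInt (fun=> 0) (l * T) T = 0); last first.
  by rewrite RInt_const /scal /= /mult /=; ring.
apply: RInt_mono => [|x|x|x xT];
  [by nra | exact: continuous_const | exact: gauss_continuous |].
by apply: gauss_ge0; nra.
Qed.

(** * Positivity of the quadratic form, from bounds on [A] and [H] alone *)

Section Laguerre.

Variables (s K : R) (A H : R -> R).
Hypothesis s_bd : 0 < s <= 1 / 60.
Hypothesis K_bd : 3 / s ^ 3 <= K <= 3.3 / s ^ 3.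
Hypothesis A_cont : forall x, continuous A x.
Hypothesis H_cont : forall x, continuous H x.
Hypothesis A_ge0 : forall x, 0 <= A x.
Hypothesis A_ge : forall x, 0 <= x -> exp (- (K * x ^ 2 / 2)) <= A x.
Hypothesis A_le : forall x, 0 <= x ->
  A x <= exp (- (K * x ^ 2 / 2) + 43.725 / s ^ 5 * x ^ 4 / 24).
Hypothesis H_bd : forall x, 0 <= x -> 0 <= H x <= 10.2 / s ^ 4 * x ^ 3 / 6.
Hypothesis A_far : forall x y0, 0 <= y0 <= 1.994 / s ^ 2 * (1 - cos x) ->
  A x <= exp (- (y0 / (1 + y0) / s) + (1 - cos x) + 0.001).

(** [T] ends the Gaussian core, [h] is the cubic coefficient [10.2 / 6 / s^4] bounding the phase,
    and [t] is the large parameter. On the core the quartic term weakens [K] by at most the factor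
    [1 - 1.21459 / 9], which is just above [0.93^2 = 0.8649]. *)
Notation T := (s / 3).
Notation h := (1.7 / s ^ 4).
Notation t := (1 / s).
Notation KL := (0.93 ^ 2 * K).

Let s_gt0 : 0 < s. Proof. by case: s_bd. Qed.
Let t_ge : 60 <= t. Proof. by apply/(Rle_div_r _ _ _ s_gt0); case: s_bd; lra. Qed.
Let T_gt0 : 0 < T. Proof. by have := s_gt0; lra. Qed.
Let sp k : 0 < s ^ k. Proof. exact: pow_lt. Qed.
Let K_gt0 : 0 < K.
Proof.
have [K_ge _] := K_bd; have : 0 < 3 / s ^ 3 by apply: Rdiv_lt_0_compat;
  [lra | exact: sp].
lra.
Qed.
Let T_lt_PI : T < PI. Proof. by have := PI2_3_2; case: s_bd; lra. Qed.

(* Here [1.21459 >= 43.725 / 36] bounds [s^2 K4 / (12 K2)]. *)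
Lemma A_core q c x : 0 <= x <= q * s -> c <= 1 - 1.21459 * q ^ 2 ->
  A x <= exp (- (c * K * x ^ 2 / 2)).
Proof.
move=> [x_ge0 x_le] c_le; apply: Rle_trans (A_le x_ge0) _; apply: exp_mono.
have x2_le : x ^ 2 <= q ^ 2 * s ^ 2 by rewrite -Rpow_mult_distr; apply: pow_incr.
have x2_ge0 := pow2_ge_0 x.
have K3 : 3 / s ^ 3 * x ^ 2 <= K * x ^ 2 by apply: Rmult_le_compat_r; [|case: K_bd].
have s3_inv := Rinv_0_lt_compat _ (sp 3).
have : 43.725 / s ^ 5 * x ^ 4 / 24 <= 1.21459 * q ^ 2 * (3 / s ^ 3 * x ^ 2) / 2.
  have -> : 43.725 / s ^ 5 * x ^ 4 / 24
    = 43.725 / 24 * (/ s ^ 5 * x ^ 2 * x ^ 2) by field; have := s_gt0; lra.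
  have -> : 1.21459 * q ^ 2 * (3 / s ^ 3 * x ^ 2) / 2
     = 1.21459 * 3 / 2 * (/ s ^ 5 * (q ^ 2 * s ^ 2) * x ^ 2) by field; have := s_gt0;
       lra.
  have : / s ^ 5 * x ^ 2 * x ^ 2 <= / s ^ 5 * (q ^ 2 * s ^ 2) * x ^ 2.
    apply: Rmult_le_compat_r => //; apply: Rmult_le_compat_l => //.
    exact/Rlt_le/Rinv_0_lt_compat/sp.
  have : 0 <= / s ^ 5 * (q ^ 2 * s ^ 2) * x ^ 2.
    by apply: Rmult_le_pos => //; apply: Rmult_le_pos;
      [exact/Rlt_le/Rinv_0_lt_compat/sp | lra].
  lra.
have : 1.21459 * q ^ 2 * (3 / s ^ 3 * x ^ 2) <= 1.21459 * q ^ 2 * (K * x ^ 2).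
  by apply: Rmult_le_compat_l => //; have := pow2_ge_0 q; lra.
have : c * (K * x ^ 2) <= (1 - 1.21459 * q ^ 2) * (K * x ^ 2).
  by apply: Rmult_le_compat_r => //; apply: Rmult_le_pos; have := K_gt0; lra.
lra.
Qed.

Lemma A_core_T x : 0 <= x <= T -> A x <= exp (- (KL * x ^ 2 / 2)).
Proof. by move=> xT; apply: (@A_core (1 / 3)); lra. Qed.

(** The fourth power is the highest one met outside the core. Lower powers follow by dividing by a
    power of [T], so a single tail integral has to be estimated. *)
Definition tail_integral := RInt (fun x => A x * x ^ 4) T PI.

Let Apow_cont p x : continuous (fun x => A x * x ^ p) x.
Proof. by apply: cont_mul => //; smooth. Qed.

Lemma annulus_le a b E : 0 <= a <= b -> (forall x, a < x < b -> A x <= E) ->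
  RInt (fun x => A x * x ^ 4) a b <= (b - a) * b ^ 4 * E.
Proof.
move=> ab A_leE; apply: (Rle_trans _ (RInt (fun=> E * b ^ 4) a b)).
  apply: RInt_mono => [|x|x|x xab];
    [lra | exact: Apow_cont | exact: continuous_const |].
  apply: Rmult_le_compat; [exact: A_ge0 | by apply: pow_le; lra | exact: A_leE |].
  by apply: pow_incr; lra.
by rewrite RInt_const /scal /= /mult /=; apply: Req_le; ring.
Qed.

Lemma annulus_core_le a b c e : 0 <= a <= b -> 0 <= c <= 1 - 1.21459 * b ^ 2 ->
  e <= 3 / 2 * c * a ^ 2 ->
  RInt (fun x => A x * x ^ 4) (a * s) (b * s)
    <= (b - a) * b ^ 4 * s ^ 5 * exp (- (e * t)).
Proof.
move=> ab c_bd e_le; have s0 := s_gt0.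
rewrite (_ : _ * s ^ 5 * _ = (b * s - a * s) * (b * s) ^ 4 * exp (- (e * t)));
  last by ring.
apply: annulus_le => [|x x_bd]; first by split; nra.
have as_ge0 : 0 <= a * s by nra.
apply: Rle_trans (@A_core b c x _ _) _; [by lra | by lra |].
apply: exp_mono.
have x2_ge : a ^ 2 * s ^ 2 <= x ^ 2 by rewrite -Rpow_mult_distr; apply: pow_incr; nra.
have as2_ge0 : 0 <= a ^ 2 * s ^ 2 by rewrite -Rpow_mult_distr; apply: pow2_ge_0.
have [K_ge _] := K_bd.
have KX : 3 / s ^ 3 * (a ^ 2 * s ^ 2) <= K * x ^ 2.
  by apply: Rmult_le_compat => //; apply/Rlt_le/Rdiv_lt_0_compat; [lra | exact: sp].
have : c * (3 / s ^ 3 * (a ^ 2 * s ^ 2))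
  <= c * (K * x ^ 2) by apply: Rmult_le_compat_l; lra.
have -> : c * (3 / s ^ 3 * (a ^ 2 * s ^ 2)) = 2 * (3 / 2 * c * a ^ 2) * t by field; lra.
have : e * t <= 3 / 2 * c * a ^ 2 * t by apply: Rmult_le_compat_r; have := t_ge; lra.
lra.
Qed.

Lemma one_minus_cos_ge q x : 0 <= q <= 2 -> q * s <= x <= PI ->
  0.9999 * q ^ 2 * s ^ 2 / 2 <= 1 - cos x.
Proof.
move=> q_bd x_bd; have s0 := s_bd; have qs_ge0 : 0 <= q * s by nra.
have qs_le : q * s <= 1 / 30 by nra.
have PI_ge3 := PI2_3_2.
have : cos x <= cos (q * s) by apply: cos_decr_1; lra.
have := cos_le_quartic qs_ge0.
rewrite (_ : (q * s) ^ 4 = (q * s) ^ 2 * (q * s) ^ 2); last by ring.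
have := pow_incr _ _ 2 (conj qs_ge0 qs_le); have := pow2_ge_0 (q * s).
rewrite -[0.9999 * _ * _](_ : 0.9999 * (q * s) ^ 2 = _); last by ring.
by move: ((q * s) ^ 2) => z z_ge0 z_le; nra.
Qed.

(** The constant 0.9969 is [1.994 * 0.9999 / 2] rounded down. The bound [m] is tiny close to 0 and
    equals 2 on the rest of the circle. *)
Lemma annulus_far_le a b y0 e : 0 <= a <= 2 -> a <= b -> b * s <= PI ->
  0 <= y0 <= 0.9969 * a ^ 2 -> e <= y0 / (1 + y0) -> forall m,
  (forall x, a * s < x < b * s -> 1 - cos x <= m) ->
  RInt (fun x => A x * x ^ 4) (a * s) (b * s)
  <= (b - a) * b ^ 4 * s ^ 5 * exp (- (e * t) + m + 0.001).
Proof.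
move=> a_bd ab bs_le y0_bd e_le m m_ge; have s0 := s_gt0.
rewrite (_ : _ * s ^ 5 * _
  = (b * s - a * s) * (b * s) ^ 4 * exp (- (e * t) + m + 0.001)); last by ring.
apply: annulus_le => [|x x_bd]; first by split; nra.
apply: Rle_trans (@A_far x y0 _) _.
  split; first lra; have := @one_minus_cos_ge a x a_bd ltac:(lra).
  have s2_inv := Rinv_0_lt_compat _ (sp 2) => H1.
  have : 1.994 / s ^ 2 * (0.9999 * a ^ 2 * s ^ 2 / 2) <= 1.994 / s ^ 2 * (1 - cos x).
    by apply: Rmult_le_compat_l => //; apply: Rmult_le_pos; lra.
  have -> : 1.994 / s ^ 2 * (0.9999 * a ^ 2 * s ^ 2 / 2)
    = 1.994 * 0.9999 / 2 * a ^ 2 by field; lra.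
  by have := pow2_ge_0 a; lra.
apply: exp_mono; have := m_ge x x_bd.
have : e * t <= y0 / (1 + y0) * t by apply: Rmult_le_compat_r; have := t_ge; lra.
by rewrite (_ : y0 / (1 + y0) * t = y0 / (1 + y0) / s); [lra | field; lra].
Qed.

(* The range [s / 3 <= x <= PI] is cut at [0.4 s], [0.5 s], [0.7 s] and [2 s];
   the quartic bound [A_le] is used up to [0.5 s], and [A_far] beyond. *)
Lemma tail_integral_le : tail_integral <= 0.264 * s ^ 8.
Proof.
have s0 := s_gt0; have t60 := t_ge.
(* An annulus gives [s^5 exp (- e t)]; the missing [s^3] comes from the decay of [t^3 exp (- e t)]
   beyond [t = 60], and [216000 = 60^3]. *)
have cubic e v : 3 <= e * 60 -> 216000 * exp (- (e * 60)) <= v ->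
    s ^ 5 * exp (- (e * t)) <= v * s ^ 8.
  move=> e_ge v_ge; have := @pow_exp_decay 3 e 60 t ltac:(lra) ltac:(rewrite /=;
    lra) t60.
  move=> D; have : t ^ 3 * exp (- (e * t)) <= v by lra.
  have -> : s ^ 5 * exp (- (e * t)) = s ^ 8 * (t ^ 3 * exp (- (e * t))) by field; lra.
  by move=> ?; rewrite Rmult_comm; apply: Rmult_le_compat_r => //; apply/Rlt_le/sp.
have pt : PI / s * s = PI by field; lra.
have small b x : 0 <= b <= 2 -> 0 < x < b * s -> 1 - cos x <= 0.001.
  move=> b_bd x_bd; have x_ge0 : 0 <= x by lra.
  have := cos_ge_quadratic x_ge0; have : x <= 1 / 30 by case: s_bd; nra.
  nra.
have exp_small : exp (0.001 + 0.001) <= 1.003.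
  have := exp_ineq1_le (- (0.001 + 0.001)); rewrite exp_Ropp => e_ge.
  have e_gt0 := exp_pos (0.001 + 0.001).
  have : exp (0.001 + 0.001) * / exp (0.001 + 0.001) = 1 by apply: Rinv_r; lra.
  nra.
have r1 : RInt (fun x => A x * x ^ 4) (1 / 3 * s) (0.4 * s) <= 0.1178 * s ^ 8.
  (* [0.80566] is [1 - 1.21459 * 0.4^2] and [0.13427] is [3 / 2 * 0.80566 / 9], both rounded
     down. *)
  apply: Rle_trans (@annulus_core_le (1 / 3) 0.4 0.80566 0.13427 _ _ _) _; try lra.
  rewrite Rmult_assoc; have := cubic 0.13427 69;
    rewrite (_ : 0.13427 * 60 = 64 * 0.125878125); last lra.
  have := @exp_neg64_le 0.125878125 1.1341 ltac:(lra) ltac:(lra) ltac:(lra).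
  move: (exp (- (64 * _))) (s ^ 5 * _) => e1 e2 e1_le /(_ ltac:(lra)) C.
  by have := C ltac:(lra); have := sp 8; lra.
have r2 : RInt (fun x => A x * x ^ 4) (0.4 * s) (0.5 * s) <= 0.0604 * s ^ 8.
  apply: Rle_trans (@annulus_core_le 0.4 0.5 0.69635 0.16712 _ _ _) _; try lra.
  rewrite Rmult_assoc; have := cubic 0.16712 9.65;
    rewrite (_ : 0.16712 * 60 = 64 * 0.156675); last lra.
  have := @exp_neg64_le 0.156675 1.1695 ltac:(lra) ltac:(lra) ltac:(lra).
  move: (exp (- (64 * _))) (s ^ 5 * _) => e1 e2 e1_le /(_ ltac:(lra)) C.
  by have := C ltac:(lra); have := sp 8; lra.
have PI_ge3 := PI2_3_2; have PI_le4 := PI_4; have s_le : s <= 1 / 60 by case: s_bd.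
have r3 : RInt (fun x => A x * x ^ 4) (0.5 * s) (0.7 * s) <= 0.0687 * s ^ 8.
  (* [0.2492] is [0.9969 * 0.5^2], and [0.199] lies below [0.2492 / 1.2492]. The later annuli are
     treated alike. *)
  apply: Rle_trans (@annulus_far_le 0.5 0.7 0.2492 0.199 _ _ _ _ _ 0.001 _) _; try lra.
    by move=> x x_bd; apply: (small 0.7); lra.
  rewrite Rplus_assoc exp_plus -Rmult_assoc (Rmult_assoc (_ * _) (s ^ 5)).
  have := cubic 0.199 1.425; rewrite (_ : 0.199 * 60 = 64 * 0.1865625); last lra.
  have := @exp_neg64_le 0.1865625 1.205 ltac:(lra) ltac:(lra) ltac:(lra).
  have := exp_pos (0.001 + 0.001); have := exp_pos (- (0.199 * t)); have := sp 5.
  move: (exp (- (64 * _))) (exp (0.001 + 0.001)) exp_small (exp (- (_ * t))) =>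
    e1 e2 e2_le e3.
  move=> s5 e3_gt0 e2_gt0 e1_le /(_ ltac:(lra)) C; have {}C := C ltac:(lra).
  have := Rmult_lt_0_compat _ _ s5 e3_gt0; move: (s ^ 5 * e3) C => z *.
  by have := sp 8; nra.
have r4 : RInt (fun x => A x * x ^ 4) (0.7 * s) (2 * s) <= 0.0134 * s ^ 8.
  apply: Rle_trans (@annulus_far_le 0.7 2 0.4884 0.328 _ _ _ _ _ 0.001 _) _; try lra.
    by move=> x x_bd; apply: (small 2); lra.
  rewrite Rplus_assoc exp_plus -Rmult_assoc (Rmult_assoc (_ * _) (s ^ 5)).
  have := cubic 0.328 0.00064; rewrite (_ : 0.328 * 60 = 64 * 0.3075); last lra.
  have := @exp_neg64_le 0.3075 1.3596 ltac:(lra) ltac:(lra) ltac:(lra).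
  have := exp_pos (0.001 + 0.001); have := exp_pos (- (0.328 * t)); have := sp 5.
  move: (exp (- (64 * _))) (exp (0.001 + 0.001)) exp_small (exp (- (_ * t))) =>
    e1 e2 e2_le e3.
  move=> s5 e3_gt0 e2_gt0 e1_le /(_ ltac:(lra)) C; have {}C := C ltac:(lra).
  have := Rmult_lt_0_compat _ _ s5 e3_gt0; move: (s ^ 5 * e3) C => z *.
  by have := sp 8; nra.
have r5 : RInt (fun x => A x * x ^ 4) (2 * s) (PI / s * s) <= 0.0036 * s ^ 8.
  have b_ge : 2 <= PI / s by apply/(Rle_div_r _ _ _ s0); lra.
  apply: Rle_trans (@annulus_far_le 2 (PI / s) 3.9876 0.799 _ _ _ _ _ 2 _) _; try lra.
    by move=> x _; have := COS_bound x; lra.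
  apply: (Rle_trans _ (1024 * (exp (- (0.799 * t)) * 9.1))).
    apply: Rmult_le_compat; [| exact/Rlt_le/exp_pos | |].
    - by apply: Rmult_le_pos; [apply: Rmult_le_pos; [lra | apply: pow_le;
      lra] | exact/Rlt_le/sp].
    - have : (PI / s) ^ 5 * s ^ 5 = PI ^ 5 by field; lra.
      have : PI ^ 5 <= 4 ^ 5 by apply: pow_incr; lra.
      have : 0 <= 2 * ((PI / s) ^ 4 * s ^ 5).
        by apply: Rmult_le_pos; [lra | apply: Rmult_le_pos; [apply: pow_le;
          lra | exact/Rlt_le/sp]].
      rewrite /=; lra.
    rewrite Rplus_assoc exp_plus; apply: Rmult_le_compat_l; first exact/Rlt_le/exp_pos.
    have -> : 2 + 0.001 = 1 + (1 + 0.001) by ring.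
    rewrite !exp_plus; have := exp_le_3; have := exp_pos 1.
    have : exp 0.001 <= 1.003.
      by apply: Rle_trans exp_small; apply: exp_mono; lra.
    have := exp_pos 0.001; move: (exp 1) (exp 0.001) => e f f0 f1 e0 e3.
    have : e * f <= 3.009 by nra.
    have : 0 < e * f by nra.
    by nra.
  have z_le : t ^ 8 * exp (- (0.799 * t)) <= 2.8e-7.
    apply: Rle_trans (@pow_exp_decay 8 0.799 60 t _ _ t60) _;
      [lra | rewrite INR_IZR_INZ /=; lra |].
    have -> : - (0.799 * 60) = - (64 * 0.37453125) + - (64 * 0.37453125) by lra.
    rewrite exp_plus; have := exp_pos (- (64 * 0.37453125)).
    have := @exp_neg64_le 0.37453125 1.4534 ltac:(lra) ltac:(lra) ltac:(lra).
    move: (exp (- (64 * _))) => e1 e1_le e1_gt0.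
    have {}e1_le : e1 <= 4.06e-11 by lra.
    by nra.
  have -> : exp (- (0.799 * t)) = s ^ 8 * (t ^ 8 * exp (- (0.799 * t))) by field; lra.
  by have := sp 8; have := Rmult_le_compat_l _ _ _ (Rlt_le _ _ (sp 8)) z_le; lra.
(* The five pieces add up to [0.2639 s^8]. *)
rewrite /tail_integral (@RInt_split _ T (0.4 * s) PI); last exact: Apow_cont.
rewrite (@RInt_split _ (0.4 * s) (0.5 * s) PI); last exact: Apow_cont.
rewrite (@RInt_split _ (0.5 * s) (0.7 * s) PI); last exact: Apow_cont.
rewrite (@RInt_split _ (0.7 * s) (2 * s) PI); last exact: Apow_cont.
rewrite pt in r5; rewrite (_ : 1 / 3 * s = T) in r1; last by field.
have := sp 8; lra.
Qed.

Notation M := (gmom K T 0).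

(** The true order is [s^(3/2)], but for [s <= 1 / 60] a multiple of [s^2] is enough and avoids
    square roots. Integrating [1 - K x^2 / 2] up to [6 s^2] gives at least [6 s^2 - 118.8 s^3]. *)
Lemma gmom0_ge : 4 * s ^ 2 <= M.
Proof.
have s0 := s_gt0; have s_le : s <= 1 / 60 by case: s_bd.
have s2 := sp 2; have six_le : 6 * s ^ 2 <= T by rewrite /=; nra.
rewrite /gmom (@RInt_split _ 0 (6 * s ^ 2) T); last exact: gauss_continuous.
have rest : 0 <= RInt (gauss K 0) (6 * s ^ 2) T.
  rewrite -[X in X <= _](_ : RInt (fun=> 0) (6 * s ^ 2) T = 0); last first.
    by rewrite RInt_const /scal /= /mult /=; ring.
  apply: RInt_mono => [|x|x|x xb];
    [by [] | exact: continuous_const | exact: gauss_continuous |].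
  by apply: gauss_ge0; lra.
suff : 4 * s ^ 2 <= RInt (gauss K 0) 0 (6 * s ^ 2) by lra.
set L := 6 * s ^ 2 in six_le rest *; have L_gt0 : 0 < L by rewrite /L; lra.
have poly : RInt (fun x => 1 - K * x ^ 2 / 2) 0 L = L - K * L ^ 3 / 6.
  apply: is_RInt_unique.
  have E : minus (L - K * L ^ 3 / 6) (0 - K * 0 ^ 3 / 6) = L - K * L ^ 3 / 6.
    by rewrite /minus /plus /Hierarchy.opp /=; field.
  rewrite -E; apply: (is_RInt_derive (fun x => x - K * x ^ 3 / 6)) => x _;
    last by smooth.
  by auto_derive => //; field.
apply: (Rle_trans _ (RInt (fun x => 1 - K * x ^ 2 / 2) 0 L)).
  have KL3 : K * L ^ 3 <= 3.3 / s ^ 3 * L ^ 3.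
    by apply: Rmult_le_compat_r; [apply: pow_le; lra | case: K_bd].
  have E : 3.3 / s ^ 3 * L ^ 3 = 216 * 3.3 * (s ^ 2 * s) by rewrite /L; field; lra.
  have : s ^ 2 * s <= s ^ 2 * (1 / 60) by apply: Rmult_le_compat_l; lra.
  by rewrite poly /L in KL3 E *; lra.
apply: RInt_mono => [|x|x|x xb]; [lra | by smooth | exact: gauss_continuous |].
by rewrite /gauss pow_O Rmult_1_l; apply: Rle_trans (exp_ineq1_le _); lra.
Qed.

Lemma tail_pow_le p : (p <= 4)%N ->
  RInt (fun x => A x * x ^ p) T PI <= tail_integral / T ^ (4 - p).
Proof.
move=> le_p4; have Tp := pow_lt T (4 - p) T_gt0.
apply/(Rle_div_r _ _ _ Tp); rewrite Rmult_comm.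
rewrite -[X in X <= _]Rplus_0_r -(Rmult_0_l (RInt (fun x => A x * x ^ p) T PI)).
rewrite -RInt_lin; try exact: Apow_cont; rewrite /tail_integral.
have T_PI := T_lt_PI; have T0 := T_gt0.
apply: RInt_mono => [|x|x|x xb]; [lra | | exact: Apow_cont |].
  apply: (@continuous_plus _ _ R_NormedModule);
    apply: (@continuous_scal_r _ _ R_NormedModule); exact: Apow_cont.
rewrite (_ : T ^ (4 - p) * (A x * x ^ p) + 0 * (A x * x ^ p)
  = A x * (T ^ (4 - p) * x ^ p)); last by ring.
apply: Rmult_le_compat_l => //.
have -> : x ^ 4 = x ^ (4 - p) * x ^ p by rewrite -pow_add plusE subnK.
apply: Rmult_le_compat_r.
  by apply: pow_le; lra.
by apply: pow_incr; lra.
Qed.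

Lemma integral_abs_le (F : R -> R) c1 p1 c2 p2 :
  (forall x, continuous F x) -> (p2 <= 4)%N -> 0 <= c2 ->
  (forall x, 0 < x < T -> Rabs (F x) <= c1 * gauss KL p1 x) ->
  (forall x, T < x < PI -> Rabs (F x) <= c2 * (A x * x ^ p2)) ->
  Rabs (RInt F 0 PI) <= c1 * gmom KL T p1 + c2 * (tail_integral / T ^ (4 - p2)).
Proof.
move=> F_cont le_p2 c2_ge0 F_core F_tail; have T_PI := T_lt_PI; have T0 := T_gt0.
rewrite (@RInt_split _ 0 T PI) //; apply: Rle_trans (Rabs_triang _ _) _.
have absF_cont x : continuous (fun x => Rabs (F x)) x.
  by apply: (continuous_comp F Rabs) => //;
    apply/continuity_pt_filterlim/Rcontinuity_abs.
have lin_cont (f : R -> R) c : (forall x, continuous f x) ->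
  forall x, continuous (fun x => c * f x + 0 * f x) x.
  by move=> cf x; apply: (@continuous_plus _ _ R_NormedModule);
    apply: (@continuous_scal_r _ _ R_NormedModule).
have abs_le (f : R -> R) c a b : a <= b -> (forall x, continuous f x) ->
    (forall x, a < x < b -> Rabs (F x) <= c * f x) ->
      Rabs (RInt F a b) <= c * RInt f a b.
  move=> ab cf le_f; apply: (Rle_trans _ (RInt (fun x => Rabs (F x)) a b)).
    by apply: abs_RInt_le => //; apply: ex_RInt_cont.
  rewrite -[X in _ <= X]Rplus_0_r -(Rmult_0_l (RInt f a b)) -RInt_lin //.
  apply: RInt_mono => // [|x xb]; first exact: lin_cont.
  by have := le_f x xb; lra.
apply: Rplus_le_compat.
  by apply: (abs_le) => //; [lra | exact: gauss_continuous].
apply: Rle_trans (Rmult_le_compat_l _ _ _ c2_ge0 (tail_pow_le le_p2)).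
by apply: (abs_le (fun x => A x * x ^ p2)) => //; lra.
Qed.

(** On the core [cos H >= 1 - H^2 / 2]: the main part takes the Gaussian lower bound of [A], and the
    subtracted part the wider Gaussian upper bound. Beyond [T] only [cos H >= -1] is used. The
    factor 0.9999 compares [1 - cos x] with [x^2 / 2] for [x <= 1 / 180]. *)
Lemma moment_ge k : (k <= 2)%N ->
  (0.9999 / 2) ^ k * gmom K T (2 * k)
    - h ^ 2 / 2 * (1 / 2) ^ k * gmom KL T (2 * k + 6)
    - (1 / 2) ^ k * (tail_integral / T ^ (4 - 2 * k))
  <= RInt (fun x => A x * (cos (H x) * (1 - cos x) ^ k)) 0 PI.
Proof.
have pow_2k (y : R) : y ^ (2 * k) = (y ^ 2) ^ k by rewrite -pow_mult multE.
move=> le_k2; have T_PI := T_lt_PI; have T0 := T_gt0;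
  have s_le : s <= 1 / 60 by case: s_bd.
have F_cont x : continuous (fun x => A x * (cos (H x) * (1 - cos x) ^ k)) x.
  by apply: cont_mul => //; apply: cont_mul; [exact: cont_cos | smooth].
rewrite (@RInt_split _ 0 T PI) //; apply: (Rplus_le_compat (_ - _) _ (- _)).
  rewrite [X in X <= _](_ : _ = (0.9999 / 2) ^ k * gmom K T (2 * k)
     + (- (h ^ 2 / 2 * (1 / 2) ^ k)) * gmom KL T (2 * k + 6)); last by ring.
  rewrite -RInt_lin; try exact: gauss_continuous.
  apply: RInt_mono => [|x|x|x xb]; [lra | | exact: F_cont |].
    apply: (@continuous_plus _ _ R_NormedModule);
      apply: (@continuous_scal_r _ _ R_NormedModule); exact: gauss_continuous.
  have x_ge0 : 0 <= x by lra.
  have [H_ge0 H_le] := H_bd x_ge0; have := cos_ge_quadratic H_ge0.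
  have u_le : 1 - cos x <= x ^ 2 / 2 by have := cos_ge_quadratic x_ge0; lra.
  have u_ge : 0.9999 / 2 * x ^ 2 <= 1 - cos x.
    have := cos_le_quartic x_ge0; rewrite (_ : x ^ 4 = x ^ 2 * x ^ 2); last by ring.
    have : x ^ 2 <= (1 / 180) ^ 2 by apply: pow_incr; lra.
    by have := pow2_ge_0 x; move: (x ^ 2) => z; nra.
  have uk_le : (1 - cos x) ^ k <= (1 / 2) ^ k * x ^ (2 * k).
    rewrite pow_2k -Rpow_mult_distr; apply: pow_incr; have := pow2_ge_0 x; lra.
  have uk_ge : (0.9999 / 2) ^ k * x ^ (2 * k) <= (1 - cos x) ^ k.
    rewrite pow_2k -Rpow_mult_distr; apply: pow_incr; have := pow2_ge_0 x; lra.
  have uk_ge0 : 0 <= (1 - cos x) ^ k by apply: pow_le; have := COS_bound x; lra.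
  have A_lo := A_ge x_ge0; have xT : 0 <= x <= T by lra.
  have A_hi := A_core_T xT.
  have H2_le : H x ^ 2 <= h ^ 2 * x ^ 6.
    rewrite (_ : h ^ 2 * x ^ 6 = (10.2 / s ^ 4 * x ^ 3 / 6) ^ 2); last first.
      rewrite (_ : 10.2 = 6 * 1.7); last by lra.
      by field; have := s_gt0; lra.
    by apply: pow_incr.
  have H2_ge0 := pow2_ge_0 (H x).
  move=> cosH_ge; have term1 : (0.9999 / 2) ^ k * gauss K (2 * k) x
    <= A x * (1 - cos x) ^ k.
    rewrite /gauss (_ : _ * (_ * _)
      = exp (- (K * x ^ 2 / 2)) * ((0.9999 / 2) ^ k * x ^ (2 * k))); last by ring.
    apply: Rmult_le_compat => //; first exact/Rlt_le/exp_pos.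
    by apply: Rmult_le_pos; apply: pow_le; lra.
  have term2 : A x * (H x ^ 2 * (1 - cos x) ^ k)
    <= h ^ 2 * (1 / 2) ^ k * gauss KL (2 * k + 6) x.
    rewrite /gauss pow_add (_ : _ * (_ * _ * _)
      = exp (- (KL * x ^ 2 / 2)) * (h ^ 2 * x ^ 6 * ((1 / 2) ^ k * x ^ (2 * k))));
        last by ring.
    apply: Rmult_le_compat => //; first exact: Rmult_le_pos.
    exact: Rmult_le_compat.
  have : A x * ((1 - H x ^ 2 / 2) * (1 - cos x) ^ k)
    <= A x * (cos (H x) * (1 - cos x) ^ k).
    by apply: Rmult_le_compat_l => //; apply: Rmult_le_compat_r.
  move: term1 term2; move: (h ^ 2) ((1 / 2) ^ k) ((0.9999 / 2) ^ k) ((1 - cos x) ^ k).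
  move: (gauss _ _ _) (gauss _ _ _) (H x ^ 2) (cos (H x)) (A x) => *; lra.
have le_2k : (2 * k <= 4)%N by rewrite (leq_mul2l 2 k 2).
apply: (Rle_trans _ (- ((1 / 2) ^ k * RInt (fun x => A x * x ^ (2 * k)) T PI))).
  apply: Ropp_le_contravar; apply: Rmult_le_compat_l; first by apply: pow_le; lra.
  exact: tail_pow_le.
rewrite [X in X <= _](_ : _ = - (1 / 2) ^ k * RInt (fun x => A x * x ^ (2 * k)) T PI
  + 0 * RInt (fun x => A x * x ^ (2 * k)) T PI); last by ring.
rewrite -RInt_lin; try exact: Apow_cont.
apply: RInt_mono => [|x|x|x xb]; [lra | | exact: F_cont |].
  apply: (@continuous_plus _ _ R_NormedModule);
    apply: (@continuous_scal_r _ _ R_NormedModule); exact: Apow_cont.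
have x_ge0 : 0 <= x by lra.
have uk_le : (1 - cos x) ^ k <= (1 / 2) ^ k * x ^ (2 * k).
  rewrite pow_2k -Rpow_mult_distr; apply: pow_incr; split;
    first by have := COS_bound x; lra.
  by have := cos_ge_quadratic x_ge0; lra.
have uk_ge0 : 0 <= (1 - cos x) ^ k by apply: pow_le; have := COS_bound x; lra.
have : A x * (- ((1 / 2) ^ k * x ^ (2 * k))) <= A x * (cos (H x) * (1 - cos x) ^ k).
  apply: Rmult_le_compat_l => //; have := COS_bound (H x); nra.
by move: ((1 / 2) ^ k) (x ^ (2 * k)) => *; lra.
Qed.

(* With [a = gmom K T 0], the three moments are at least [0.9759 a], [0.3915 a / K]
   and [0.099 a / K^2], against [|o1 O1| <= 0.1171 (a / K)^2]. *)
Lemma laguerre_pos (e0 e1 e2 O1 o1 : R) :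
  RInt (fun x => A x * (cos (H x) * (1 - cos x) ^ 0)) 0 PI = e0 ->
  RInt (fun x => A x * (cos (H x) * (1 - cos x) ^ 1)) 0 PI = e1 ->
  RInt (fun x => A x * (cos (H x) * (1 - cos x) ^ 2)) 0 PI = e2 ->
  RInt (fun x => A x * (sin (H x) * sin x)) 0 PI = O1 ->
  RInt (fun x => A x * (sin (H x) * (sin x * (1 - cos x)))) 0 PI = o1 ->
  0 < 12 * e1 ^ 2 + 4 * e0 * e2 + 4 * e2 ^ 2 - 16 * e1 * e2 + 8 * o1 * O1 - 4 * o1 ^ 2.
Proof.
move=> e0E e1E e2E O1E o1E.
have s0 := s_gt0; have s_le : s <= 1 / 60 by case: s_bd.
have T0 := T_gt0; have K0 := K_gt0.
have KL_gt0 : 0 < KL by lra.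
have T_PI := T_lt_PI.
have h_gt0 : 0 < h by apply: Rdiv_lt_0_compat; [lra | exact: sp].
have core_sin x : 0 < x < T -> Rabs (sin (H x)) <= h * x ^ 3.
  move=> xb; have x_ge0 : 0 <= x by lra.
  have [H_ge0 H_le] := H_bd x_ge0.
  have : h * x ^ 3 = 10.2 / s ^ 4 * x ^ 3 / 6.
    by rewrite (_ : 10.2 = 6 * 1.7); [field; lra | lra].
  have := sin_le_id H_ge0; have : - H x <= sin (H x).
    case: (Rle_dec (H x) PI) => [H_le_PI|]; first by have := sin_ge_0 _ H_ge0 H_le_PI;
      lra.
    by have := PI2_3_2; have := SIN_bound (H x); lra.
  by move=> *; apply: Rabs_le; lra.
have A_abs x : Rabs (A x) = A x by apply/Rabs_right/Rle_ge.
have sin_abs x : 0 < x < PI -> Rabs (sin x) <= x.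
  move=> xb; rewrite Rabs_right; first by apply: sin_le_id; lra.
  by apply/Rle_ge/sin_ge_0; lra.
have u_abs x : 0 < x < PI -> Rabs (1 - cos x) <= x ^ 2 / 2.
  move=> xb; rewrite Rabs_right; last by have := COS_bound x; lra.
  by have := @cos_ge_quadratic x ltac:(lra); lra.
have cos1 y : Rabs (cos y) <= 1 by apply: Rabs_le; have := COS_bound y; lra.
have sin1 y : Rabs (sin y) <= 1 by apply: Rabs_le; have := SIN_bound y; lra.
have core F c p x : 0 < x < T -> Rabs F <= c * x ^ p ->
  Rabs (A x * F) <= c * gauss KL p x.
  move=> xb F_le; rewrite Rabs_mult A_abs /gauss.
  rewrite (_ : c * (_ * _) = exp (- (KL * x ^ 2 / 2)) * (c * x ^ p)); last by ring.
  by apply: Rmult_le_compat => //; [exact: Rabs_pos | apply: A_core_T; lra].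
have rest F c p x : Rabs F <= c * x ^ p -> Rabs (A x * F) <= c * (A x * x ^ p).
  move=> F_le; rewrite Rabs_mult A_abs (_ : c * _ = A x * (c * x ^ p)); last by ring.
  exact: Rmult_le_compat_l.
have O1_le : Rabs O1 <= h * gmom KL T 4 + 1 * (tail_integral / T ^ 3).
  rewrite -O1E; apply: (@integral_abs_le _ h 4 1 1) => //; try lra.
  - by move=> x; apply: cont_mul => //; apply: cont_mul; [exact: cont_sin | smooth].
  - move=> x xb; apply: core => //; rewrite Rabs_mult (_ : h * x ^ 4 = h * x ^ 3 * x);
    last by ring.
    by apply: Rmult_le_compat; try exact: Rabs_pos; [exact: core_sin | apply: sin_abs;
      lra].
  move=> x xb; apply: rest; rewrite Rabs_mult pow_1.
  by apply: Rmult_le_compat; try exact: Rabs_pos; [exact: sin1 | apply: sin_abs; lra].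
have o1_le : Rabs o1 <= h / 2 * gmom KL T 6 + 1 / 2 * (tail_integral / T ^ 1).
  rewrite -o1E; apply: (@integral_abs_le _ (h / 2) 6 (1 / 2) 3) => //; try lra.
  - by move=> x; apply: cont_mul => //; apply: cont_mul; [exact: cont_sin | smooth].
  - move=> x xb; apply: core => //;
    rewrite !Rabs_mult (_ : h / 2 * x ^ 6 = h * x ^ 3 * (x * (x ^ 2 / 2)));
      last by field; lra.
    apply: Rmult_le_compat; try exact: Rabs_pos; [by apply: Rmult_le_pos;
      exact: Rabs_pos | exact: core_sin |].
    by apply: Rmult_le_compat; try exact: Rabs_pos; [apply: sin_abs;
      lra | apply: u_abs; lra].
  move=> x xb; apply: rest;
    rewrite !Rabs_mult (_ : 1 / 2 * x ^ 3 = 1 * (x * (x ^ 2 / 2))); last by field.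
  apply: Rmult_le_compat; try exact: Rabs_pos; [by apply: Rmult_le_pos;
    exact: Rabs_pos | exact: sin1 |].
  by apply: Rmult_le_compat; try exact: Rabs_pos; [apply: sin_abs; lra | apply: u_abs;
    lra].
have e1_le : Rabs e1 <= 1 / 2 * gmom KL T 2 + 1 / 2 * (tail_integral / T ^ 2).
  rewrite -e1E; apply: (@integral_abs_le _ (1 / 2) 2 (1 / 2) 2) => //; try lra.
  - by move=> x; apply: cont_mul => //; apply: cont_mul; [exact: cont_cos | smooth].
  - move=> x xb; apply: core => //;
    rewrite pow_1 Rabs_mult (_ : 1 / 2 * x ^ 2 = 1 * (x ^ 2 / 2)); last by field.
    by apply: Rmult_le_compat; try exact: Rabs_pos; [exact: cos1 | apply: u_abs; lra].
  move=> x xb; apply: rest;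
    rewrite pow_1 Rabs_mult (_ : 1 / 2 * x ^ 2 = 1 * (x ^ 2 / 2)); last by field.
  by apply: Rmult_le_compat; try exact: Rabs_pos; [exact: cos1 | apply: u_abs; lra].
have e2_le : Rabs e2 <= 1 / 4 * gmom KL T 4 + 1 / 4 * (tail_integral / T ^ 0).
  have u2_abs x : 0 < x < PI -> Rabs (cos (H x) * (1 - cos x) ^ 2) <= 1 / 4 * x ^ 4.
    move=> xb; rewrite Rabs_mult -RPow_abs (_ : 1 / 4 * x ^ 4 = 1 * (x ^ 2 / 2) ^ 2);
      last by field.
    apply: Rmult_le_compat; [exact: Rabs_pos | apply: pow_le;
      exact: Rabs_pos | exact: cos1 |].
    by apply: pow_incr; split; [exact: Rabs_pos | apply: u_abs].
  rewrite -e2E; apply: (@integral_abs_le _ (1 / 4) 4 (1 / 4) 4) => //; try lra.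
  - by move=> x; apply: cont_mul => //; apply: cont_mul; [exact: cont_cos | smooth].
  - by move=> x xb; apply: core => //; apply: u2_abs; lra.
  by move=> x xb; apply: rest; apply: u2_abs; lra.
have e0_ge : 1 * M - h ^ 2 / 2 * 1 * gmom KL T 6 - 1 * (tail_integral / T ^ 4) <= e0.
  by rewrite -e0E; exact: (@moment_ge 0 isT).
have e1_ge : (0.9999 / 2) ^ 1 * gmom K T 2 - h ^ 2 / 2 * (1 / 2) ^ 1 * gmom KL T 8
    - (1 / 2) ^ 1 * (tail_integral / T ^ 2) <= e1.
  by rewrite -e1E; exact: (@moment_ge 1 isT).
have e2_ge : (0.9999 / 2) ^ 2 * gmom K T 4 - h ^ 2 / 2 * (1 / 2) ^ 2 * gmom KL T 10
    - (1 / 2) ^ 2 * (tail_integral / T ^ 0) <= e2.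
  by rewrite -e2E; exact: (@moment_ge 2 isT).
clear e0E e1E e2E O1E o1E core_sin A_abs sin_abs u_abs cos1 sin1 core rest.
have M_lo := gmom0_ge; have s2 := sp 2; have M_gt0 : 0 < M by lra.
have tail_hi := tail_integral_le; have [K_lo K_hi] := K_bd.
have gl0 : gmom KL T 0 <= 1 / 0.93 * M.
  by have := @gmom0_scale K 0.93 T ltac:(lra) ltac:(lra); lra.
set Ki := / K; have Ki_gt0 : 0 < Ki by apply: Rinv_0_lt_compat.
have KKi : K * Ki = 1 by apply: Rinv_r; lra.
have step p C X : gmom KL T p <= C * X ->
  gmom KL T p.+2 <= INR p.+1 / 0.93 ^ 2 * C * (X * Ki).
  move=> le_p; apply: Rle_trans (gmomS_le p KL_gt0 (Rlt_le _ _ T0)) _.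
  rewrite (_ : INR p.+1 / KL = INR p.+1 / 0.93 ^ 2 * Ki); last by rewrite /Ki; field;
    lra.
  have : 0 <= INR p.+1 / 0.93 ^ 2 * Ki.
    apply: Rmult_le_pos; last lra.
    by apply: Rdiv_le_0_compat; [exact: pos_INR | lra].
  by move=> c_ge0; have := Rmult_le_compat_l _ _ _ c_ge0 le_p; lra.
have gl2 := step 0%N _ _ gl0; have gl4 := step 2%N _ _ gl2;
  have gl6 := step 4%N _ _ gl4.
have gl8 := step 6%N _ _ gl6; have gl10 := step 8%N _ _ gl8.
rewrite !INR_IZR_INZ in gl2 gl4 gl6 gl8 gl10.
cbn [Z.of_nat Pos.of_succ_nat Pos.succ] in gl2, gl4, gl6, gl8, gl10.
set X1 := M * Ki in gl2 gl4 gl6 gl8 gl10; set X2 := X1 * Ki in gl4 gl6 gl8 gl10.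
set X3 := X2 * Ki in gl6 gl8 gl10; set X4 := X3 * Ki in gl8 gl10;
  set X5 := X4 * Ki in gl10.
have X1_gt0 : 0 < X1 by apply: Rmult_lt_0_compat.
have X2_gt0 : 0 < X2 by apply: Rmult_lt_0_compat.
have X3_gt0 : 0 < X3 by apply: Rmult_lt_0_compat.
have X4_gt0 : 0 < X4 by apply: Rmult_lt_0_compat.
have X5_gt0 : 0 < X5 by apply: Rmult_lt_0_compat.
(* The constant for moment [2 p] is [(2 p - 1)!! / 0.93^(2 p + 1)], rounded up. *)
have {}gl2 : gmom KL T 2 <= 1.2434 * X1 by lra.
have {}gl4 : gmom KL T 4 <= 4.3125 * X2 by lra.
have {}gl6 : gmom KL T 6 <= 24.931 * X3 by lra.
have {}gl8 : gmom KL T 8 <= 201.78 * X4 by lra.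
have {}gl10 : gmom KL T 10 <= 2099.7 * X5 by lra.
have Ki_lo : s ^ 3 / 3.3 <= Ki.
  rewrite /Ki (_ : s ^ 3 / 3.3 = / (3.3 / s ^ 3)); last by field; lra.
  exact: Rinv_le_contravar.
have Ki_hi : Ki <= s ^ 3 / 3.
  rewrite /Ki (_ : s ^ 3 / 3 = / (3 / s ^ 3)); last by field; lra.
  by apply: Rinv_le_contravar => //; apply: Rdiv_lt_0_compat; [lra | exact: sp].
have s3_le : s ^ 3 <= (1 / 60) ^ 3 by apply: pow_incr; lra.
have s3 := sp 3.
(* This squared skewness, at most [1.7^2 / 27 * s], is the small parameter that controls all effects
   of the phase. *)
have h2Ki3 : h ^ 2 * Ki ^ 3 <= 0.001785.
  apply: (Rle_trans _ (h ^ 2 * (s ^ 3 / 3) ^ 3)).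
    apply: Rmult_le_compat_l; first exact: pow2_ge_0.
    by apply: pow_incr; lra.
  by rewrite (_ : h ^ 2 * _ = 1.7 ^ 2 / 27 * s); [lra | field; lra].
have tail_X2 : tail_integral <= 0.72 * X2.
  apply: Rle_trans tail_hi _;
    apply: (Rle_trans _ (0.72 * (4 * s ^ 2 * (s ^ 3 / 3.3) ^ 2))).
    rewrite (_ : 4 * s ^ 2 * (s ^ 3 / 3.3) ^ 2 = 4 / 3.3 ^ 2 * s ^ 8); last by field;
      lra.
    by have := sp 8; lra.
  apply: Rmult_le_compat_l; first lra.
  rewrite (_ : X2 = M * Ki ^ 2); last by rewrite /X2 /X1; ring.
  apply: Rmult_le_compat; [lra | exact: pow2_ge_0 | lra |].
  by apply: pow_incr; split; [apply: Rdiv_le_0_compat; lra | lra].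
have hX3 : h ^ 2 * X3 <= 0.001785 * M.
  rewrite (_ : h ^ 2 * X3 = h ^ 2 * Ki ^ 3 * M); last by rewrite /X3 /X2 /X1; ring.
  by apply: Rmult_le_compat_r; lra.
have hX4 : h ^ 2 * X4 <= 0.001785 * X1.
  rewrite (_ : h ^ 2 * X4 = h ^ 2 * Ki ^ 3 * X1); last by rewrite /X4 /X3 /X2 /X1; ring.
  by apply: Rmult_le_compat_r; lra.
have hX5 : h ^ 2 * X5 <= 0.001785 * X2.
  rewrite (_ : h ^ 2 * X5 = h ^ 2 * Ki ^ 3 * X2); last by rewrite /X5 /X4 /X3 /X2 /X1;
    ring.
  by apply: Rmult_le_compat_r; lra.
have tail_div p : tail_integral / T ^ p <= 0.72 * X2 / T ^ p.
  by apply: Rmult_le_compat_r => //; apply/Rlt_le/Rinv_0_lt_compat/pow_lt.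
have KiT2 : Ki / T ^ 2 <= 0.05.
  apply: (Rle_trans _ (s ^ 3 / 3 / T ^ 2)).
    by apply: Rmult_le_compat_r => //; apply/Rlt_le/Rinv_0_lt_compat/pow_lt.
  by rewrite (_ : s ^ 3 / 3 / T ^ 2 = 3 * s); [lra | field; lra].
have KiT2_ge0 : 0 <= Ki / T ^ 2 by apply: Rdiv_le_0_compat; [lra | exact: pow_lt].
have t4 : tail_integral / T ^ 4 <= 0.0018 * M.
  apply: Rle_trans (tail_div 4%N) _.
  rewrite (_ : 0.72 * X2 / T ^ 4 = 0.72 * (Ki / T ^ 2) ^ 2 * M);
    last by rewrite /X2 /X1; field; lra.
  by apply: Rmult_le_compat_r; [lra | have := pow_incr _ _ 2 (conj KiT2_ge0 KiT2); lra].
have t2 : tail_integral / T ^ 2 <= 0.036 * X1.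
  apply: Rle_trans (tail_div 2%N) _.
  rewrite (_ : 0.72 * X2 / T ^ 2 = 0.72 * (Ki / T ^ 2) * X1); last by rewrite /X2 /X1;
    field; lra.
  by apply: Rmult_le_compat_r; lra.
have t3 : tail_integral / T ^ 3 <= 0.1907 * (h * X2).
  apply: Rle_trans (tail_div 3%N) _.
  rewrite (_ : 0.72 * X2 / T ^ 3 = 0.72 * (27 / 1.7 * s) * (h * X2)); last by field;
    lra.
  by apply: Rmult_le_compat_r; [apply: Rmult_le_pos; lra | lra].
have t1 : tail_integral / T ^ 1 <= 4.1935 * (h * X3).
  apply: Rle_trans (tail_div 1%N) _.
  rewrite (_ : 0.72 * X2 / T ^ 1 = 0.72 * 3 / 1.7 * X2 * (h * s ^ 3)); last by field;
    lra.
  have : h * s ^ 3 <= h * (3.3 * Ki) by apply: Rmult_le_compat_l; lra.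
  move=> hs; have := Rmult_le_compat_l (0.72 * 3 / 1.7 * X2) _ _ ltac:(lra) hs.
  rewrite [X in _ <= X -> _](_ : _ = 0.72 * 3 * 3.3 / 1.7 * (h * X3));
    last by rewrite /X3; field; lra.
  have : 0 < h * X3 by apply: Rmult_lt_0_compat.
  lra.
have t0 : tail_integral / T ^ 0 <= 0.72 * X2 by rewrite pow_O Rdiv_1_r.
(* The boundary factor of [gmom_rec]; its exponent is at least [t / 6], so it is negligible against
   powers of [s]. *)
set E := exp (- (K * T ^ 2 / 2)).
have E_gt0 : 0 < E by apply: exp_pos.
have E_le : E <= exp (- (1 / 6 * t)).
  apply: exp_mono; have : 3 / s ^ 3 * T ^ 2 <= K * T ^ 2.
    by apply: Rmult_le_compat_r => //; apply: pow2_ge_0.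
  by rewrite (_ : 3 / s ^ 3 * T ^ 2 = 1 / 3 * t); [lra | field; lra].
have e10 : exp (- (1 / 6 * 60)) <= 4.6e-5.
  rewrite (_ : 1 / 6 * 60 = 64 * 0.15625); last by lra.
  have := @exp_neg64_le 0.15625 1.169 ltac:(lra) ltac:(lra) ltac:(lra); lra.
have Es2 : E <= 0.17 * s ^ 2.
  have := @pow_exp_decay 2 (1 / 6) 60 t ltac:(lra) ltac:(rewrite /=; lra) t_ge => D.
  apply: Rle_trans E_le _; rewrite (_ : exp _ = s ^ 2 * (t ^ 2 * exp (- (1 / 6 * t))));
    last by field; lra.
  by rewrite Rmult_comm; apply: Rmult_le_compat_r; lra.
have TE : T ^ 1 * E <= 0.0003 * M.
  have : s * E <= 1 / 60 * (0.17 * s ^ 2) by apply: Rmult_le_compat; lra.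
  by rewrite pow_1; lra.
have T3E : T ^ 3 * E <= 0.0053 * X1.
  have : T ^ 3 * E <= T ^ 3 * (0.17 * s ^ 2) by apply: Rmult_le_compat_l => //;
    apply/Rlt_le/pow_lt.
  have : s ^ 3 / 3.3 * (4 * s ^ 2) <= X1 by rewrite /X1 Rmult_comm;
    apply: Rmult_le_compat; lra.
  rewrite (_ : T ^ 3 * (0.17 * s ^ 2) = 0.17 / 27 * (s ^ 3 * s ^ 2)); last by field.
  have := Rmult_lt_0_compat _ _ s3 s2; move: (s ^ 3) (s ^ 2) => a b *; lra.
have g2 : 0.9997 * X1 <= gmom K T 2.
  have := gmom_rec K T 0; rewrite -/E => R2.
  have -> : gmom K T 2 = (INR 1 * M - T ^ 1 * E) * Ki by rewrite -R2 /Ki; field; lra.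
  rewrite /X1 -Rmult_assoc; apply: Rmult_le_compat_r; first lra.
  by rewrite Rmult_1_l; lra.
have g4 : 2.993 * X2 <= gmom K T 4.
  have := gmom_rec K T 2; rewrite -/E => R4.
  have -> : gmom K T 4 = (INR 3 * gmom K T 2 - T ^ 3 * E) * Ki by rewrite -R4 /Ki;
    field; lra.
  rewrite /X2 -Rmult_assoc; apply: Rmult_le_compat_r; first lra.
  by rewrite INR_IZR_INZ [Z.of_nat 3]/=; lra.
have h2_ge0 := pow2_ge_0 h.
have e0_lo : 0.9759 * M <= e0.
  have := Rmult_le_compat_l _ _ _ h2_ge0 gl6; lra.
have e1_lo : 0.3915 * X1 <= e1.
  have := Rmult_le_compat_l _ _ _ h2_ge0 gl8; rewrite !pow_1 in e1_ge; lra.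
(* About 0.748 from the Gaussian, less 0.469 for the phase and 0.18 for the tail. *)
have e2_lo : 0.099 * X2 <= e2.
  have := Rmult_le_compat_l _ _ _ h2_ge0 gl10; lra.
have O1_hi : Rabs O1 <= 4.504 * (h * X2).
  have := Rmult_le_compat_l _ _ _ (Rlt_le _ _ h_gt0) gl4;
    have := Rmult_lt_0_compat _ _ h_gt0 X2_gt0; lra.
have o1_hi : Rabs o1 <= 14.563 * (h * X3).
  have := Rmult_le_compat_l _ _ _ (Rlt_le _ _ h_gt0) gl6;
    have := Rmult_lt_0_compat _ _ h_gt0 X3_gt0; lra.
have e1_hi : e1 <= 0.64 * X1 by have := Rle_abs e1; lra.
have e2_hi : e2 <= 1.26 * X2 by have := Rle_abs e2; lra.
have Ki_small : Ki <= 1.6e-6 by lra.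
clear - Ki_gt0 Ki_small M_gt0 X1_gt0 X2_gt0 X3_gt0 h_gt0 h2Ki3 e0_lo e1_lo e2_lo O1_hi
  o1_hi e1_hi e2_hi.
set P := X1 ^ 2; have P_gt0 : 0 < P by apply: pow_lt.
have m1 : 12 * e1 ^ 2 >= 1.838 * P.
  have := pow_incr (0.3915 * X1) e1 2 ltac:(lra); rewrite Rpow_mult_distr -/P; lra.
have m2 : 4 * e0 * e2 >= 0.386 * P.
  have := Rmult_le_compat (0.9759 * M) e0 (0.099
    * X2) e2 ltac:(lra) ltac:(lra) e0_lo e2_lo.
  rewrite (_ : 0.9759 * M * (0.099 * X2) = 0.9759 * 0.099 * P);
    last by rewrite /P /X2 /X1; ring.
  lra.
have PKi : 0 < P * Ki <= 1.6e-6 * P by split;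
  [apply: Rmult_lt_0_compat | rewrite Rmult_comm; apply: Rmult_le_compat_r; lra].
have m3 : 16 * e1 * e2 <= 0.001 * P.
  have := Rmult_le_compat e1 (0.64 * X1) e2 (1.26
    * X2) ltac:(lra) ltac:(lra) e1_hi e2_hi.
  rewrite (_ : 0.64 * X1 * (1.26 * X2) = 0.64 * 1.26 * (P * Ki));
    last by rewrite /P /X2; ring.
  lra.
have hP : h ^ 2 * Ki ^ 3 * P <= 0.001785 * P by apply: Rmult_le_compat_r; lra.
have m4 : Rabs (o1 * O1) <= 0.1171 * P.
  rewrite Rabs_mult; have := Rmult_le_compat _ _ _ _ (Rabs_pos o1) (Rabs_pos O1) o1_hi
    O1_hi.
  rewrite (_ : 14.563 * (h * X3) * (4.504 * (h * X2))
    = 14.563 * 4.504 * (h ^ 2 * Ki ^ 3 * P)); last first.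
    by rewrite /P /X3 /X2; ring.
  lra.
have m5 : o1 ^ 2 <= 0.001 * P.
  rewrite -[o1 ^ 2]pow2_abs; have := pow_incr _ _ 2 (conj (Rabs_pos o1) o1_hi).
  rewrite (_ : (14.563 * (h * X3)) ^ 2 = 14.563 ^ 2 * (h ^ 2 * Ki ^ 3 * P * Ki));
    last first.
    by rewrite /P /X3 /X2; ring.
  have : h ^ 2 * Ki ^ 3 * P * Ki <= 0.001785 * P * Ki by apply: Rmult_le_compat_r; lra.
  lra.
have m4' : Rabs (o1 * O1) < 0.1172 * P by lra.
(* In units of [P] the form is at least [1.838 + 0.386 - 0.001 - 8 * 0.1172 - 4 * 0.001 > 1.28]. *)
by have := Rabs_def2 _ _ m4'; have := pow2_ge_0 e2; lra.
Qed.

End Laguerre.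

(** * From the moments back to five consecutive coefficients *)

Section Expansion.

Variables A H : R -> R.
Hypothesis A_cont : forall x, continuous A x.
Hypothesis H_cont : forall x, continuous H x.

Notation f k := (fun x => A x * (cos (H x) * (1 - cos x) ^ k)).
Notation g1 := (fun x => A x * (sin (H x) * sin x)).
Notation g2 := (fun x => A x * (sin (H x) * (sin x * (1 - cos x)))).

(* [cos (H + j x)] for [j = -2, ..., 2], expanded in powers of [1 - cos x]. *)
Lemma RInt_cos_shift (c0 c1 c2 d1 d2 : R) (h : R -> R) :
  (forall x, h x = c0 * cos (H x) + c1 * (cos (H x) * (1 - cos x))
     + c2 * (cos (H x) * (1 - cos x) ^ 2) + d1 * (sin (H x) * sin x)
     + d2 * (sin (H x) * (sin x * (1 - cos x)))) ->
  RInt (fun x => A x * h x) 0 PI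
  = c0 * RInt (f 0) 0 PI + c1 * RInt (f 1) 0 PI + c2 * RInt (f 2) 0 PI
    + d1 * RInt g1 0 PI + d2 * RInt g2 0 PI.
Proof.
move=> hE.
have fc k x : continuous (f k) x.
  by apply: cont_mul => //; apply: cont_mul; [exact: cont_cos | smooth].
have g1c x : continuous g1 x.
  by apply: cont_mul => //; apply: cont_mul; [exact: cont_sin | smooth].
have g2c x : continuous g2 x.
  by apply: cont_mul => //; apply: cont_mul; [exact: cont_sin | smooth].
have term (c : R) (F : R -> R) : (forall x, continuous F x) -> is_RInt (fun x =>
  c * F x) 0 PI (c * RInt F 0 PI).
  by move=> Fc; apply: (@is_RInt_scal R_NormedModule); apply: RInt_correct;
    apply: ex_RInt_cont.
apply: is_RInt_unique.
apply: is_RInt_ext (_ : is_RInt (fun x =>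
  c0 * f 0 x + c1 * f 1 x + c2 * f 2 x + d1 * g1 x + d2 * g2 x) 0 PI _).
  by move=> x _; rewrite hE /=; match goal with |- ?a = ?b => change (a = b :> R) end;
    ring.
by repeat apply: (@is_RInt_plus R_NormedModule); apply: term.
Qed.

End Expansion.

(** In each product of the Laguerre expression the two indices add up to [2 (n + 2)], so the weights
    [C exp (- j s)] come out as one common positive factor. *)
Theorem laguerre_count (count : nat -> nat -> R) n :
  (forall n, count 0%N n = if n == 0%N then 1 else 0) ->
  (forall k n, count k.+1 n = count k n + if (k.+2
    <= n)%N then count k.+1 (n - k.+2)%N else 0) ->
  (5941 <= n.+2)%N ->
  exists2 k, (n.+4 <= k)%N &
    0 < 3 * count k n.+2 ^ 2 - 4 * count k n.+1 * count k n.+3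
      + count k n * count k n.+4.
Proof.
(* As [s >= 1 / (2 (n + 2))], this choice gives [k s^2 >= 1], which makes the truncation at part
   [k + 1] harmless. *)
move=> count0 countS n_ge; pose k := (4 * n.+2 * n.+2)%N.
exists k.
  apply: (@leq_trans (4 * n.+2)%N); last by rewrite leq_pmulr.
  by rewrite -addn4 -[n.+2]addn2 mulnDr leq_add // leq_pmull.
have [s s_bd muE] := @cumulant0_surj k n.+2 isT n_ge.
have n_gt0 : 0 < INR n.+2 by apply: lt_0_INR; lia.
have s_gt0 : 0 < s by have := Rinv_0_lt_compat (2 * INR n.+2) ltac:(lra); lra.
have s_bd' : 0 < s <= 1 / 60 by lra.
have t_le : 1 / s <= INR k.+1 * s.
  apply/(Rle_div_l _ _ _ s_gt0).
  have kE : INR k = 4 * INR n.+2 * INR n.+2 by rewrite /k !mult_INR [INR 4]INR_IZR_INZ.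
  rewrite S_INR kE; have : 1 / 2 <= INR n.+2 * s.
    have := Rmult_le_compat_l _ _ _ (Rlt_le _ _ n_gt0) (proj1 s_bd).
    by rewrite (_ : INR n.+2 * / (2 * INR n.+2) = 1 / 2); [lra | field; lra].
  nra.
have [C C_gt0 fourierE] := fourier_count s_gt0 count0 countS k.
pose A := ampl s k; pose H th := th * cumulant s k 0 - phase s k th.
have A_cont x : continuous A x by apply: ampl_continuous.
have H_cont x : continuous H x.
  by apply: (@continuous_minus _ _ R_NormedModule); [smooth | apply: phase_continuous].
have K_bd : 3 / s ^ 3 <= cumulant s k 1 <= 3.3 / s ^ 3.
  by split; [apply: cumulant1_ge => //; lra | apply: cumulant1_le].
have A_ge0 x : 0 <= A x by apply/Rlt_le/ampl_gt0.
have A_ge x : 0 <= x -> exp (- (cumulant s k 1 * x ^ 2 / 2)) <= A x by apply: ampl_ge.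
have A_le x : 0 <= x ->
  A x <= exp (- (cumulant s k 1 * x ^ 2 / 2) + 43.725 / s ^ 5 * x ^ 4 / 24).
  move=> x_ge0; apply: Rle_trans (ampl_le_core s_gt0 k x_ge0) _; apply: exp_mono.
  have := Rmult_le_compat_r _ _ _ (pow_le x 4 x_ge0) (cumulant3_le k s_gt0); lra.
have H_bd x : 0 <= x -> 0 <= H x <= 10.2 / s ^ 4 * x ^ 3 / 6.
  move=> x_ge0; have := phase_defect s_gt0 k x_ge0.
  have := Rmult_le_compat_r _ _ _ (pow_le x 3 x_ge0) (cumulant2_le k s_gt0).
  by rewrite /H; lra.
have A_far x y0 : 0 <= y0 <= 1.994 / s ^ 2 * (1 - cos x) ->
    A x <= exp (- (y0 / (1 + y0) / s) + (1 - cos x) + 0.001).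
  move=> y0_bd; apply: ampl_far => //; split; first lra.
  have := polylog1_ge s_gt0 ltac:(lra) => P_ge.
  have := Rmult_le_compat_r (1 - cos x) (2 * (0.997 / s ^ 2)) (2
    * polylog 1 (exp (- s)))
    ltac:(have := COS_bound x; lra) ltac:(lra).
  by rewrite (_ : 2 * (0.997 / s ^ 2) = 1.994 / s ^ 2); [lra | rewrite /Rdiv; lra].
pose e k := RInt (fun x => A x * (cos (H x) * (1 - cos x) ^ k)) 0 PI.
pose O1 := RInt (fun x => A x * (sin (H x) * sin x)) 0 PI.
pose o1 := RInt (fun x => A x * (sin (H x) * (sin x * (1 - cos x)))) 0 PI.
have main := @laguerre_pos _ _ _ _ s_bd' K_bd A_cont H_cont A_ge0 A_ge A_le H_bd A_far
  (e 0%N) (e 1%N) (e 2%N) O1 o1 erefl erefl erefl erefl erefl.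
have shift := RInt_cos_shift A_cont H_cont.
have fourierI j : fourier s k (Z.of_nat (n + j)) = RInt (fun x =>
  A x * cos (H x + (INR j - 2) * x)) 0 PI.
  apply: RInt_ext => x _; rewrite /wave /A /H muE -INR_IZR_INZ plus_INR !S_INR.
  by rewrite -[X in _ * X = _]cos_neg; congr (_ * cos _); ring.
have I2 : fourier s k (Z.of_nat n.+2) = e 0%N.
  rewrite -addn2 fourierI (shift 1 0 0 0 0); first by rewrite -/(e 0%N); lra.
  by move=> x; rewrite [INR 2]/= (_ : (1 + 1 - 2) * x = 0) ?Rplus_0_r; lra.
have I1 : fourier s k (Z.of_nat n.+1) = e 0%N - e 1%N + O1.
  rewrite -addn1 fourierI (shift 1 (-1) 0 1 0);
    first by rewrite -/(e 0%N) -/(e 1%N) -/O1; lra.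
  by move=> x; rewrite [INR 1]/= (_ : (1 - 2) * x = - x) ?cos_plus ?cos_neg ?sin_neg;
    lra.
have I3 : fourier s k (Z.of_nat n.+3) = e 0%N - e 1%N - O1.
  rewrite -addn3 fourierI (shift 1 (-1) 0 (-1) 0);
    first by rewrite -/(e 0%N) -/(e 1%N) -/O1; lra.
  by move=> x; rewrite [INR 3]/= (_ : (1 + 1 + 1 - 2) * x = x) ?cos_plus; lra.
have I0 : fourier s k (Z.of_nat n) = e 0%N - 4 * e 1%N + 2 * e 2%N + (2 * O1 - 2 * o1).
  rewrite -[n in LHS]addn0 fourierI (shift 1 (-4) 2 2 (-2)).
    by rewrite -/(e 0%N) -/(e 1%N) -/(e 2%N) -/O1 -/o1; lra.
  move=> x; rewrite [INR 0]/= (_ : (0 - 2) * x = - (2 * x)); last by ring.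
  by rewrite cos_plus cos_neg sin_neg cos_2a_cos sin_2a; ring.
have I4 : fourier s k (Z.of_nat n.+4)
  = e 0%N - 4 * e 1%N + 2 * e 2%N - (2 * O1 - 2 * o1).
  rewrite -addn4 fourierI (shift 1 (-4) 2 (-2) 2).
    by rewrite -/(e 0%N) -/(e 1%N) -/(e 2%N) -/O1 -/o1; lra.
  move=> x; rewrite [INR 4]/= (_ : (1 + 1 + 1 + 1 - 2) * x = 2 * x); last by ring.
  by rewrite cos_plus cos_2a_cos sin_2a; ring.
have {main} : 0 < 3 * fourier s k (Z.of_nat n.+2) ^ 2
    - 4 * fourier s k (Z.of_nat n.+1) * fourier s k (Z.of_nat n.+3)
    + fourier s k (Z.of_nat n) * fourier s k (Z.of_nat n.+4).
  (* The terms in [(e 0)^2], [e 0 * e 1] and [O1^2] cancel. *)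
  by rewrite I0 I1 I2 I3 I4; lra.
rewrite !fourierE.
have expS m : exp (- (INR m.+1 * s)) = exp (- (INR m * s)) * exp (- s).
  by rewrite -exp_plus; congr exp; rewrite S_INR; ring.
rewrite !expS; move: (exp (- (INR n * s))) (exp_pos (- (INR n
  * s))) (exp (- s)) (exp_pos (- s)) => E E_gt0 q q_gt0.
move: (count k n) (count k n.+1) (count k n.+2) (count k n.+3) (count k n.+4) =>
  a0 a1 a2 a3 a4.
rewrite (_ : _ - _ + _ = (C * E * q ^ 2) ^ 2 * (3 * a2 ^ 2 - 4 * a1 * a3 + a0 * a4));
  last by ring.
have D_gt0 : 0 < (C * E * q ^ 2) ^ 2.
  by apply/pow_lt/Rmult_lt_0_compat; [apply: Rmult_lt_0_compat | apply: pow_lt].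
by move=> lt0; apply: (Rmult_lt_reg_l _ _ _ D_gt0); rewrite Rmult_0_r.
Qed.

End Analysis.

(** * Counting partitions *)

From mathcomp Require Import ring ssrZ zify.
Import Order.TTheory GRing.Theory Num.Theory.
Local Open Scope nat_scope.

(* The lists of parts at most [M] summing to [n], for fuel [f > M + n]. *)
Fixpoint part_seqs (f M n : nat) : seq (seq nat) :=
  if f is f'.+1 then
    if M is M'.+1 then
      part_seqs f' M' n ++
      (if M <= n then map (cons M) (part_seqs f' M (n - M)) else [::])
    else if n == 0 then [:: [::]] else [::]
  else [::].

Lemma part_seqsS f M n : part_seqs f.+1 M.+1 n = part_seqs f M n ++
  (if M < n then map (cons M.+1) (part_seqs f M.+1 (n - M.+1)) else [::]).
Proof. by []. Qed.

Lemma part_seqs_fuel f g M n : M + n < f -> M + n < g ->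
  part_seqs f M n = part_seqs g M n.
Proof.
elim: f g M n => [|f IHf] [|g] // [|M] n //=; rewrite !ltnS => lt_f lt_g.
congr (_ ++ _); first by apply: IHf; rewrite -addSn.
have lt_n h : M.+1 + n <= h -> n < h by move=> le_h; apply: leq_trans le_h;
  rewrite addSn ltnS leq_addl.
by case: leqP => // le_Mn; rewrite (IHf g) // subnKC // lt_n.
Qed.

Lemma mem_part_seqs f M n s : M + n < f ->
  (s \in part_seqs f M n) = is_partition n s && all (leq^~ M) s.
Proof.
have geq_trans : transitive geq by move=> y x z; rewrite /geq /= => yx zy;
  apply: leq_trans zy yx.
elim: f M n s => [|f IHf] // [|M] n s /=; rewrite ltnS => lt_f.
  case: s => [|x s]; first by rewrite /is_partition /= andbT eq_sym; case: eqP.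
  by rewrite /is_partition /= [x <= 0]leqNgt; case: (0 < x); rewrite ?andbF //=;
    case: (n == 0).
have lt_n : n < f by apply: leq_trans lt_f; rewrite addSn ltnS leq_addl.
rewrite mem_cat IHf; last by rewrite -addSn.
case: s => [|x s].
  rewrite /= !andbT; case: (is_partition n [::]) => //=.
  by case: leqP => // _; apply/negbTE/negP => /mapP[].
have partE m : is_partition m (x :: s) =
    [&& all (geq x) s, 0 < x, x <= m & is_partition (m - x) s].
  rewrite /is_partition /= path_sortedE // -!andbA; congr (_ && _).
  case: (0 < x); rewrite ?andbF //=; case: leqP => [le_xm|lt_mx] /=.
    by rewrite -[in LHS](subnKC le_xm) eqn_add2l.
  by rewrite (gtn_eqF (leq_trans lt_mx (leq_addr _ _))) ?andbF.
rewrite /= partE; case: (ltngtP x M.+1) => [lt_xM|lt_Mx|->] /=.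
- have le_xM : x <= M by rewrite -ltnS.
  rewrite le_xM /=.
  have -> : (x :: s \in (if M < n then [seq M.+1 :: i | i <- part_seqs f M.+1 (n -
    M.+1)] else [::])) = false.
    by case: leqP => // _; apply/negP => /mapP[y _ [xE _]]; rewrite xE ltnn in lt_xM.
  rewrite orbF; case: (boolP (all (geq x) s)) => //= /allP le_s.
  have [-> ->] // : all (leq^~ M) s = true /\ all (leq^~ M.+1) s = true.
  split; apply/allP => y /le_s /= le_yx; first by rewrite (leq_trans le_yx).
  exact: leq_trans le_yx (ltnW lt_xM).
- have -> : (x <= M) = false by rewrite leqNgt (ltn_trans _ lt_Mx).
  rewrite !andbF /=; apply/negbTE; move: lt_Mx.
  by case: (leqP M.+1 n) => // _ lt_Mx; apply/negP => /mapP [y _ [xE _]];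
    rewrite xE ltnn in lt_Mx.
rewrite ltnn andbF /=; case: leqP => [_|lt_Mn]; rewrite ?andbF //=.
rewrite mem_map; last by move=> u v [].
rewrite IHf ?subnKC //.
have -> : all (geq M.+1) s = all (leq^~ M.+1) s by apply: eq_all.
by case: (all _ s); rewrite /= ?andbF ?andbT.
Qed.

Lemma part_seqs_uniq f M n : M + n < f -> uniq (part_seqs f M n).
Proof.
elim: f M n => [|f IHf] // [|M] n /=; rewrite ltnS => lt_f.
  by case: (n == 0).
have lt_n : n < f by apply: leq_trans lt_f; rewrite addSn ltnS leq_addl.
have lt_f' : M + n < f by rewrite -addSn.
rewrite cat_uniq IHf //=; case: leqP => //= le_Mn; rewrite map_inj_uniq;
  last by move=> u v [].
rewrite IHf ?subnKC // andbT; apply/hasPn => s /mapP [y _ ->].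
by rewrite mem_part_seqs // /= ltnn /= andbF.
Qed.

Definition restricted_parts (M n : nat) : nat := size (part_seqs (M + n).+1 M n).

Lemma restricted_parts0 n : restricted_parts 0 n = (n == 0).
Proof. by rewrite /restricted_parts /=; case: (n == 0). Qed.

Lemma restricted_partsS M n : restricted_parts M.+1 n
  = restricted_parts M n + (if M < n then restricted_parts M.+1 (n - M.+1) else 0).
Proof.
rewrite /restricted_parts part_seqsS size_cat (@part_seqs_fuel _ (M + n).+1) ?addSn //.
congr addn; case: leqP => // lt_Mn; rewrite size_map.
by rewrite (@part_seqs_fuel _ (M.+1 + (n - M.+1)).+1) // subnKC // ltnS leq_addl.
Qed.

Lemma restricted_parts_stable M n : n <= M ->
  restricted_parts M n = restricted_parts n n.
Proof.
elim: M => [|M IHM]; first by rewrite leqn0 => /eqP ->.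
rewrite leq_eqVlt => /predU1P [-> //|lt_nM].
by rewrite restricted_partsS ltnNge -ltnS lt_nM addn0 IHM.
Qed.

Lemma npartE n : npart n = restricted_parts n n.
Proof.
rewrite /npart cardE /restricted_parts -(size_map (fun b : {bseq n of 'I_n.+1} =>
  map val b)).
apply/perm_size/uniq_perm.
- by rewrite map_inj_uniq ?enum_uniq //; apply: partition_seq_inj.
- by apply: part_seqs_uniq.
move=> s; rewrite mem_part_seqs //; apply/mapP/andP => [[b]|[part_s _]].
  rewrite mem_enum => b_in ->; have part_b : is_partition n (map val b).
    by apply/is_partitionP; exists b.
  by split=> //; apply/allP => x /mapP [i _ ->]; exact: (ltn_ord i).
by case/is_partitionP: part_s => b b_in bE; exists b; rewrite ?mem_enum.
Qed.

Local Open Scope ring_scope.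

(** * The pentagonal number recurrence from Shanks' identity *)

Section PolyCong.

Variable R : comNzRingType.
Implicit Types p q r : {poly R}.

(** Congruence modulo ['X^n]; it replaces infinite products and power series. *)
Definition coef_eq (n : nat) p q := forall i, (i < n)%N -> p`_i = q`_i.

Lemma coef_eqM n p q r : coef_eq n p q -> coef_eq n (r * p) (r * q).
Proof.
move=> pq i lt_in; rewrite !coefM; apply: eq_bigr => j _; rewrite pq //.
exact: leq_ltn_trans (leq_subr _ _) lt_in.
Qed.

Lemma coef_eq_trans n q p r : coef_eq n p q -> coef_eq n q r -> coef_eq n p r.
Proof. by move=> pq qr i lt_in; rewrite pq ?qr. Qed.

Lemma sum_natS (V : nmodType) (F : nat -> V) n :
  \sum_(0 <= k < n.+1) F k = \sum_(0 <= k < n) F k + F n.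
Proof. by rewrite big_nat_recr. Qed.

Lemma sum_natD (V : nmodType) (F G : nat -> V) n :
  \sum_(0 <= k < n) (F k + G k) = \sum_(0 <= k < n) F k + \sum_(0 <= k < n) G k.
Proof. by rewrite big_split. Qed.

Definition euler_prod (m n : nat) : {poly R} := \prod_(m <= i < n) (1 - 'X^(i.+1)).

Lemma euler_prodS m n : (m <= n)%N ->
  euler_prod m n.+1 = euler_prod m n * (1 - 'X^(n.+1)).
Proof. by move=> le_mn; rewrite /euler_prod big_nat_recr. Qed.

(* The generalised pentagonal numbers k (3 k - 1) / 2 and k (3 k + 1) / 2. *)
Definition pent1 (k : nat) : nat := (k * k + 'C(k, 2))%N.
Definition pent2 (k : nat) : nat := (k * k + 'C(k.+1, 2))%N.

Definition pent_poly (n : nat) : {poly R} :=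
  1 + \sum_(0 <= k < n) (-1) ^+ k.+1 * ('X^(pent1 k.+1) + 'X^(pent2 k.+1)).

Definition shanks_sum (n : nat) : {poly R} :=
  \sum_(0 <= k < n.+1) (-1) ^+ k * (euler_prod k n * 'X^(k * n + 'C(k.+1, 2))).

Lemma shanks_step n j : (j <= n)%N ->
  \sum_(0 <= k < j.+1) (-1) ^+ k * (euler_prod k n *
     ('X^(k * n.+1 + 'C(k.+1, 2)) * (1 - 'X^(n.+1)) - 'X^(k * n + 'C(k.+1, 2))))
  = - ((-1) ^+ j * (euler_prod j n * 'X^(j.+1 * n.+1 + 'C(j.+1, 2)))) :> {poly R}.
Proof.
elim: j => [|j IHj] lt_jn.
  by rewrite big_nat1 !mul0n mul1n addn0 bin_small // addn0 !expr0; ring.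
rewrite sum_natS IHj; last exact: ltnW.
have -> : euler_prod j n = (1 - 'X^(j.+1)) * euler_prod j.+1 n.
  by rewrite /euler_prod big_ltn.
have -> : 'C(j.+2, 2) = ('C(j.+1, 2) + j.+1)%N by rewrite binS bin1.
have -> : (j.+2 * n.+1 = j.+1 * n + j.+1 + n.+1)%N by rewrite mulSn mulnS; lia.
have -> : (j.+1 * n.+1 = j.+1 * n + j.+1)%N by rewrite mulnS addnC.
move: (j.+1 * n)%N ('C(j.+1, 2)) (euler_prod j.+1 n) => a b e.
by rewrite !exprD [(-1) ^+ j.+1]exprS; ring.
Qed.

(** Passing from [n] to [n + 1] changes the old terms by the telescoping sum of [shanks_step], whose
    boundary term is the power [pent1 n.+1]; the new last term is the power [pent2 n.+1]. *)
Lemma shanks n : shanks_sum n = pent_poly n.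
Proof.
elim: n => [|n IHn].
  rewrite /shanks_sum big_nat1 /euler_prod big_geq // mul0n bin_small //.
  by rewrite /pent_poly big_geq // !expr0; ring.
rewrite /pent_poly sum_natS addrA -/(pent_poly n) -IHn.
rewrite /shanks_sum sum_natS.
have -> : \sum_(0 <= k < n.+1) (-1) ^+ k * (euler_prod k n.+1 * 'X^(k * n.+1 + 'C(k.+1,
  2)))
  = \sum_(0 <= k < n.+1) (-1) ^+ k * (euler_prod k n * 'X^(k * n + 'C(k.+1, 2)))
   + \sum_(0 <= k < n.+1) (-1) ^+ k * (euler_prod k n *
     ('X^(k * n.+1 + 'C(k.+1, 2)) * (1 - 'X^(n.+1)) - 'X^(k * n + 'C(k.+1,
       2)))) :> {poly R}.
  rewrite -sum_natD; apply: eq_big_nat => k lt_kn.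
  rewrite euler_prodS ?(ltnS k n) //.
  by ring.
have prod_nil k : euler_prod k k = 1 by rewrite /euler_prod big_geq.
by rewrite shanks_step // !prod_nil [(-1) ^+ n.+1]exprS /pent1 /pent2; ring.
Qed.

(** The term [k = 0] of Shanks' sum is the Euler product itself, and every other term is divisible
    by ['X^(n.+1)]. *)
Lemma coef_eq_euler_pent n : coef_eq n.+1 (euler_prod 0 n) (pent_poly n).
Proof.
move=> i le_in; rewrite -shanks /shanks_sum big_nat_recl // coefD expr0 mul1r.
rewrite mul0n bin_small // expr0 mulr1 coef_sum big1_seq ?addr0 // => k _.
rewrite mulrA coefMXn ifT // (leq_trans le_in) //.
by rewrite binS bin1; nia.
Qed.

Definition parts_poly (L M : nat) : {poly R} :=
  \poly_(i < L) (restricted_parts M i)%:R.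

(** Multiplication by [1 - 'X^(M.+1)] removes the part [M + 1]: this is [restricted_partsS] read on
    generating functions. *)
Lemma coef_eq_parts_poly L M : coef_eq L (euler_prod 0 M * parts_poly L M) 1.
Proof.
elim: M => [|M IHM].
  move=> i lt_iL; rewrite /euler_prod big_geq // mul1r coef_poly lt_iL coef1.
  by rewrite restricted_parts0.
rewrite euler_prodS // -mulrA; apply: coef_eq_trans IHM; apply: coef_eqM => i lt_iL.
rewrite mulrBl mul1r coefB coefXnM !coef_poly lt_iL (leq_ltn_trans (leq_subr _ _)) //.
rewrite restricted_partsS natrD ltnS; case: leqP => _; first by rewrite subr0 addr0.
by rewrite addrK.
Qed.

(* [npart (n - g)], extended by [0] for [g > n]. *)
Definition npart_sub (n g : nat) : R := if (n < g)%N then 0 else (npart (n - g))%:R.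

Lemma npart_pentagonal n : (npart n.+1)%:R =
  \sum_(0 <= k < n.+1) (-1) ^+ k * (npart_sub n.+1 (pent1 k.+1)
    + npart_sub n.+1 (pent2 k.+1)).
Proof.
have := @coef_eq_parts_poly n.+2 n.+1 n.+1 (ltnSn _).
rewrite mulrC (coef_eqM _ (@coef_eq_euler_pent n.+1)) // coef1 mulrDr mulr1 coefD.
rewrite coef_poly ltnSn -npartE mulr_sumr coef_sum => /eqP.
rewrite addr_eq0 => /eqP ->; rewrite -sumrN; apply: eq_bigr => k _.
have coefX g : (parts_poly n.+2 n.+1 * 'X^g)`_n.+1 = npart_sub n.+1 g.
  rewrite coefMXn /npart_sub; case: leqP => // le_gn.
  rewrite coef_poly ltnS leq_subr npartE restricted_parts_stable ?leq_subr //.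
rewrite mulrCA exprS mulN1r mulNr coefN opprK -[in LHS]signr_odd -[in RHS]signr_odd.
rewrite -!coefX -coefD -mulrDr.
by case: odd; rewrite ?expr1 ?expr0 ?mul1r ?mulN1r ?coefN.
Qed.

End PolyCong.

(** * Table of partition numbers and the finite check *)

Fixpoint pent_walk (f k : nat) (l : seq Z) : Z * Z :=
  if f is f'.+1 then
    if l is x :: _ then
      let l' := drop k l in
      let: (u, v) := pent_walk f' k.+1 (drop k.*2.+1 l') in
      (Z.add (Z.add x (head Z0 l')) v, u)
    else (Z0, Z0)
  else (Z0, Z0).

(** [pent_walk] advances by the gaps [k] and [2 k + 1] between generalised pentagonal numbers. It
    swaps its two accumulators at each level, so they collect the terms of either sign; reading past
    the end gives 0, the value at negative arguments. *)
Definition npart_next (l : seq Z) : Z :=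
  let: (u, v) := pent_walk (size l) 1 l in Z.sub u v.

(* [npart n], ..., [npart 0], most recent first; see [npart_tableE]. *)
Fixpoint npart_table (n : nat) : seq Z :=
  if n is n'.+1 then let l := npart_table n' in npart_next l :: l else [:: Zpos 1].

Lemma pent_walkP f k l : (0 < k)%N ->
  let: (u, v) := pent_walk f k (drop (pent1 k).-1 l) in
  u - v = \sum_(0 <= j < f) (-1) ^+ j *
    (nth 0 l (pent1 (k + j)).-1 + nth 0 l (pent2 (k + j)).-1) :> Z.
Proof.
elim: f k => [|f IHf] k k_gt0 /=; first by rewrite big_geq.
have p12 m : pent2 m = (pent1 m + m)%N by rewrite /pent1 /pent2 binS bin1 addnA.
have p21 m : pent1 m.+1 = (pent2 m + m.*2.+1)%N by rewrite /pent1 /pent2; lia.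
have p1_gt0 m : (0 < m)%N -> (0 < pent1 m)%N by rewrite /pent1; nia.
have p1_mono j : (pent1 k <= pent1 (k + j))%N.
  elim: j => [|j IHj]; first by rewrite addn0.
  by apply: leq_trans IHj _; rewrite addnS p21 p12 -addnA leq_addr.
have [le_lp|lt_pl] := leqP (size l) (pent1 k).-1.
  rewrite drop_oversize // subr0 big1_seq // => j _.
  have le1 : (size l <= (pent1 (k + j)).-1)%N.
    by apply: leq_trans le_lp _; rewrite -!subn1 leq_sub2r.
  have le2 : (size l <= (pent2 (k + j)).-1)%N.
    by apply: leq_trans le1 _; rewrite p12 -!subn1 leq_sub2r ?leq_addr.
  by rewrite !nth_default ?addr0 ?mulr0.
rewrite (drop_nth 0 lt_pl) -(drop_nth 0 lt_pl) !drop_drop.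
have -> : (k.*2.+1 + k + (pent1 k).-1 = (pent1 k.+1).-1)%N.
  by rewrite p21 p12; have := p1_gt0 k k_gt0; lia.
have := IHf k.+1 isT; case: pent_walk => u v uvE.
rewrite big_nat_recl // expr0 mul1r addn0.
have -> : head Z0 (drop (k + (pent1 k).-1) l) = nth 0 l (pent2 k).-1.
  by rewrite -nth0 nth_drop addn0 p12; congr (nth _ _ _); have := p1_gt0 k k_gt0; lia.
rewrite -[Z.add]/(+%R : Z -> Z -> Z).
have -> : \sum_(0 <= j < f) (-1) ^+ j.+1 *
    (l`_(pent1 (k + j.+1)).-1 + l`_(pent2 (k + j.+1)).-1) = - (u - v) :> Z.
  rewrite uvE -sumrN; apply: eq_bigr => j _.
  by rewrite exprS mulN1r mulNr addSnnS.
by rewrite opprB [v - u]addrC -addrA [- u + v]addrC addrA.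
Qed.

Lemma npart_tableE n : npart_table n = [seq (npart (n - i))%:R | i <- iota 0 n.+1].
Proof.
elim: n => [|n IHn]; first by rewrite /= npartE.
rewrite [npart_table _]/= IHn; set l := map _ _.
have size_l : size l = n.+1 by rewrite size_map size_iota.
have -> : iota 0 n.+2 = 0%N :: map succn (iota 0 n.+1) by rewrite /= -(iotaDl 1 1).
rewrite map_cons -map_comp subn0; congr (_ :: _).
have nth_l g : (0 < g)%N -> nth 0 l g.-1 = npart_sub Z n.+1 g.
  case: g => // g _; rewrite /npart_sub /= ltnS; case: leqP => [le_gn|lt_ng].
    by rewrite (nth_map 0%N) ?size_iota // nth_iota // add0n subSS.
  by rewrite nth_default // size_l.
have := @pent_walkP (size l) 1 l isT; rewrite [drop _ _]drop0 /npart_next.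
case: pent_walk => u v; rewrite -[Z.sub u v]/(u - v) => ->.
rewrite npart_pentagonal size_l; apply: eq_bigr => k _.
by rewrite !add1n !nth_l // /pent1 /pent2 addn_gt0 muln_gt0.
Qed.

(* Only the leading 50 bits of each difference are used. *)
Definition laguerre_test (x5 x4 x3 x2 x1 x0 : Z) : bool :=
  let sh := Z.max 0 (Z.sub (Z.log2 x5) 50) in
  let l0 := Z.shiftr (Z.sub x1 x0) sh in
  let l1 := Z.shiftr (Z.sub x2 x1) sh in
  let l2 := Z.shiftr (Z.sub x3 x2) sh in
  let l3 := Z.shiftr (Z.sub x4 x3) sh in
  let l4 := Z.shiftr (Z.sub x5 x4) sh in
  [&& Z.leb 0 l0, Z.leb 0 l1, Z.leb 0 l2, Z.leb 0 l3, Z.leb 0 l4 &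
   Z.ltb (Z.mul 4 (Z.mul (Z.add l1 1) (Z.add l3 1)))
     (Z.add (Z.mul 3 (Z.mul l2 l2)) (Z.mul l0 l4))].

Fixpoint laguerre_tests (c : nat) (l : seq Z) : bool :=
  if c is c'.+1 then
    if l is x5 :: ((x4 :: x3 :: x2 :: x1 :: x0 :: _) as l')
    then laguerre_test x5 x4 x3 x2 x1 x0 && laguerre_tests c' l' else false
  else true.

(** Each difference [d] with truncation [l] satisfies [P l <= d <= P (l + 1)] for [P = 2^sh]. The
    lower ends are used in the positive products and the upper ends in the negative one; a factor
    [P^2] is common. The sign tests make the products monotone. *)
Lemma laguerre_testP (x5 x4 x3 x2 x1 x0 : Z) : laguerre_test x5 x4 x3 x2 x1 x0 ->
  Z.lt 0 (Z.add (Z.sub (Z.mul 3 (Z.mul (Z.sub x3 x2) (Z.sub x3 x2)))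
      (Z.mul 4 (Z.mul (Z.sub x2 x1) (Z.sub x4 x3))))
    (Z.mul (Z.sub x1 x0) (Z.sub x5 x4))).
Proof.
rewrite /laguerre_test; set sh := Z.max _ _.
have sh_ge0 : Z.le 0 sh by apply: Z.le_max_l.
have pow_gt0 := Z.pow_pos_nonneg 2 sh ltac:(lia) sh_ge0.
rewrite !Z.shiftr_div_pow2 //; move: (Z.pow 2 sh) pow_gt0 => P P_gt0.
have bounds d : Z.le (Z.mul P (Z.div d P)) d /\ Z.le d (Z.mul P (Z.add (Z.div d P) 1)).
  by have := Z.div_mod d P; have := Z.mod_pos_bound d P P_gt0; lia.
move: (Z.sub x1 x0) (Z.sub x2 x1) (Z.sub x3 x2) (Z.sub x4 x3) (Z.sub x5 x4) =>
  d0 d1 d2 d3 d4.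
move: (bounds d0) (bounds d1) (bounds d2) (bounds d3) (bounds d4).
move: (Z.div d0 P) (Z.div d1 P) (Z.div d2 P) (Z.div d3 P) (Z.div d4 P) =>
  l0 l1 l2 l3 l4.
move=> [lo0 _] [lo1 hi1] [lo2 _] [lo3 hi3] [lo4 _] /and5P [/Z.leb_le h0 /Z.leb_le h1
  /Z.leb_le h2 /Z.leb_le h3].
move=> /andP [/Z.leb_le h4 /Z.ltb_lt main].
have mono a b c d : Z.le 0 a -> Z.le 0 c -> Z.le a b -> Z.le c d ->
  Z.le (Z.mul a c) (Z.mul b d).
  by move=> *; apply: Z.mul_le_mono_nonneg.
have pos l : Z.le 0 l -> Z.le 0 (Z.mul P l) by move=> ?; apply: Z.mul_nonneg_nonneg;
  lia.
have sq2 := mono _ _ _ _ (pos _ h2) (pos _ h2) lo2 lo2.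
have sq04 := mono _ _ _ _ (pos _ h0) (pos _ h4) lo0 lo4.
have d1_ge0 : Z.le 0 d1 by have := pos _ h1; lia.
have d3_ge0 : Z.le 0 d3 by have := pos _ h3; lia.
have sq13 := mono _ _ _ _ d1_ge0 d3_ge0 hi1 hi3.
have PP_gt0 : Z.lt 0 (Z.mul P P) by apply: Z.mul_pos_pos.
have := proj1 (Z.mul_lt_mono_pos_l _ _ _ PP_gt0) main.
by lia.
Qed.

Lemma laguerre_testsP c l i : laguerre_tests c l -> (i < c)%N ->
  laguerre_test l`_i l`_(i + 1) l`_(i + 2) l`_(i + 3) l`_(i + 4) l`_(i + 5).
Proof.
elim: c l i => // c IHc [|x5 [|x4 [|x3 [|x2 [|x1 [|x0 l]]]]]] // i /andP [t0 ts].
by case: i => [|i] // lt_ic; apply: (IHc (x4 :: x3 :: x2 :: x1 :: x0 :: l)).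
Qed.

(** * Transfer of both ranges to [fdiff npart] *)

Lemma natr_Z n : n%:R = Z.of_nat n.
Proof. by elim: n => // n IHn; rewrite mulrS IHn Nat2Z.inj_succ -Z.add_1_l. Qed.

Lemma laguerre_npart_le c N n : laguerre_tests c (npart_table N) ->
  (n + 5 <= N < n + 5 + c)%N ->
  0 < 3 * fdiff npart (n + 2) ^+ 2
      - 4 * fdiff npart (n + 1) * fdiff npart (n + 3)
      + fdiff npart n * fdiff npart (n + 4).
Proof.
move=> tests /andP [le_N lt_N].
have lt_ic : (N - (n + 5) < c)%N by rewrite ltn_subLR.
have nthE j : (j <= 5)%N ->
  (npart_table N)`_(N - (n + 5) + j) = Z.of_nat (npart (n + 5 - j)).
  move=> le_j5; rewrite npart_tableE (nth_map 0%N) ?size_iota; last by lia.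
  by rewrite nth_iota ?natr_Z; [congr (Z.of_nat (npart _)); lia | lia].
have := laguerre_testP (laguerre_testsP tests lt_ic).
have := nthE 0%N isT; rewrite addn0 => ->.
rewrite !nthE // subn0 /fdiff.
have -> : (n + 5 - 1 = n + 4)%N by lia.
have -> : (n + 5 - 2 = n + 3)%N by lia.
have -> : (n + 5 - 3 = n + 2)%N by lia.
have -> : (n + 5 - 4 = n + 1)%N by lia.
have -> : (n + 5 - 5 = n)%N by lia.
rewrite !expr2 -!addnS -[n.+1]addn1.
by lia.
Qed.

(** The 5637 windows of six consecutive values, going down from index 5942, are those starting at
    [n = 301, ..., 5937]. *)
Lemma npart_table_tests : laguerre_tests 5637 (npart_table 5942).
Proof. by vm_compute. Qed.

(* The number of partitions of [n] into parts [2, ..., k + 1]: those into parts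
   at most [k + 1], minus those with a part 1. *)
Definition no_one_count (k n : nat) : R :=
  Rminus (INR (restricted_parts k.+1 n)) (if n is n'.+1 then INR (restricted_parts k.+1
    n') else R0).

Lemma no_one_count0 n : no_one_count 0 n = if n == 0%N then R1 else R0.
Proof.
have part1 m : restricted_parts 1 m = 1%N.
  elim: m => [|m IHm]; rewrite restricted_partsS restricted_parts0 //=.
  by rewrite subn1 IHm.
by case: n => [|n]; rewrite /no_one_count !part1;
  [exact: Rminus_0_r | exact: Rminus_diag].
Qed.

Lemma no_one_countS k n : no_one_count k.+1 n
  = Rplus (no_one_count k n) (if (k.+2
    <= n)%N then no_one_count k.+1 (n - k.+2)%N else R0).
Proof.
rewrite /no_one_count; case: n => [|n].
  by rewrite restricted_partsS plus_INR /=; lra.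
rewrite (restricted_partsS k.+1 n.+1) (restricted_partsS k.+1 n) ltnS subSS !plus_INR.
case: (ltngtP k.+1 n) => [lt_kn|lt_nk|<-]; rewrite ?subnn.
- have -> : (n - k.+1 = (n - k.+2).+1)%N by lia.
  by lra.
- by rewrite /=; lra.
by rewrite /=; lra.
Qed.

Lemma laguerre_npart_ge m n : (forall n, (m <= n.+2)%N -> exists2 k, (n.+4 <= k)%N &
    Rlt R0 (Rplus (Rminus (Rmult (IZR 3) (pow (no_one_count k n.+2) 2))
      (Rmult (Rmult (IZR 4) (no_one_count k n.+1)) (no_one_count k n.+3)))
      (Rmult (no_one_count k n) (no_one_count k n.+4)))) ->
  (m <= n.+3)%N ->
  0 < 3 * fdiff npart (n + 2) ^+ 2
      - 4 * fdiff npart (n + 1) * fdiff npart (n + 3)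
      + fdiff npart n * fdiff npart (n + 4).
Proof.
(* [fdiff npart n] counts the partitions of [n + 1] without part 1, so the hypothesis is taken at
   [n.+1]. *)
move=> H /H [k le_k].
have countE j : (j <= 4)%N -> no_one_count k (n + j).+1
    = IZR (Z.sub (Z.of_nat (npart (n + j).+1)) (Z.of_nat (npart (n + j)))).
  move=> le_j; rewrite minus_IZR -!INR_IZR_INZ /no_one_count !npartE.
  have le1 : ((n + j).+1 <= k.+1)%N.
    by rewrite ltnS; apply: (@leq_trans (n + 4));
      [rewrite leq_add2l | rewrite addn4 ltnW].
  by rewrite !(restricted_parts_stable le1) (restricted_parts_stable (ltnW le1)).
have := countE 0%N isT; rewrite addn0 => ->.
have := countE 1%N isT; rewrite addn1 => ->.
have := countE 2 isT; rewrite addn2 => ->.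
have := countE 3 isT; rewrite addn3 => ->.
have := countE 4 isT; rewrite addn4 => ->.
rewrite /fdiff.
move: (npart n) (npart n.+1) (npart n.+2) (npart n.+3) (npart n.+4) (npart n.+4.+1).
move=> p0 p1 p2 p3 p4 p5.
rewrite pow_IZR -!mult_IZR -minus_IZR -plus_IZR => R_lt; have := lt_IZR Z0 _ R_lt.
rewrite expr2; lia.
Qed.

Theorem theorem3p1 (n : nat) (hn : (301 <= n)%N) :
  0 < 3 * fdiff npart (n + 2) ^+ 2
      - 4 * fdiff npart (n + 1) * fdiff npart (n + 3)
      + fdiff npart n * fdiff npart (n + 4).
Proof.
(* The two ranges meet without a gap: [n + 5 <= 5942] is computed, and otherwise [n + 3 >= 5941].
   The difference 305 places the lower end of the computation at [n = 301]. *)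
have E1 : (5942 = 5637 + 305)%N by vm_compute.
have E2 : (5942 = 5941.+1)%N by vm_compute.
move: E1 E2 npart_table_tests (fun n => @laguerre_npart_ge _ n (fun m =>
  @laguerre_count _ m no_one_count0 no_one_countS)).
move: 5942%N 5637%N 5941%N => N c m E1 E2 tests large.
have [le_nN|lt_Nn] := leqP (n + 5) N.
  by apply: (laguerre_npart_le tests); rewrite le_nN; lia.
by apply: large; lia.
Qed.
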